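(* Let $\mathrm{J}:\mathbb{N}\to[0,\infty)$ be a summable sequence with $\mathrm{J}(0)=0$, and let $\phi(x)=x_0\sum_{k=1}^\infty \mathrm{J}(k)x_k$ for $x\in X=\{-1,+1\}^{\mathbb{N}}$. If $\phi$ has square summable variations, i.e. if $$\sum_{n=0}^\infty(\operatorname{var}_n\phi)^2<\infty,$$ then for all $0\le\beta<\beta_c(J_{\mathbb{Z}})$ there exists a continuous eigenfunction $h\in C(X)$, $h\neq 0$, of the transfer operator $\mathscr{L}_{\beta\phi}$ with $\mathscr{L}_{\beta\phi}h=\lambda_{\beta\phi}h$, where $\lambda_{\beta\phi}$ is the spectral radius of $\mathscr{L}_{\beta\phi}$, and $h$ is unique up to multiplication by a scalar.
   Context: $\mathbb{N}=\{0,1,2,\dots\}$. The space $X=\{-1,+1\}^{\mathbb{N}}$ has the product topology; $C(X)$ is the space of continuous real functions on $X$. $T:X\to X$ is the left shift $(Tx)_i=x_{i+1}$. For $\psi\in C(X)$ the transfer operator is $\mathscr{L}_\psi f(x)=\sum_{y\in T^{-1}x}e^{\psi(y)}f(y)$, $f\in C(X)$. The $n$th variation of $f:X\to\mathbb{R}$ is $\operatorname{var}_n f=\sup\{|f(y)-f(z)|: y,z\in X,\ y_i=z_i \text{ for } 0\le i<n\}$. Critical value: let $J_{\mathbb{Z}}(ij)=\mathrm{J}(|i-j|)$ for unordered pairs $ij$ of integers. For $\beta\ge0$ let $\mathscr{G}(\beta\Phi_{\mathbb{Z}})$ be the set of two-sided Ising Gibbs measures, i.e. Borel probability measures on $\{-1,+1\}^{\mathbb{Z}}$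 such that for every finite $\Lambda\subset\mathbb{Z}$ the conditional probability of $x_\Lambda$ given $x_{\mathbb{Z}\setminus\Lambda}$ is proportional to $\exp\big(\beta\sum_{ij:\{i,j\}\cap\Lambda\ne\emptyset}J_{\mathbb{Z}}(ij)x_ix_j\big)$, the sum being over unordered pairs $ij$ of integers. Then $\beta_c(J_{\mathbb{Z}})\in[0,\infty]$ is the critical value such that $|\mathscr{G}(\beta\Phi_{\mathbb{Z}})|=1$ for $0\le\beta<\beta_c(J_{\mathbb{Z}})$ and $|\mathscr{G}(\beta\Phi_{\mathbb{Z}})|>1$ for $\beta>\beta_c(J_{\mathbb{Z}})$. *)

(* Defs.v *)
From HB Require Import structures.
From mathcomp Require Import all_boot all_order all_algebra finmap.
From mathcomp Require Import all_classical all_reals all_analysis.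
From mathcomp.real_closed Require Import complex.

Set Implicit Arguments.
Unset Strict Implicit.
Unset Printing Implicit Defensive.
Import Order.TTheory GRing.Theory Num.Theory.
Import numFieldNormedType.Exports.
Local Open Scope classical_set_scope.
Local Open Scope ring_scope.
Local Open Scope complex_scope.

(* The two-point space {-1,+1} is encoded by [bool] with its discrete topology;
   [spin] gives the numerical value. *)
Notation config I := (prod_topology (fun _ : I => bool)).

Definition spin {R : realType} (b : bool) : R := if b then 1 else -1.

Definition left_shift (x : config nat) : config nat := fun i => x i.+1.

(* Valued in the extended reals, so that an unbounded [f] has variation +oo. *)
Definition var {R : realType} (n : nat) (f : config nat -> R) : \bar R :=
  ereal_sup [set r | exists y z : config nat,
    (forall i : nat, (i < n)%N -> y i = z i) /\ r = `|f y - f z|%:E].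

Definition phi {R : realType} (J : nat -> R) (x : config nat) : R :=
  spin (x 0%N) * \big[+%R/0]_(1 <= k <oo) (J k * spin (x k)).

Definition transfer {R : realType} (psi f : config nat -> R) (x : config nat)
    : R :=
  \sum_(y \in left_shift @^-1` [set x]) expR (psi y) * f y.

(* The spectrum of an operator on the real Banach space C(X) is, as usual, that
   of its complexification, which for [transfer psi] is the same formula on
   continuous complex functions. *)
Definition transferC {R : realType} (psi : config nat -> R)
    (f : config nat -> R[i]) (x : config nat) : R[i] :=
  \sum_(y \in left_shift @^-1` [set x]) (expR (psi y))%:C * f y.

(* [R[i]^o] carries the topology of the complex modulus. *)
Definition continuousC {R : realType} {T : topologicalType} (f : T -> R[i])
    : Prop :=
  continuous (f : T -> R[i]^o).

(* [S] acts as a bounded linear operator on C(T, R[i]) with the sup norm; its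
   values on discontinuous functions are irrelevant. *)
Definition bounded_operator {R : realType} {T : topologicalType}
    (S : (T -> R[i]) -> (T -> R[i])) : Prop :=
  [/\ forall f : T -> R[i], continuousC f -> continuousC (S f),
      forall (a : R[i]) (f g : T -> R[i]), continuousC f -> continuousC g ->
        forall x, S (fun t => a * f t + g t) x = a * S f x + S g x &
      exists M : R, forall (f : T -> R[i]) (B : R), continuousC f ->
        (forall t, Normc.normc (f t) <= B) ->
        forall x, Normc.normc (S f x) <= M * B].

Definition spectrum {R : realType} {T : topologicalType}
    (A : (T -> R[i]) -> (T -> R[i])) : set R[i] :=
  [set z | ~ exists S : (T -> R[i]) -> (T -> R[i]),
    [/\ bounded_operator S,
        forall f : T -> R[i], continuousC f ->
          forall x, S (fun t => z * f t - A f t) x = f x &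
        forall f : T -> R[i], continuousC f ->
          forall x, z * S f x - A (S f) x = f x]].

Definition spectral_radius {R : realType} {T : topologicalType}
    (A : (T -> R[i]) -> (T -> R[i])) : R :=
  sup [set Normc.normc z | z in spectrum A].

(* Unconditional sum over [D] of an absolutely summable real family. *)
Definition unordered_sum {R : realType} {I : choiceType} (D : set I)
    (f : I -> R) : R :=
  fine (\esum_(i in D) (Num.max (f i) 0)%:E)
  - fine (\esum_(i in D) (Num.max (- f i) 0)%:E).

(* An unordered pair of distinct integers is represented by (i, j) with i < j;
   when J(0) = 0 the diagonal pairs contribute nothing. *)
Definition energy {R : realType} (J : nat -> R) (L : {fset int})
    (x : config int) : R :=
  unordered_sum
    [set p : int * int | p.1 < p.2 /\ ((p.1 \in L) || (p.2 \in L))]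
    (fun p => J `|p.1 - p.2|%N * (spin (x p.1) * spin (x p.2))).

(* [s] on [L], [x] off [L] *)
Definition glue (L : {fset int}) (s : {ffun L -> bool}) (x : config int)
    : config int :=
  fun i => if insub i is Some k then s k else x i.

Definition gibbs_kernel {R : realType} (J : nat -> R) (beta : R)
    (L : {fset int}) (s : {ffun L -> bool}) (x : config int) : R :=
  expR (beta * energy J L (glue s x)) /
  \sum_(t : {ffun L -> bool}) expR (beta * energy J L (glue t x)).

Notation borel_config := (g_sigma_algebraType (@open (config int))).

Definition cylinder (L : {fset int}) (s : {ffun L -> bool})
    : set borel_config :=
  [set x | forall k : L, x (val k) = s k].

(* The sigma-algebra generated by the coordinates outside [L] *)
Definition outside (L : {fset int}) : set (set borel_config) :=
  <<s [set A | exists (i : int) (b : bool),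
         i \notin L /\ A = [set x : borel_config | x i = b]] >>.

(* [gibbs_kernel J beta s] is a version of the conditional probability of
   x_L = s given the coordinates outside L. *)
Definition gibbs {R : realType} (J : nat -> R) (beta : R)
    (mu : probability borel_config R) : Prop :=
  forall (L : {fset int}) (s : {ffun L -> bool}) (A : set borel_config),
    outside L A ->
    mu (A `&` cylinder s) = (\int[mu]_(x in A) (gibbs_kernel J beta s x)%:E)%E.

(* A [probability] is a function on all sets; two of them are the same Borel
   measure when they agree on measurable sets. *)
Definition unique_gibbs {R : realType} (J : nat -> R) (beta : R) : Prop :=
  exists mu : probability borel_config R, gibbs J beta mu /\
    forall nu : probability borel_config R, gibbs J beta nu ->
    forall A, measurable A -> nu A = mu A.

Definition several_gibbs {R : realType} (J : nat -> R) (beta : R) : Prop :=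
  exists mu nu : probability borel_config R,
    [/\ gibbs J beta mu, gibbs J beta nu &
        exists2 A, measurable A & mu A <> nu A].

Definition is_critical {R : realType} (J : nat -> R) (bc : \bar R) : Prop :=
  [/\ (0 <= bc)%E,
      forall b : R, 0 <= b -> (b%:E < bc)%E -> unique_gibbs J b &
      forall b : R, (bc < b%:E)%E -> several_gibbs J b].

(* The supremum makes this total without presupposing that a value as in
   [is_critical] exists; if there is one, it is this one ([is_critical_eq]). *)
Definition critical_value {R : realType} (J : nat -> R) : \bar R :=
  ereal_sup [set bc : \bar R | (0 <= bc)%E /\
    forall b : R, 0 <= b -> (b%:E < bc)%E -> unique_gibbs J b].

Lemma is_critical_eq {R : realType} (J : nat -> R) (bc : \bar R) :
  is_critical J bc -> bc = critical_value J.
Proof.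
move=> [bc0 uni sev]; apply/eqP; rewrite eq_le; apply/andP; split.
  by apply: ereal_sup_ubound; split.
apply: ge_ereal_sup => u [u0 uniu]; rewrite leNgt; apply/negP => bcu.
have [b bcb bu] : exists2 b : R, (bc < b%:E)%E & (b%:E < u)%E.
  case: bc bc0 bcu {uni sev} => [r| |] //= _; last by rewrite ltNge leey.
  case: u {u0 uniu} => [s| |] //=.
    rewrite lte_fin => rs; exists ((r + s) / 2%:R); rewrite lte_fin.
      exact: (midf_lt rs).1.
    exact: (midf_lt rs).2.
  by move=> _; exists (r + 1); rewrite ?ltry// lte_fin ltrDl.
have b0 : 0 <= b by rewrite -lee_fin; exact: le_trans bc0 (ltW bcb).
have [m [n [gm gn [A mA]]]] := sev b bcb.
have [k [_ kE]] := uniu b b0 bu.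
by rewrite (kE m gm A mA) (kE n gn A mA).
Qed.

(* Main.v *)
(** Idea. Up to the factor [2^n], [transfer^n 1 (x)] is the partition function of
    the Ising model on [0, n[ in the field that the half-line configuration [x],
    placed at n, n + 1, etc., exerts from the right; at site [k] this field is
    at most [beta * r(n - k)], where [r] is the tail of J, and square summability of
    the variations of phi means that [r] is square summable.  When two
    configurations agree on [0, m[, Jensen's inequality together with a comparison of
    one-point functions bounds the logarithm of the ratio of the two partition
    functions by a bilinear form in the tails whose kernel is the zero-field
    two-point function.  If the susceptibility is finite this form is bounded on
    l^2, so the logarithms of [transfer^n 1] are equicontinuous, uniformly in [n],
    and the Cesaro means of [lambda^-n transfer^n 1] have a continuous positive
    limit point, which is the eigenfunction.  Uniqueness is the maximum principle;
    the Neumann series, dominated by the positive eigenfunction, identifies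
    [lambda] with the spectral radius.

    Finite susceptibility below [beta_c] is the sharpness argument of
    Duminil-Copin and Tassion: either some finite S has [phiS beta S < 1], and then
    Simon-Lieb's inequality iterates to a finite susceptibility, or a differential
    inequality keeps the magnetization with plus boundary condition away from 0
    at all larger inverse temperatures, so that the plus and the minus states
    are distinct Gibbs measures there. *)

From HB Require Import structures.
Require Import Defs.
From mathcomp Require Import all_boot all_order all_algebra finmap.
From mathcomp Require Import all_classical all_reals all_analysis.
From mathcomp.real_closed Require Import complex.
From mathcomp Require Import ring lra zify.
Set Implicit Arguments.
Unset Strict Implicit.
Unset Printing Implicit Defensive.
Import Order.TTheory GRing.Theory Num.Theory.
Import numFieldNormedType.Exports.
Local Open Scope classical_set_scope.
Local Open Scope ring_scope.

(** * Averages over finitely many spins *)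

(** The transfer operator lives on a half-line, while [critical_value] belongs to the two-sided
    model. No comparison of critical points is needed: the susceptibility is bounded uniformly over
    all finite subsets of Z with free boundary condition, and an interval is one of them. Such a
    bound asks for Simon's inequality in Lieb's form, where the first correlation is computed inside
    [S] alone. It follows from the Gaussian inequality, and the same expansion bounds a one-point
    function by the field times zero-field two-point functions. The differential inequality for the
    magnetization is also proved with two replicas: the field is expanded site by site until the
    origin has joined the plus boundary or no field is left. Positivity has one source throughout:
    polynomials in the spins with nonnegative coefficients have nonnegative means, if necessary
    after the substitution y = t x between two replicas. Infinite-volume states, the eigenfunction
    and the resolvent are limits along an ultrafilter, for which boundedness suffices; neither
    monotonicity in the volume nor a choice of subsequences enters. *)

Section Average.
Context {R : realType} {I : eqType}.
Implicit Types (x y t : I -> bool) (l A : seq I) (f g : (I -> bool) -> R).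

Definition upd x i b : I -> bool := fun j => if j == i then b else x j.

Definition avg1 i f x : R := (f (upd x i true) + f (upd x i false)) / 2.

(** The result is still a function of the whole configuration, so that averages nest and commute and
    the spins off [l] remain available as a boundary condition. *)
Definition avg l f : (I -> bool) -> R := foldr avg1 f l.

(* Sites that are not averaged over have spin +. *)
Definition mean l f : R := avg l f (fun=> true).

(** The pointwise product of two spin configurations: [t i == x i] is true exactly when the product
    of the two signs is +1. *)
Definition flip t x : I -> bool := fun i => t i == x i.

Lemma updE x i b : upd x i b i = b.
Proof. by rewrite /upd eqxx. Qed.

Lemma upd_neq x i b j : j != i -> upd x i b j = x j.
Proof. by rewrite /upd => /negPf ->. Qed.

Lemma upd_upd x i b c : upd (upd x i b) i c = upd x i c.
Proof. by apply/funext => j; rewrite /upd; case: eqP. Qed.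

Lemma updC x i j b c : i != j -> upd (upd x i b) j c = upd (upd x j c) i b.
Proof.
move=> ij; apply/funext => k; rewrite /upd.
by case: (eqVneq k j) => // ->; rewrite eq_sym (negPf ij).
Qed.

Lemma avg1D i f g : avg1 i (fun x => f x + g x) = fun x => avg1 i f x + avg1 i g x.
Proof. by apply/funext => x; rewrite /avg1; field. Qed.

Lemma avgD l f g x : avg l (fun x => f x + g x) x = avg l f x + avg l g x.
Proof.
suff -> : avg l (fun x => f x + g x) = (fun x => avg l f x + avg l g x) by [].
by elim: l => //= i l ->; rewrite avg1D.
Qed.

Definition indep A f := forall x i b, i \in A -> f (upd x i b) = f x.

Lemma avg1Mr i f g : (forall x b, g (upd x i b) = g x) ->
  avg1 i (fun x => f x * g x) = fun x => avg1 i f x * g x.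
Proof. by move=> ig; apply/funext => x; rewrite /avg1 !ig; field. Qed.

Lemma avgMr l f g x : indep l g ->
  avg l (fun x => f x * g x) x = avg l f x * g x.
Proof.
move=> ig.
suff -> : avg l (fun x => f x * g x) = (fun x => avg l f x * g x) by [].
elim: l ig => //= i l IH ig; rewrite IH ?avg1Mr // => [y b|y j b jl].
  by rewrite ig ?mem_head.
by rewrite ig // inE jl orbT.
Qed.

Lemma avgMl l f g x : indep l g ->
  avg l (fun x => g x * f x) x = g x * avg l f x.
Proof.
by move=> ig; rewrite mulrC -avgMr //; congr avg; apply/funext => y; rewrite mulrC.
Qed.

Lemma avgZ l c f x : avg l (fun x => c * f x) x = c * avg l f x.
Proof. by rewrite (@avgMl l f (fun=> c)). Qed.

Lemma avgN l f x : avg l (fun x => - f x) x = - avg l f x.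
Proof. by rewrite -mulN1r -avgZ; congr avg; apply/funext => y; rewrite mulN1r. Qed.

Lemma avgB l f g x : avg l (fun x => f x - g x) x = avg l f x - avg l g x.
Proof. by rewrite avgD avgN. Qed.

Lemma avg_cst l c x : avg l (fun=> c) x = c.
Proof. by elim: l x => //= i l IH x; rewrite /avg1 !IH; field. Qed.

Lemma avg_id l f x : indep l f -> avg l f x = f x.
Proof.
move=> il; rewrite -[RHS]mulr1 -(avg_cst l 1 x) -avgMl //.
by congr avg; apply/funext => y; rewrite mulr1.
Qed.

Lemma avg1_avg1 i j f : avg1 i (avg1 j f) = avg1 j (avg1 i f).
Proof.
have [->//|ij] := eqVneq i j; apply/funext => x; rewrite /avg1.
by rewrite !(updC _ _ _ ij); field.
Qed.

Lemma avg1_avg i l f : avg1 i (avg l f) = avg l (avg1 i f).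
Proof. by elim: l => //= j l IH; rewrite avg1_avg1 IH. Qed.

Lemma avg_cat l l' f : avg (l ++ l') f = avg l (avg l' f).
Proof. by rewrite /avg foldr_cat. Qed.

Lemma avgC l l' f : avg l (avg l' f) = avg l' (avg l f).
Proof. by elim: l => //= i l ->; rewrite avg1_avg. Qed.

Lemma indep_avg l f : indep l (avg l f).
Proof.
elim: l => [//|i l IH] x j b; rewrite inE => /orP[/eqP ->|jl]; rewrite -[avg _ _]/(avg1 i (avg l f)).
  by rewrite /avg1 !upd_upd.
have [->|ji] := eqVneq j i; first by rewrite /avg1 !upd_upd.
by rewrite /avg1 !(updC x b _ ji) !(IH _ _ _ jl).
Qed.

Lemma indep_sub A l f : {subset l <= A} -> indep A f -> indep l f.
Proof. by move=> s h x i b il; apply: h; apply: s. Qed.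

(** The tower property of conditional expectations; the consistency of the Gibbs kernels rests on
    it. *)
Lemma avg_sub A l f : {subset l <= A} -> avg A (avg l f) = avg A f.
Proof.
move=> lA; rewrite avgC; apply/funext => x; rewrite avg_id //.
exact/(indep_sub lA)/indep_avg.
Qed.

(** Each of the two averages absorbs the other, and they commute. Hence order and repetitions in the
    list of sites are irrelevant. *)
Lemma avg_perm l l' f : {subset l <= l'} -> {subset l' <= l} -> avg l f = avg l' f.
Proof. by move=> s s'; rewrite -(avg_sub _ s) avgC avg_sub. Qed.

Lemma mean_perm l l' f : {subset l <= l'} -> {subset l' <= l} -> mean l f = mean l' f.
Proof. by move=> s s'; rewrite /mean (avg_perm _ s s'). Qed.

Lemma avg_eqx l f g x :
  (forall y, (forall i, i \notin l -> y i = x i) -> f y = g y) ->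
  avg l f x = avg l g x.
Proof.
elim: l x => [|i l IH] x h /=; first exact: h.
rewrite /avg1; congr ((_ + _) / _); apply: IH => y hy; apply: h => j;
  by rewrite inE negb_or => /andP[ji jl]; rewrite hy // upd_neq.
Qed.

Lemma avg_le l f g x :
  (forall y, (forall i, i \notin l -> y i = x i) -> f y <= g y) ->
  avg l f x <= avg l g x.
Proof.
elim: l x => [|i l IH] x h /=; first exact: h.
rewrite /avg1 ler_pM2r // lerD //; apply: IH => y hy; apply: h => j;
  by rewrite inE negb_or => /andP[ji jl]; rewrite hy // upd_neq.
Qed.

Lemma avg_indep l f x y : (forall i, i \notin l -> x i = y i) -> avg l f x = avg l f y.
Proof.
elim: l x y => [|i l IH] x y xy /=; first by congr f; apply/funext => i; exact: xy.
rewrite /avg1; congr ((_ + _) / _); apply: IH => j jl; rewrite /upd;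
  by case: eqVneq => // ji; apply: xy; rewrite inE negb_or ji.
Qed.

Lemma avg_flip l f t x : avg l (fun x => f (flip t x)) x = avg l f (flip t x).
Proof.
elim: l x => //= i l IH x; rewrite /avg1 !IH.
have E b : flip t (upd x i b) = upd (flip t x) i (t i == b).
  by apply/funext => j; rewrite /flip /upd; case: ifP => // /eqP ->.
by rewrite !E eqb_id eqbF_neg; case: (t i) => //=; rewrite addrC.
Qed.

Lemma flipC t x : flip t x = flip x t.
Proof. by apply/funext => i; rewrite /flip eq_sym. Qed.

Lemma mean_flip l f t : (forall i, i \notin l -> t i) ->
  mean l (fun x => f (flip t x)) = mean l f.
Proof.
move=> tl; rewrite /mean avg_flip; apply: avg_indep => i il.
by rewrite /flip tl.
Qed.

Lemma mean_ge0 l f : (forall x, (forall i, i \notin l -> x i) -> 0 <= f x) -> 0 <= mean l f.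
Proof.
move=> h; rewrite -(avg_cst l 0 (fun=> true)); apply: avg_le => y hy.
by apply: h => i il; rewrite hy.
Qed.

Lemma meanD l f g : mean l (fun x => f x + g x) = mean l f + mean l g.
Proof. exact: avgD. Qed.
Lemma meanB l f g : mean l (fun x => f x - g x) = mean l f - mean l g.
Proof. exact: avgB. Qed.
Lemma meanN l f : mean l (fun x => - f x) = - mean l f.
Proof. exact: avgN. Qed.
Lemma meanZ l c f : mean l (fun x => c * f x) = c * mean l f.
Proof. exact: avgZ. Qed.

Lemma avg_sum (J : Type) (s : seq J) l (F : J -> (I -> bool) -> R) x :
  avg l (fun y => \sum_(j <- s) F j y) x = \sum_(j <- s) avg l (F j) x.
Proof.
elim: s => [|j s IH].
  by rewrite big_nil -[RHS](avg_cst l 0 x); congr avg; apply/funext => y; rewrite big_nil.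
by rewrite big_cons -IH -avgD; congr avg; apply/funext => y; rewrite big_cons.
Qed.

Lemma mean_sum (J : Type) (s : seq J) l (F : J -> (I -> bool) -> R) :
  mean l (fun y => \sum_(j <- s) F j y) = \sum_(j <- s) mean l (F j).
Proof. exact: avg_sum. Qed.

End Average.

Lemma mean_ext {R : realType} {I : eqType} (l : seq I) (f g : (I -> bool) -> R) :
  (forall x, f x = g x) -> mean l f = mean l g.
Proof. by move=> fg; congr mean; apply/funext. Qed.

Arguments mean_ext {R I l f g}.

Lemma avg_fubini {R : realType} {I I' : eqType} (l : seq I) (l' : seq I')
    (F : (I -> bool) -> (I' -> bool) -> R) x y :
  avg l (fun x => avg l' (F x) y) x = avg l' (fun y => avg l (F^~ y) x) y.
Proof.
elim: l x => //= i l IH x; rewrite /avg1 !IH -avgD mulrC -avgZ.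
by congr avg; apply/funext => z; rewrite mulrC.
Qed.

Lemma avg_map {R : realType} {I I' : eqType} (h : I -> I') (l : seq I)
    (f : (I -> bool) -> R) z : injective h ->
  avg (map h l) (fun z => f (z \o h)) z = avg l f (z \o h).
Proof.
move=> hi; elim: l z => //= i l IH z; rewrite /avg1 !IH.
have E b : upd z (h i) b \o h = upd (z \o h) i b.
  by apply/funext => j /=; rewrite /upd (inj_eq hi).
by rewrite !E.
Qed.

Lemma mean_map {R : realType} {I I' : eqType} (h : I -> I') (l : seq I)
    (f : (I -> bool) -> R) : injective h ->
  mean (map h l) (fun z => f (z \o h)) = mean l f.
Proof. by move=> hi; rewrite /mean avg_map. Qed.

(* Two replicas live on the index type I + I. *)
Definition dbl {I : Type} (l : seq I) : seq (I + I) := map inl l ++ map inr l.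
Definition pair_conf {I : Type} (x y : I -> bool) : I + I -> bool :=
  fun i => match i with inl i => x i | inr i => y i end.

Lemma mean_dbl {R : realType} {I : eqType} (l : seq I) (F : (I + I -> bool) -> R) :
  mean (dbl l) F = mean l (fun x => mean l (fun y => F (pair_conf x y))).
Proof.
have inl_inj : injective (@inl I I) by move=> ? ? [].
have inr_inj : injective (@inr I I) by move=> ? ? [].
have pE (z : I + I -> bool) : z = pair_conf (z \o inl) (z \o inr) by apply/funext => -[].
rewrite /mean avg_cat.
have E1 z : avg (map inr l) F z = avg l (fun y => F (pair_conf (z \o inl) y)) (z \o inr).
  rewrite -(avg_map _ _ _ inr_inj); apply: avg_eqx => y hy.
  rewrite {1}(pE y); congr (F (pair_conf _ _)); apply/funext => i /=.
  by rewrite hy //; apply/mapP => -[].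
rewrite -(avg_map _ _ (fun=> true) inl_inj); apply: avg_eqx => y hy.
rewrite E1; congr avg; apply/funext => i /=; rewrite hy //.
by apply/mapP => -[].
Qed.

(** * Griffiths inequalities *)

Section Cone.
Context {R : realType} {I : eqType}.
Implicit Types (x y t : I -> bool) (l A B : seq I) (f g H : (I -> bool) -> R).

Definition mono A x : R := \prod_(i <- A) spin (x i).

(* Closed under products, exponentials and partial averages, whence Griffiths' inequalities. *)
Inductive pos : ((I -> bool) -> R) -> Prop :=
| pos_mono c A : 0 <= c -> pos (fun x => c * mono A x)
| posD f g : pos f -> pos g -> pos (fun x => f x + g x).

Lemma pos_eq f g : pos f -> (forall x, f x = g x) -> pos g.
Proof. by move=> pf /funext <-. Qed.

Lemma mono_cat A B x : mono (A ++ B) x = mono A x * mono B x.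
Proof. by rewrite /mono big_cat. Qed.

Lemma mono_cons i A x : mono (i :: A) x = spin (x i) * mono A x.
Proof. by rewrite /mono big_cons. Qed.

Lemma mono0 x : mono [::] x = 1.
Proof. by rewrite /mono big_nil. Qed.

Lemma mono1 i x : mono [:: i] x = spin (x i).
Proof. by rewrite mono_cons mono0 mulr1. Qed.

Lemma spin2 b : spin b * spin b = 1 :> R.
Proof. by case: b; rewrite /spin ?mulr1 // mulrNN mulr1. Qed.

Lemma spin_eq b c : spin (b == c) = spin b * spin c :> R.
Proof. by case: b c => -[]; rewrite /spin /= ?mulrNN ?mulr1 ?mul1r. Qed.

Lemma mono_flip A t x : mono A (flip t x) = mono A t * mono A x.
Proof. by rewrite /mono -big_split; apply: eq_bigr => i _ /=; rewrite /flip spin_eq. Qed.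

Lemma mono_pm A x : mono A x = 1 \/ mono A x = -1.
Proof.
elim: A => [|i A [] IH]; [by left; rewrite mono0|..];
  by rewrite mono_cons IH; case: (x i); rewrite /spin; lra.
Qed.

Lemma mono_le1 A x : mono A x <= 1.
Proof. by case: (mono_pm A x) => ->; lra. Qed.

Lemma mono_geN1 A x : -1 <= mono A x.
Proof. by case: (mono_pm A x) => ->; lra. Qed.

Lemma mono_true A : mono A (fun=> true) = 1.
Proof. by rewrite /mono big1 // => i _; rewrite /spin. Qed.

Lemma pos_monom A : pos (mono A).
Proof. by apply: (pos_eq (@pos_mono 1 A ler01)) => x; rewrite mul1r. Qed.

Lemma pos_cst c : 0 <= c -> pos (fun=> c).
Proof. by move=> c0; apply: (pos_eq (@pos_mono c [::] c0)) => x; rewrite mono0 mulr1. Qed.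

Lemma pos_spin i : pos (fun x => spin (x i)).
Proof. by apply: (pos_eq (pos_monom [:: i])) => x; rewrite mono1. Qed.

Lemma posM f g : pos f -> pos g -> pos (fun x => f x * g x).
Proof.
elim=> [c A c0|f1 f2 _ IH1 _ IH2] pg.
  elim: pg => [d B d0|g1 g2 _ IH1 _ IH2].
    apply: (pos_eq (@pos_mono (c * d) (A ++ B) (mulr_ge0 c0 d0))) => x.
    by rewrite mono_cat; ring.
  by apply: (pos_eq (posD IH1 IH2)) => x; ring.
by apply: (pos_eq (posD (IH1 pg) (IH2 pg))) => x; ring.
Qed.

Lemma posZ c f : 0 <= c -> pos f -> pos (fun x => c * f x).
Proof. by move=> c0; apply: posM; apply: pos_cst. Qed.

Lemma pos_sum (J : eqType) (s : seq J) (F : J -> (I -> bool) -> R) :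
  (forall j, j \in s -> pos (F j)) -> pos (fun x => \sum_(j <- s) F j x).
Proof.
elim: s => [|j s IH] h.
  by apply: (pos_eq (@pos_cst 0 _)) => // x; rewrite big_nil.
have pj : pos (F j) by apply: h; rewrite mem_head.
apply: (pos_eq (posD pj (IH _))) => [k ks|x]; last by rewrite big_cons.
by apply: h; rewrite inE ks orbT.
Qed.

Lemma pos_prod (J : eqType) (s : seq J) (F : J -> (I -> bool) -> R) :
  (forall j, j \in s -> pos (F j)) -> pos (fun x => \prod_(j <- s) F j x).
Proof.
elim: s => [|j s IH] h.
  by apply: (pos_eq (@pos_cst 1 _)) => // x; rewrite big_nil.
have pj : pos (F j) by apply: h; rewrite mem_head.
apply: (pos_eq (posM pj (IH _))) => [k ks|x]; last by rewrite big_cons.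
by apply: h; rewrite inE ks orbT.
Qed.

Definition ch (c : R) : R := (expR c + expR (- c)) / 2.
Definition sh (c : R) : R := (expR c - expR (- c)) / 2.

Lemma ch_gt0 c : 0 < ch c.
Proof. by rewrite /ch divr_gt0 // addr_gt0 // expR_gt0. Qed.

Lemma sh_ge0 c : 0 <= c -> 0 <= sh c.
Proof.
move=> c0; rewrite /sh divr_ge0 // subr_ge0 ler_expR.
by rewrite (le_trans _ c0) // oppr_le0.
Qed.

Lemma expR_mono c A x : expR (c * mono A x) = ch c + sh c * mono A x.
Proof. by rewrite /ch /sh; case: (mono_pm A x) => ->; rewrite ?mulrN ?mulr1; field. Qed.

Lemma pos_exp f : pos f -> pos (fun x => expR (f x)).
Proof.
elim=> [c A c0|f1 f2 _ IH1 _ IH2].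
  have := posD (pos_cst (ltW (ch_gt0 c))) (pos_mono A (sh_ge0 c0)).
  by move/pos_eq; apply => x; rewrite expR_mono.
by apply: (pos_eq (posM IH1 IH2)) => x; rewrite expRD.
Qed.

Lemma pos_true f : pos f -> 0 <= f (fun=> true).
Proof. by elim=> [c A c0|f1 f2 _ ? _ ?]; rewrite ?mono_true ?mulr1 // addr_ge0. Qed.

(** The average over one spin kills the monomials of odd degree in it and erases it from those of
    even degree. *)
Lemma pos_avg1 i f : pos f -> pos (avg1 i f).
Proof.
elim=> [c A c0|f1 f2 _ IH1 _ IH2]; last first.
  by apply: (pos_eq (posD IH1 IH2)) => x; rewrite /avg1; field.
suff : pos (avg1 i (mono A)).
  by move=> h; apply: (pos_eq (posZ c0 h)) => x; rewrite /avg1; field.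
(* [b] is the parity of the number of occurrences of [i] in [A], and [B] is [A] without them. *)
suff [b [B E]] : exists b B, forall x, mono A x = (if b then spin (x i) else 1) * mono B x
    /\ i \notin B.
  have iB : i \notin B by have [] := E (fun=> true).
  have Bi x b' : mono B (upd x i b') = mono B x.
    rewrite /mono; apply: eq_big_seq => j jB; congr spin; rewrite upd_neq //.
    by apply: contraNneq iB => <-.
  have {}E x : mono A x = (if b then spin (x i) else 1) * mono B x by have [] := E x.
  case: b E => E.
    apply: (pos_eq (@pos_cst 0 _)) => // x.
    by rewrite /avg1 !E !Bi !updE /spin; field.
  by apply: (pos_eq (pos_monom B)) => x; rewrite /avg1 !E !Bi; field.
elim: A => [|j A [b [B E]]]; first by exists false, [::] => x; rewrite mul1r.
have [->|ji] := eqVneq j i.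
  exists (~~ b), B => x; have [E1 iB] := E x; split => //.
  by rewrite mono_cons E1; case: (b); rewrite /= ?mul1r ?mulrA ?spin2 ?mul1r.
exists b, (j :: B) => x; have [E1 iB] := E x; split.
  by rewrite !mono_cons E1; ring.
by rewrite inE negb_or eq_sym ji.
Qed.

Lemma pos_avg l f : pos f -> pos (avg l f).
Proof. by move=> pf; elim: l => //= i l IH; apply: pos_avg1. Qed.

Lemma griffiths1 l f : pos f -> 0 <= mean l f.
Proof. by move=> pf; apply/pos_true/pos_avg. Qed.

(** For fixed [t], each coefficient is multiplied by [1 + mono A t], which is 0 or 2. *)
Lemma pos_replica H t : pos H -> pos (fun x => H x + H (flip t x)).
Proof.
elim=> [c A c0|f1 f2 _ IH1 _ IH2].
  have p1 : 0 <= 1 + mono A t by have := mono_geN1 A t; lra.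
  apply: (pos_eq (@pos_mono (c * (1 + mono A t)) A (mulr_ge0 c0 p1))) => x.
  by rewrite mono_flip; ring.
by apply: (pos_eq (posD IH1 IH2)) => x; ring.
Qed.

(* The change of variables y = flip t x, for x fixed, between two replicas. *)
Lemma mean_replica l (F : (I -> bool) -> (I -> bool) -> R) :
  mean l (fun x => mean l (F x)) = mean l (fun t => mean l (fun x => F x (flip t x))).
Proof.
rewrite [RHS]avg_fubini; apply: avg_eqx => x hx.
rewrite -/(mean l (F x)) -(@mean_flip _ _ l (F x) x); last by move=> i /hx ->.
by apply: mean_ext => t; rewrite flipC.
Qed.

Lemma mean_mul l f g : mean l f * mean l g = mean l (fun x => mean l (fun y => f x * g y)).
Proof. by rewrite mulrC -meanZ; apply: mean_ext => x; rewrite mulrC -meanZ. Qed.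

(** Ginibre's duplication. By bilinearity [f] and [g] are monomials; the difference of the two sides
    is a double mean of s_A (s_B - s'_B), and for s' = t s this is [1 - mono B t] times the mean of
    a member of the cone. *)
Lemma griffiths2 l H f g : pos H -> pos f -> pos g ->
  mean l (fun x => f x * expR (H x)) * mean l (fun x => g x * expR (H x)) <=
  mean l (fun x => f x * g x * expR (H x)) * mean l (fun x => expR (H x)).
Proof.
move=> pH pf pg.
elim: pf => [a A a0|f1 f2 _ IH1 _ IH2]; last first.
  rewrite (mean_ext (g := fun x => f1 x * expR (H x) + f2 x * expR (H x))); last first.
    by move=> x; ring.
  rewrite [X in _ <= X * _](mean_ext
    (g := fun x => f1 x * g x * expR (H x) + f2 x * g x * expR (H x))); last first.
    by move=> x; ring.
  by rewrite !meanD !mulrDl lerD.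
elim: pg => [b B b0|g1 g2 _ IH1 _ IH2]; last first.
  rewrite [X in _ * X <= _](mean_ext
    (g := fun x => g1 x * expR (H x) + g2 x * expR (H x))); last by move=> x; ring.
  rewrite [X in _ <= X * _](mean_ext (g := fun x => a * mono A x * g1 x * expR (H x)
    + a * mono A x * g2 x * expR (H x))); last by move=> x; ring.
  by rewrite !meanD mulrDr mulrDl lerD.
rewrite -subr_ge0 !mean_mul -meanB.
rewrite (mean_ext (g := fun x => mean l (fun y =>
  a * b * (mono A x * (mono B x - mono B y) * expR (H x + H y))))); last first.
  by move=> x; rewrite -meanB; apply: mean_ext => y; rewrite expRD; ring.
rewrite mean_replica; apply: mean_ge0 => t _.
rewrite (mean_ext (g := fun x => a * b * (1 - mono B t) *
    (mono A x * mono B x * expR (H x + H (flip t x))))); last first.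
  by move=> x; rewrite mono_flip; ring.
rewrite meanZ mulr_ge0 ?mulr_ge0 ?subr_ge0 ?mono_le1 //.
by apply/griffiths1/posM/pos_exp/pos_replica => //; apply: posM; apply: pos_monom.
Qed.

Lemma mean_exp_gt0 l H : 0 < mean l (fun x => expR (H x)).
Proof.
rewrite /mean; elim: l (fun=> true) => [|i l IH] x /=; first exact: expR_gt0.
by rewrite /avg1 divr_gt0 // addr_gt0 // IH.
Qed.

Definition gibbs_mean l H f : R :=
  mean l (fun x => f x * expR (H x)) / mean l (fun x => expR (H x)).

Lemma gibbs_mean_ge0 l H f : pos H -> pos f -> 0 <= gibbs_mean l H f.
Proof.
move=> pH pf; apply: divr_ge0; last exact/ltW/mean_exp_gt0.
exact/griffiths1/posM/pos_exp.
Qed.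

Lemma gibbs_mean_le l H f c : (forall x, f x <= c) -> gibbs_mean l H f <= c.
Proof.
move=> fc; rewrite ler_pdivrMr ?mean_exp_gt0 // -meanZ; apply: avg_le => x _.
by rewrite ler_wpM2r // expR_ge0.
Qed.

(** Griffiths' second inequality for [f] and [exp g], both of which lie in the cone. *)
Lemma gibbs_mean_incr l H g f : pos H -> pos g -> pos f ->
  gibbs_mean l H f <= gibbs_mean l (fun x => H x + g x) f.
Proof.
move=> pH pg pf; rewrite /gibbs_mean ler_pdivrMr ?mean_exp_gt0 // mulrAC.
rewrite ler_pdivlMr ?mean_exp_gt0 //.
have := griffiths2 l pH pf (pos_exp pg).
by congr (_ <= _); [congr (_ * _)|congr (_ * _)]; apply: mean_ext => x;
  rewrite ?expRD; ring.
Qed.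

End Cone.
Arguments mono {R I}.

(** * The Gaussian inequality *)

Section Gaussian.
Context {R : realType} {I : eqType}.
Implicit Types (x y : I -> bool) (z : I + I -> bool) (V B D xs : seq I).
Implicit Types (E : seq (R * (I * I))).

Lemma spin_pm (b : bool) : spin b = 1 :> R \/ spin b = -1 :> R.
Proof. by case: b; [left|right]. Qed.

Lemma expR_pm (c s : R) : s = 1 \/ s = -1 -> expR (c * s) = ch c + sh c * s.
Proof. by rewrite /ch /sh; case=> ->; rewrite ?mulrN ?mulr1; field. Qed.

Lemma ch_ge1 (c : R) : 1 <= ch c.
Proof. by have := expR_ge1Dx c; have := expR_ge1Dx (- c); rewrite /ch; lra. Qed.

(** The energy is carried by a list of weighted edges so that inductions can remove one edge at a
    time. *)
Definition ham E x : R := \sum_(e <- E) e.1 * (spin (x e.2.1) * spin (x e.2.2)).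

Definition ham2 E z : R := ham E (z \o inl) + ham E (z \o inr).

Definition sl (i : I) z : R := spin (z (inl i)).
Definition sr (i : I) z : R := spin (z (inr i)).
Definition tau (i : I) z : R := sl i z * sr i z.
Definition monol B z : R := \prod_(i <- B) sl i z.
(* For [o] in [D], the indicator that tau is constant on [D]. *)
Definition agree o D z : R := \prod_(v <- D) ((1 + tau o z * tau v z) / 2).

Lemma pos_ham E : (forall e, e \in E -> 0 <= e.1) -> pos (ham E).
Proof.
move=> E0; apply: pos_sum => e eE.
apply: (pos_eq (@pos_mono _ _ e.1 [:: e.2.1; e.2.2] (E0 e eE))) => x.
by rewrite mono_cons mono1.
Qed.

Lemma pos_comp (J : eqType) (h : I -> J) (f : (I -> bool) -> R) :
  pos f -> pos (fun z : J -> bool => f (z \o h)).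
Proof.
elim=> [c A c0|f1 f2 _ IH1 _ IH2]; last exact: posD.
apply: (pos_eq (pos_mono (map h A) c0)) => z.
by rewrite /mono big_map.
Qed.

Lemma pos_ham2 E : (forall e, e \in E -> 0 <= e.1) -> pos (ham2 E).
Proof. by move=> /pos_ham h; apply: posD; apply: pos_comp. Qed.

Lemma pos_sl i : pos (sl i). Proof. exact: pos_spin. Qed.
Lemma pos_sr i : pos (sr i). Proof. exact: pos_spin. Qed.
Lemma pos_tau i : pos (tau i).
Proof. by apply: posM; [apply: pos_sl|apply: pos_sr]. Qed.
Lemma pos_monol B : pos (monol B).
Proof. by apply: pos_prod => i _; apply: pos_sl. Qed.

Lemma pos_agree1 o v : pos (fun z => (1 + tau o z * tau v z) / 2).
Proof.
apply: (pos_eq (posZ (_ : 0 <= 2^-1) (posD (pos_cst ler01) (posM (pos_tau o) (pos_tau v))))).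
  by rewrite invr_ge0.
by move=> z; rewrite mulrC.
Qed.

Lemma pos_agree o D : pos (agree o D).
Proof. by apply: pos_prod => i _; apply: pos_agree1. Qed.

Lemma sl_pm i z : sl i z = 1 \/ sl i z = -1.
Proof. exact: spin_pm. Qed.
Lemma sr_pm i z : sr i z = 1 \/ sr i z = -1.
Proof. exact: spin_pm. Qed.
Lemma tau_pm i z : tau i z = 1 \/ tau i z = -1.
Proof. by rewrite /tau; case: (sl_pm i z) (sr_pm i z) => -> [] ->; lra. Qed.

Lemma agree_tau o D v z : v \in D ->
  agree o D z = 0 \/ tau o z * tau v z = 1.
Proof.
move=> vD; case: (tau_pm o z) (tau_pm v z) => h1 [] h2.
- by right; rewrite h1 h2; lra.
- by left; rewrite /agree (big_rem v) //= h1 h2; apply/eqP; rewrite mulf_eq0; apply/orP; left; apply/eqP; lra.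
- by left; rewrite /agree (big_rem v) //= h1 h2; apply/eqP; rewrite mulf_eq0; apply/orP; left; apply/eqP; lra.
by right; rewrite h1 h2; lra.
Qed.

(* Opening or closing an edge of the two-replica expansion: the closed weight is 1. *)
Lemma explore_edge o D u v (c : R) z : u \in D ->
  agree o D z * expR (c * (sl u z * sl v z) + c * (sr u z * sr v z)) =
  agree o D z + (ch (2 * c) - 1) * agree o (v :: D) z
   + sh (2 * c) * (agree o (v :: D) z * (sl u z * sl v z)).
Proof.
move=> uD; rewrite [agree o (v :: D) z]/agree big_cons -/(agree o D z).
have [->|ou] := agree_tau o z uD; first by rewrite !(mul0r, mulr0, addr0).
set p := sl u z * sl v z.
have p_pm : p = 1 \/ p = -1.
  by rewrite /p; case: (sl_pm u z) (sl_pm v z) => -> [] ->; lra.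
have -> : c * p + c * (sr u z * sr v z) = c * (1 + tau o z * tau v z) * p.
  have -> : tau o z * tau v z = tau u z * tau v z.
    by case: (tau_pm o z) (tau_pm u z) ou => -> [] ->; lra.
  rewrite /tau /p; case: (sl_pm u z) (sl_pm v z) => -> [] ->; ring.
(* If [v] agrees with [o], both replicas give the edge the same term and the exponent is
   [2 * c * p]; otherwise the two terms cancel. *)
have [->|->] : tau o z * tau v z = 1 \/ tau o z * tau v z = -1.
- by case: (tau_pm o z) (tau_pm v z) => -> [] ->; lra.
- rewrite (_ : c * (1 + 1) = 2 * c); last by ring.
  by rewrite expR_pm //; field.
by rewrite subrr mulr0 mul0r expR0; field.
Qed.

Lemma ham_rem E e x : e \in E ->
  ham E x = e.1 * (spin (x e.2.1) * spin (x e.2.2)) + ham (rem e E) x.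
Proof. by move=> eE; rewrite /ham (big_rem e). Qed.

Lemma monol_cons i B z : monol (i :: B) z = sl i z * monol B z.
Proof. by rewrite /monol big_cons. Qed.

Definition flipD D : I + I -> bool :=
  fun i => match i with inl i => i \notin D | inr i => i \notin D end.

Lemma sl_flip D i z : sl i (flip (flipD D) z) = (if i \in D then -1 else 1) * sl i z.
Proof. by rewrite /sl /flip spin_eq /=; case: (i \in D). Qed.
Lemma sr_flip D i z : sr i (flip (flipD D) z) = (if i \in D then -1 else 1) * sr i z.
Proof. by rewrite /sr /flip spin_eq /=; case: (i \in D). Qed.
Lemma tau_flip D i z : tau i (flip (flipD D) z) = tau i z.
Proof. by rewrite /tau sl_flip sr_flip; case: ifP => _; ring. Qed.

Lemma mem_dbl V i : (inl i \in dbl V) = (i \in V).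
Proof.
have inl_inj : injective (@inl I I) by move=> ? ? [].
rewrite mem_cat mem_map //; case: (i \in V) => //=.
by apply/mapP => -[].
Qed.
Lemma mem_dblr V i : (inr i \in dbl V) = (i \in V).
Proof.
have inr_inj : injective (@inr I I) by move=> ? ? [].
rewrite mem_cat (mem_map inr_inj); case: (i \in V); rewrite ?orbT ?orbF //.
by apply/mapP => -[].
Qed.

(* [D] is explored from [o] by opening edges, across which tau is constant.  Once
   no edge leaves [D], flipping [D] in both replicas changes the sign, [B] being odd, and the mean vanishes;
   as soon as [D] meets [xs], Griffiths' inequality applies. *)
Lemma gaussian_explore V o E D B xs : o \in D -> {subset D <= V} ->
  {subset B <= D} -> odd (size B) ->
  (forall e, e \in E -> [/\ 0 <= e.1, e.2.1 \in V & e.2.2 \in V]) ->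
  0 <= mean (dbl V) (fun z => agree o D z * expR (ham2 E z) *
    (monol B z * monol xs z * (\sum_(i <- xs) tau o z * tau i z - 1))).
Proof.
have [n] := ubnP (size E); elim: n E D B => // n IH E D B szE oD DV BD oB hE.
have E0 e : e \in E -> 0 <= e.1 by move=> /hE[].
(* When some [i] of [xs] has been reached, tau_o tau_i = 1 wherever [agree] is nonzero. This term
   cancels the -1, and what remains lies in the cone. *)
have [[i ixs iD]|xsD] := pselect (exists2 i, i \in xs & i \in D).
  have := @griffiths1 R _ (dbl V) (fun z => agree o D z * expR (ham2 E z) *
    (monol B z * monol xs z * (\sum_(j <- rem i xs) tau o z * tau j z))) _.
  rewrite (_ : mean _ _ = mean (dbl V) (fun z => agree o D z * expR (ham2 E z) *
    (monol B z * monol xs z * (\sum_(i <- xs) tau o z * tau i z - 1)))).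
    apply; apply: posM; first by apply/posM/pos_exp/pos_ham2 => //; apply: pos_agree.
    apply: posM; first by apply: posM; apply: pos_monol.
    by apply: pos_sum => j _; apply: posM; apply: pos_tau.
  apply: mean_ext => z; rewrite (big_rem i ixs) /=.
  by case: (agree_tau o z iD) => ->; rewrite ?mul0r //; ring.
have [[e eE cross]|nocross] :=
    pselect (exists2 e, e \in E & (e.2.1 \in D) != (e.2.2 \in D)).
  have [c0 e1V e2V] := hE e eE.
  have [u [v [uD vD vV ee]]] : exists u v, [/\ u \in D, v \notin D, v \in V &
      forall x, spin (x e.2.1) * spin (x e.2.2) = spin (x u) * spin (x v) :> R].
    case: (boolP (e.2.1 \in D)) cross => h1; case: (boolP (e.2.2 \in D)) => h2 // _.
      by exists e.2.1, e.2.2.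
    by exists e.2.2, e.2.1; split => // x; rewrite mulrC.
  have sz' : (size (rem e E) < n)%N.
    by move: szE; rewrite size_rem // ltnS; case: (E) eE.
  have hE' e' : e' \in rem e E -> [/\ 0 <= e'.1, e'.2.1 \in V & e'.2.2 \in V].
    by move=> /mem_rem; apply: hE.
  pose F D B z := agree o D z * expR (ham2 (rem e E) z) *
    (monol B z * monol xs z * (\sum_(i <- xs) tau o z * tau i z - 1)).
  have vDV : {subset v :: D <= V} by move=> j; rewrite inE => /orP[/eqP ->|/DV].
  have BvD : {subset B <= v :: D} by move=> j /BD; rewrite inE orbC => ->.
  (* Three outcomes: the edge is closed; it is opened with even weight, and [B] is unchanged; it is
     opened with odd weight, and both ends enter [B]. The size of [B] stays odd in all of them. *)
  rewrite (mean_ext (g := fun z => F D B z + ((ch (2 * e.1) - 1) * F (v :: D) B z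
     + sh (2 * e.1) * F (v :: D) [:: u, v & B] z))); last first.
    move=> z; rewrite /F /ham2 !(ham_rem _ eE) !ee /= -!/(sl _ _) -!/(sr _ _).
    set a := e.1 * _; set hl := ham _ _; set b := e.1 * _; set hr := ham _ _.
    have -> : agree o D z * expR (a + hl + (b + hr)) =
        agree o D z * expR (a + b) * expR (hl + hr).
      by rewrite -mulrA -expRD addrACA.
    rewrite (explore_edge o v e.1 z uD).
    by rewrite !monol_cons; ring.
  have s0 : 0 <= sh (2 * e.1) by rewrite sh_ge0 // mulr_ge0.
  have c1 : 0 <= ch (2 * e.1) - 1 by rewrite subr_ge0 ch_ge1.
  rewrite !meanD !meanZ; apply: addr_ge0; first exact: IH.
  apply: addr_ge0; apply: mulr_ge0 => //.
    by apply: IH => //; rewrite inE oD orbT.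
  apply: IH => //=; rewrite ?inE ?oD ?orbT ?negbK //.
  by move=> j; rewrite !inE => /or3P[/eqP ->|/eqP ->|/BD ->]; rewrite ?eqxx ?uD ?orbT.
set m := mean _ _; suff : m = - m by lra.
rewrite /m -meanN -[LHS](@mean_flip _ _ _ _ (flipD D)); last first.
  by move=> [] i; rewrite ?mem_dbl ?mem_dblr; apply: contra; apply: DV.
apply: mean_ext => z.
have -> : agree o D (flip (flipD D) z) = agree o D z.
  by apply: eq_bigr => v _; rewrite !tau_flip.
have -> : \sum_(i <- xs) tau o (flip (flipD D) z) * tau i (flip (flipD D) z) =
    \sum_(i <- xs) tau o z * tau i z by apply: eq_bigr => v _; rewrite !tau_flip.
have -> : monol xs (flip (flipD D) z) = monol xs z.
  apply: eq_big_seq => i ixs; rewrite sl_flip; case: ifP => iD; last by rewrite mul1r.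
  by case: xsD; exists i.
have -> : monol B (flip (flipD D) z) = - monol B z.
  have -> : - monol B z = (-1) ^+ size B * monol B z by rewrite -signr_odd oB expr1 mulN1r.
  elim: (B) BD => [|i A IHA] AD; first by rewrite /monol !big_nil mulr1.
  rewrite !monol_cons IHA => [|j jA]; last by apply: AD; rewrite inE jA orbT.
  by rewrite sl_flip (AD i) ?mem_head //= exprS; ring.
have -> : ham2 E (flip (flipD D) z) = ham2 E z.
  rewrite /ham2 /ham -!big_split; apply: eq_big_seq => e eE /=.
  rewrite -!/(sl _ _) -!/(sr _ _) !sl_flip !sr_flip.
  have -> : (e.2.1 \in D) = (e.2.2 \in D).
    by apply/eqP/negPn/negP => h; apply: nocross; exists e.
  by case: ifP => _; ring.
by ring.
Qed.

Lemma monolE B z : monol B z = mono B (z \o inl).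
Proof. by []. Qed.

Lemma mean_dbl_mul V (f g : (I -> bool) -> R) :
  mean (dbl V) (fun z => f (z \o inl) * g (z \o inr)) = mean V f * mean V g.
Proof. by rewrite mean_dbl mean_mul. Qed.

(** The exploration is started from [D] = [B] = [[:: o]], where [agree] is 1. Since the spin at [o]
    squares to 1, the factor tau_o tau_i trades s_o for s_i in the first replica and puts s_o s_i
    into the second. Iterated, the inequality bounds a correlation by a sum over pairings, as for a
    Gaussian field. *)
Theorem gaussian_ineq V o E xs : o \in V ->
  (forall e, e \in E -> [/\ 0 <= e.1, e.2.1 \in V & e.2.2 \in V]) ->
  mean V (fun x => spin (x o) * mono xs x * expR (ham E x)) *
    mean V (fun x => expR (ham E x)) <=
  \sum_(i <- xs) mean V (fun x => spin (x o) * spin (x i) * expR (ham E x)) *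
    mean V (fun x => spin (x i) * mono xs x * expR (ham E x)).
Proof.
move=> oV hE.
have oV' : {subset [:: o] <= V} by move=> j; rewrite inE => /eqP ->.
have := gaussian_explore xs (mem_head o [::]) oV' (fun _ h => h) isT hE.
move=> h; rewrite -subr_ge0; move: h; congr (_ <= _).
pose w := fun x => expR (ham E x).
transitivity (mean (dbl V) (fun z =>
   \sum_(i <- xs) (spin (z (inl i)) * mono xs (z \o inl) * w (z \o inl)) *
     (spin (z (inr o)) * spin (z (inr i)) * w (z \o inr))
   - (spin (z (inl o)) * mono xs (z \o inl) * w (z \o inl)) * w (z \o inr))).
  apply: mean_ext => z.
  rewrite /agree big_seq1 /tau /monol big_seq1 -/(monol xs z) monolE.
  have -> : sl o z * sr o z * (sl o z * sr o z) = 1.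
    by case: (sl_pm o z) (sr_pm o z) => -> [] ->; ring.
  rewrite (_ : (1 + 1) / 2 = 1 :> R); last by field.
  rewrite mul1r mulrBr mulrBr /ham2 expRD -!/(w _) !big_distrr /=; congr (_ - _); last first.
    by rewrite /sl; ring.
  apply: eq_bigr => i _; rewrite /sl /sr.
  by rewrite -[RHS]mul1r -(spin2 (z (inl o))); ring.
rewrite meanB mean_sum; congr (_ - _); last first.
  exact: (mean_dbl_mul V (fun x => spin (x o) * mono xs x * w x) w).
apply: eq_bigr => i _; rewrite mulrC.
by rewrite -(mean_dbl_mul V (fun x => spin (x i) * mono xs x * w x)
  (fun x => spin (x o) * spin (x i) * w x)).
Qed.

End Gaussian.

(** This is tanh c <= c with the denominator cleared, a form that can serve as a coefficient in the
    cone. Twice the difference of the two sides has derivative x (e^x - e^-x), which is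
    nonnegative. *)
Lemma sh_le {R : realType} (c : R) : 0 <= c -> sh c <= c * ch c.
Proof.
move=> c0; rewrite -subr_ge0.
pose f (x : R) := x * (expR x + expR (- x)) - (expR x - expR (- x)).
have df (x : R) : is_derive x 1 f (x * (expR x - expR (- x))).
  by apply: is_derive_eq; rewrite /GRing.scale /=; ring.
have [->|cN0] := eqVneq c 0; first by rewrite mul0r sub0r /sh oppr0 subrr mul0r oppr0.
have c1 : 0 < c by rewrite lt_neqAle eq_sym cN0.
have cf : {within `[0, c], continuous f}.
  apply: continuous_subspaceT => x; apply: differentiable_continuous.
  by apply/derivable1_diffP; have [] := df x.
have [x xc] := MVT c1 (fun x _ => df x) cf.
have -> : f 0 = 0 by rewrite /f mul0r sub0r oppr0 subrr oppr0.
rewrite subr0 => fE.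
have : 0 <= f c.
  rewrite fE subr0 mulr_ge0 // mulr_ge0 //; first by case/itvP: xc => h; rewrite ltW ?h.
  by rewrite subr_ge0 ler_expR; have : 0 <= x by [rewrite (itvP xc)]; lra.
by rewrite /f /ch /sh; lra.
Qed.

(** * Lieb's inequality *)

Section Comparison.
Context {R : realType} {I : eqType}.
Implicit Types (x y : I -> bool) (S V W xs : seq I).
Implicit Types (E : seq (R * (I * I))) (C : seq (R * (I * seq I))).

Lemma indepM S (f g : (I -> bool) -> R) :
  indep S f -> indep S g -> indep S (fun x => f x * g x).
Proof. by move=> fi gi x i b iS; rewrite fi // gi. Qed.

Lemma indep_mono S (A : seq I) : {in A, forall i, i \notin S} -> indep S (@mono R I A).
Proof.
move=> AS x i b iS; apply: eq_big_seq => j jA; congr spin; rewrite upd_neq //.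
by apply: contraTneq iS => <-; apply: AS.
Qed.

Lemma indep_ham S E : {in E, forall e, e.2.1 \notin S /\ e.2.2 \notin S} ->
  indep S (ham E).
Proof.
move=> ES x i b iS; apply: eq_big_seq => e /ES[e1 e2].
by rewrite !upd_neq //; apply: contraTneq iS => <-.
Qed.

Lemma mean_supp V S (f : (I -> bool) -> R) : {subset S <= V} ->
  indep [seq i <- V | i \notin S] f -> mean V f = mean S f.
Proof.
move=> SV fi; rewrite (@mean_perm _ _ V (S ++ [seq i <- V | i \notin S])).
- rewrite /mean avg_cat; congr (avg S _ _); apply/funext => x.
  exact: avg_id.
- by move=> i iV; rewrite mem_cat mem_filter iV andbT; case: (i \in S).
by move=> i; rewrite mem_cat mem_filter => /orP[/SV//|/andP[]].
Qed.

Lemma avg_upd W i b (g : (I -> bool) -> R) x :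
  (forall x, g (upd x i b) = g x) -> avg W g (upd x i b) = avg W g x.
Proof.
move=> gi; elim: W x => //= j W IH x; rewrite /avg1.
have [->|ij] := eqVneq i j; first by rewrite !upd_upd.
by rewrite !(updC _ _ _ ij) !IH.
Qed.

Lemma mean_catM S W (f g : (I -> bool) -> R) : indep W f -> indep S g ->
  mean (S ++ W) (fun x => f x * g x) = mean S f * mean W g.
Proof.
move=> fi gi; rewrite /mean avg_cat.
transitivity (avg S (fun x => f x * avg W g x) (fun=> true)).
  by apply: avg_eqx => y _; rewrite avgMl.
rewrite avgMr // => x i b iS.
by apply: avg_upd => y; apply: gi.
Qed.

(** The far end of an edge is a monomial rather than a site, so that one expansion covers couplings
    (one site) and magnetic fields (the empty monomial). *)
Definition cross C x : R := \sum_(e <- C) e.1 * (spin (x e.2.1) * mono e.2.2 x).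

Lemma pos_cross C : (forall e, e \in C -> 0 <= e.1) -> pos (cross C).
Proof.
move=> C0; apply: pos_sum => e eC.
apply: (pos_eq (@pos_mono _ _ e.1 (e.2.1 :: e.2.2) (C0 e eC))) => x.
by rewrite mono_cons.
Qed.

(* Induction on the edges [C] from [S] to the rest, with
   [expR (c s t) = ch c + sh c * s t] and [sh c <= c * ch c]; the last sum
   collects the ends in [S] of the edges already opened. *)
Lemma lieb_expand S W o E (g HW : (I -> bool) -> R) C xs :
  o \in S -> (forall e, e \in E -> [/\ 0 <= e.1, e.2.1 \in S & e.2.2 \in S]) ->
  pos g -> pos HW -> indep S g -> indep S HW -> {subset xs <= S} ->
  {in S, forall i, i \notin W} ->
  (forall e, e \in C -> [/\ 0 <= e.1, e.2.1 \in S & {in e.2.2, forall i, i \notin S}]) ->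
  let w C x := expR (ham E x + HW x + cross C x) in
  let c i j := mean S (fun x => spin (x i) * spin (x j) * expR (ham E x)) in
  is_true (mean (S ++ W) (fun x => spin (x o) * mono xs x * g x * w C x) *
    mean S (fun x => expR (ham E x)) <=
  \sum_(e <- C) e.1 * c o e.2.1 *
     mean (S ++ W) (fun x => mono xs x * mono e.2.2 x * g x * w C x) +
  \sum_(i <- xs) c o i * mean (S ++ W) (fun x => spin (x i) * mono xs x * g x * w C x)).
Proof.
move=> oS hE pg pHW gS HWS xsS SW hC w c.
have pE : pos (ham E) by apply: pos_ham => e /hE[].
have c_ge0 i j : 0 <= c i j.
  by apply/griffiths1/posM/pos_exp => //; apply: posM; apply: pos_spin.
elim: C g xs pg gS xsS hC => [|e C IH] g xs pg gS xsS hC.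
  (* With no edge left the weight factors over [S] and [W], and the claim is the Gaussian inequality
     in [S] times a common factor. *)
  rewrite big_nil add0r.
  have xsW : indep W (fun x => spin (x o) * mono xs x * expR (ham E x)).
    apply: indepM; first apply: indepM.
    - move=> x i b iW; rewrite upd_neq //.
      by apply: contraTneq iW => <-; apply: SW.
    - by apply: indep_mono => i /xsS; apply: SW.
    - move=> x i b iW; congr expR; apply: indep_ham iW => e /hE[_ h1 h2].
      by rewrite !SW.
  have iW i : i \in xs -> indep W (fun x => spin (x i) * mono xs x * expR (ham E x)).
    move=> ixs; apply: indepM; first apply: indepM.
    - move=> x j b jW; rewrite upd_neq //.
      by apply: contraTneq jW => <-; apply/SW/xsS.
    - by apply: indep_mono => j /xsS; apply: SW.
    - move=> x j b jW; congr expR; apply: indep_ham jW => e /hE[_ h1 h2].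
      by rewrite !SW.
  have gHS : indep S (fun x => g x * expR (HW x)).
    by apply: indepM => // x i b iS; rewrite HWS.
  rewrite (mean_ext (g := fun x => (spin (x o) * mono xs x * expR (ham E x)) *
     (g x * expR (HW x)))); last first.
    by move=> x; rewrite /w /cross big_nil addr0 expRD; ring.
  rewrite mean_catM //.
  under eq_big_seq => i ixs.
    rewrite (mean_ext (g := fun x => (spin (x i) * mono xs x * expR (ham E x)) *
       (g x * expR (HW x)))); last first.
      by move=> x; rewrite /w /cross big_nil addr0 expRD; ring.
    rewrite (mean_catM (iW i ixs) gHS) mulrA.
    over.
  rewrite -big_distrl /= mulrAC ler_wpM2r //.
    by apply/griffiths1/posM/pos_exp.
  exact: gaussian_ineq.
have [e0 eS ys] := hC e (mem_head _ _).
have hC' e' : e' \in C -> [/\ 0 <= e'.1, e'.2.1 \in S & {in e'.2.2, forall i, i \notin S}].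
  by move=> h; apply: hC; rewrite inE h orbT.
set x0 := e.2.1; set y0 := e.2.2; set b := e.1.
have wE x : w (e :: C) x = (ch b + sh b * (spin (x x0) * mono y0 x)) * w C x.
  transitivity (expR (b * mono (x0 :: y0) x) * w C x); last by rewrite expR_mono mono_cons.
  by rewrite /w -expRD; congr expR; rewrite /cross big_cons mono_cons -/b; ring.
have mE f : mean (S ++ W) (fun x => f x * w (e :: C) x) =
   ch b * mean (S ++ W) (fun x => f x * w C x) +
   sh b * mean (S ++ W) (fun x => f x * (spin (x x0) * mono y0 x) * w C x).
  by rewrite -!meanZ -meanD; apply: mean_ext => x; rewrite wE; ring.
have IH1 := IH g xs pg gS xsS hC'.
have pg2 : pos (fun x => mono y0 x * g x) by apply: posM => //; apply: pos_monom.
have gS2 : indep S (fun x => mono y0 x * g x).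
  by apply: indepM => //; apply: indep_mono => i /ys.
have xsS2 : {subset x0 :: xs <= S} by move=> i; rewrite inE => /orP[/eqP ->|/xsS].
have IH2 := IH _ (x0 :: xs) pg2 gS2 xsS2 hC'.
have s0 : 0 <= sh b by exact: sh_ge0.
have c0 := ltW (ch_gt0 b).
have := lerD (ler_wpM2l c0 IH1) (ler_wpM2l s0 IH2).
set A := (X in _ <= X -> _) => hA.
rewrite mE mulrDl.
have -> : mean (S ++ W) (fun x => spin (x o) * mono xs x * g x *
    (spin (x x0) * mono y0 x) * w C x) =
  mean (S ++ W) (fun x => spin (x o) * mono (x0 :: xs) x * (mono y0 x * g x) * w C x).
  by apply: mean_ext => x; rewrite mono_cons; ring.
rewrite -[X in X + _ <= _]mulrA -[X in _ + X <= _]mulrA; apply: (le_trans hA); rewrite /A.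
rewrite !mulrDr !big_distrr /= !big_cons -!/x0.
set P := mean (S ++ W) (fun x => spin (x x0) * mono (x0 :: xs) x * (mono y0 x * g x) * w C x).
set Q := mean (S ++ W) (fun x => mono xs x * mono y0 x * g x * w (e :: C) x).
(* The summand of the opened edge's own end [x0]: its two spins at [x0] square to 1. The weight of
   the edge is then restored by [sh b <= b * ch b] and positivity, which yields the new term of the
   sum over [e :: C]. *)
have PQ : sh b * P <= b * Q.
  rewrite -!meanZ -subr_ge0 -meanB.
  rewrite (mean_ext (g := fun x => ((b * ch b - sh b) + b * sh b * (spin (x x0) * mono y0 x)) *
      (mono xs x * mono y0 x * g x * w C x))); last first.
    move=> x; have -> : spin (x x0) * mono (x0 :: xs) x = mono xs x :> R.
      by rewrite mono_cons mulrA spin2 mul1r.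
    by rewrite wE; ring.
  apply: griffiths1; apply: posM.
    apply: posD; first by apply: pos_cst; rewrite subr_ge0 sh_le.
    by apply: posZ; [rewrite mulr_ge0|apply: posM; [apply: pos_spin|apply: pos_monom]].
  apply: posM; first by apply: posM => //; apply: posM; apply: pos_monom.
  apply: pos_exp; apply: posD; first exact: posD.
  by apply: pos_cross => e' /hC'[].
(* The two induction hypotheses, weighted by [ch b] and [sh b], add up to the expansion of the edge
   [e] in every other term. *)
have E1 : \sum_(e' <- C) ch b * (e'.1 * c o e'.2.1 *
      mean (S ++ W) (fun x => mono xs x * mono e'.2.2 x * g x * w C x)) +
   \sum_(e' <- C) sh b * (e'.1 * c o e'.2.1 * mean (S ++ W)
     (fun x => mono (x0 :: xs) x * mono e'.2.2 x * (mono y0 x * g x) * w C x)) =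
   \sum_(e' <- C) e'.1 * c o e'.2.1 *
      mean (S ++ W) (fun x => mono xs x * mono e'.2.2 x * g x * w (e :: C) x).
  rewrite -big_split; apply: eq_bigr => e' _ /=; rewrite mE.
  rewrite [in RHS](mean_ext (g := fun x => mono (x0 :: xs) x * mono e'.2.2 x *
     (mono y0 x * g x) * w C x) (f := fun x => _ * (_ * _) * _)); first by ring.
  by move=> x; rewrite mono_cons; ring.
have E2 : \sum_(i <- xs) ch b * (c o i *
      mean (S ++ W) (fun x => spin (x i) * mono xs x * g x * w C x)) +
   \sum_(i <- xs) sh b * (c o i * mean (S ++ W)
     (fun x => spin (x i) * mono (x0 :: xs) x * (mono y0 x * g x) * w C x)) =
   \sum_(i <- xs) c o i *
      mean (S ++ W) (fun x => spin (x i) * mono xs x * g x * w (e :: C) x).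
  rewrite -big_split; apply: eq_bigr => i _ /=; rewrite mE.
  rewrite [in RHS](mean_ext (g := fun x => spin (x i) * mono (x0 :: xs) x *
     (mono y0 x * g x) * w C x) (f := fun x => _ * (_ * _) * _)); first by ring.
  by move=> x; rewrite mono_cons; ring.
rewrite -E1 -E2.
have h : sh b * (c o x0 * P) <= b * c o x0 * Q.
  rewrite (_ : sh b * _ = c o x0 * (sh b * P)); last by ring.
  rewrite (_ : b * _ * _ = c o x0 * (b * Q)); last by ring.
  exact: ler_wpM2l (c_ge0 _ _) _ _ PQ.
by rewrite -/b; lra.
Qed.

(* Every pair occurs in both orders, hence the half. *)
Definition edges (K : I -> I -> R) S : seq (R * (I * I)) :=
  [seq (K i j / 2, (i, j)) | i <- S, j <- S].

Definition hamK K S : (I -> bool) -> R := ham (edges K S).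

Lemma hamKE K S x :
  hamK K S x = 2^-1 * \sum_(i <- S) \sum_(j <- S) K i j * (spin (x i) * spin (x j)).
Proof.
rewrite /hamK /ham big_allpairs_dep big_distrr; apply: eq_bigr => i _ /=.
by rewrite big_distrr; apply: eq_bigr => j _ /=; field.
Qed.

Lemma edgesP K S : (forall i j, 0 <= K i j) ->
  forall e, e \in edges K S -> [/\ 0 <= e.1, e.2.1 \in S & e.2.2 \in S].
Proof.
move=> K0 e /allpairsP[[i j] /= [iS jS ->]] /=; split => //.
by rewrite divr_ge0.
Qed.

Lemma pos_hamK K S : (forall i j, 0 <= K i j) -> pos (hamK K S).
Proof. by move=> K0; apply: pos_ham => e /(edgesP K0)[]. Qed.

Lemma indep_hamK K S W : {in S, forall i, i \notin W} -> indep W (hamK K S).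
Proof.
by move=> SW; apply: indep_ham => e /allpairsP[[i j] /= [iS jS ->]] /=; rewrite !SW.
Qed.

Definition corr K S i j : R :=
  gibbs_mean S (hamK K S) (fun x => spin (x i) * spin (x j)).

Lemma corrC K S i j : corr K S i j = corr K S j i.
Proof. by rewrite /corr; congr gibbs_mean; apply/funext => x; rewrite mulrC. Qed.

Lemma pos_spin2 i j : pos (fun x => spin (x i) * spin (x j) : R).
Proof. by apply: posM; apply: pos_spin. Qed.

Lemma corr_ge0 K S i j : (forall i j, 0 <= K i j) -> 0 <= corr K S i j.
Proof. by move=> K0; apply: gibbs_mean_ge0; [apply: pos_hamK|apply: pos_spin2]. Qed.

Lemma corr_le1 K S i j : corr K S i j <= 1.
Proof.
apply: gibbs_mean_le => x.
by case: (@spin_pm R (x i)) (@spin_pm R (x j)) => -> [] ->; lra.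
Qed.

Lemma hamK_split K S V x : (forall i j, K i j = K j i) -> uniq V -> uniq S ->
  {subset S <= V} ->
  hamK K V x = hamK K S x + hamK K [seq i <- V | i \notin S] x +
    \sum_(i <- S) \sum_(j <- [seq i <- V | i \notin S]) K i j * (spin (x i) * spin (x j)).
Proof.
move=> Ksym uV uS SV; set W := [seq i <- V | i \notin S].
have pV : perm_eq V (S ++ W).
  rewrite uniq_perm // ?cat_uniq ?uS ?filter_uniq //=.
    by rewrite andbT; apply/hasPn => i; rewrite mem_filter => /andP[].
  by move=> i; rewrite mem_cat mem_filter; case: (boolP (i \in S)) => [/SV ->|].
have sumV (F : I -> R) : \sum_(i <- V) F i = \sum_(i <- S) F i + \sum_(i <- W) F i.
  by rewrite (perm_big _ pV) big_cat.
rewrite !hamKE sumV.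
under eq_bigr do rewrite sumV.
under [X in _ + X]eq_bigr do rewrite sumV.
rewrite !big_split /=.
rewrite [X in _ + (X + _)](_ : _ =
    \sum_(i <- S) \sum_(j <- W) K i j * (spin (x i) * spin (x j))); first by field.
rewrite exchange_big /=; apply: eq_bigr => i _; apply: eq_bigr => j _.
by rewrite Ksym; ring.
Qed.

Lemma corr_supp K S V i j : {subset S <= V} -> i \in S -> j \in S ->
  gibbs_mean V (hamK K S) (fun x => spin (x i) * spin (x j)) = corr K S i j.
Proof.
move=> SV iS jS; rewrite /corr /gibbs_mean.
have h : indep [seq i <- V | i \notin S] (fun x => expR (hamK K S x)).
  move=> x k b kV; congr expR; apply: indep_hamK kV => l lS.
  by rewrite mem_filter lS.
rewrite !(mean_supp SV) //; apply: indepM => //.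
move=> x k b; rewrite mem_filter => /andP[kS _].
by rewrite !upd_neq //; apply: contraNneq kS => <-.
Qed.

(** Passing from [S] to [V] only adds terms of the cone to the energy. *)
Lemma corr_mono K S V i j : (forall i j, 0 <= K i j) -> (forall i j, K i j = K j i) ->
  uniq V -> uniq S -> {subset S <= V} -> i \in S -> j \in S ->
  corr K S i j <= corr K V i j.
Proof.
move=> K0 Ksym uV uS SV iS jS; rewrite -(corr_supp K SV iS jS).
rewrite [corr K V i j]/corr.
pose W := [seq i <- V | i \notin S].
rewrite (_ : hamK K V = fun x => hamK K S x + (hamK K W x +
    \sum_(i <- S) \sum_(j <- W) K i j * (spin (x i) * spin (x j)))).
  apply: gibbs_mean_incr; [exact: pos_hamK| |exact: pos_spin2].
  apply: posD; first exact: pos_hamK.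
  apply: pos_sum => k _; apply: pos_sum => l _; apply: posZ => //.
  exact: pos_spin2.
by apply/funext => x; rewrite (hamK_split x Ksym uV uS SV) addrA.
Qed.

(** The couplings from [S] to the rest of [V] are expanded, with s_z as a spectator and no end
    opened yet. That the correlation from [o] is the one of [S], and not of [V], is what will make
    [phiS] appear. *)
Theorem lieb_ineq K S V o z : (forall i j, 0 <= K i j) -> (forall i j, K i j = K j i) ->
  uniq V -> uniq S -> {subset S <= V} -> o \in S -> z \notin S ->
  corr K V o z <= \sum_(i <- S) \sum_(j <- [seq i <- V | i \notin S])
    K i j * corr K S o i * corr K V j z.
Proof.
move=> K0 Ksym uV uS SV oS zS; set W := [seq i <- V | i \notin S].
pose C : seq (R * (I * seq I)) := [seq (K i j, (i, [:: j])) | i <- S, j <- W].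
have SW : {in S, forall i, i \notin W} by move=> i iS; rewrite mem_filter iS.
have hC e : e \in C -> [/\ 0 <= e.1, e.2.1 \in S & {in e.2.2, forall i, i \notin S}].
  move=> /allpairsP[[i j] /= [iS jW ->]] /=; split => // k; rewrite inE => /eqP ->.
  by apply: contraTN jW => jS; apply: SW.
have VE f : mean V f = mean (S ++ W) f.
  apply: mean_perm => i; rewrite mem_cat mem_filter.
    by move=> ->; rewrite andbT; case: (i \in S).
  by case/orP => [/SV|/andP[]].
have := @lieb_expand S W o (edges K S) (fun x => spin (x z)) (hamK K W) C [::] oS
  (edgesP K0) (pos_spin z) (pos_hamK W K0) _ _ (fun _ => False_ind _ \o notF) SW hC.
have zi : indep S (fun x => spin (x z) : R).
  by move=> x i b iS; rewrite upd_neq //; apply: contraNneq zS => ->.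
have Wi : indep S (hamK K W).
  by apply: indep_hamK => i; rewrite mem_filter => /andP[].
move=> /(_ zi Wi) /=.
rewrite big_nil addr0 -!VE.
have wE f : mean V (fun x => f x * expR (ham (edges K S) x + hamK K W x + cross C x)) =
    mean V (fun x => f x * expR (hamK K V x)).
  apply: mean_ext => x; rewrite (hamK_split x Ksym uV uS SV) -/W.
  congr (_ * expR (_ + _)); rewrite /cross big_allpairs_dep; apply: eq_bigr => i _.
  by apply: eq_bigr => j _ /=; rewrite mono1.
rewrite !wE.
under eq_bigr do rewrite -VE wE.
rewrite big_allpairs_dep /=.
have ZS := mean_exp_gt0 S (hamK K S); have ZV := mean_exp_gt0 V (hamK K V).
rewrite -ler_pdivlMr // -(ler_pM2r (_ : 0 < (mean V (fun x => expR (hamK K V x)))^-1)); last first.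
  by rewrite invr_gt0.
congr (_ <= _).
  by rewrite /corr /gibbs_mean; congr (_ / _); apply: mean_ext => x; rewrite mono0; ring.
rewrite -mulrA big_distrl /=; apply: eq_bigr => i _.
rewrite big_distrl /=; apply: eq_bigr => j _.
rewrite /corr /gibbs_mean -/(hamK K S).
rewrite (mean_ext (f := fun x => mono [::] x * _ * _ * _)
  (g := fun x => spin (x j) * spin (x z) * expR (hamK K V x))); last first.
  by move=> x; rewrite mono0 mono1; ring.
by ring.
Qed.

Theorem field_ineq K S o (B : I -> R) : (forall i j, 0 <= K i j) -> (forall i, 0 <= B i) ->
  o \in S ->
  gibbs_mean S (fun x => hamK K S x + \sum_(i <- S) B i * spin (x i)) (fun x => spin (x o))
   <= \sum_(i <- S) B i * corr K S o i.
Proof.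
move=> K0 B0 oS.
pose C : seq (R * (I * seq I)) := [seq (B i, (i, [::])) | i <- S].
have hC e : e \in C -> [/\ 0 <= e.1, e.2.1 \in S & {in e.2.2, forall i, i \notin S}].
  by move=> /mapP[i iS ->]; split => //=.
have := @lieb_expand S [::] o (edges K S) (fun=> 1) (fun=> 0) C [::] oS
  (edgesP K0) (pos_cst ler01) (pos_cst (lexx 0)) (fun _ _ _ _ => erefl)
  (fun _ _ _ _ => erefl) (fun _ => False_ind _ \o notF) (fun _ _ => isT) hC.
rewrite /= cats0 big_nil addr0 big_map /=.
set H := fun x => hamK K S x + _.
have wE f : mean S (fun x => f x * expR (ham (edges K S) x + 0 + cross C x)) =
    mean S (fun x => f x * expR (H x)).
  apply: mean_ext => x; rewrite addr0; congr (_ * expR (_ + _)).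
  by rewrite /cross big_map; apply: eq_bigr => i _ /=; rewrite mono0 mulr1.
rewrite wE; under eq_bigr do rewrite wE.
have ZS := mean_exp_gt0 S (hamK K S); have ZH := mean_exp_gt0 S H.
rewrite -ler_pdivlMr // /gibbs_mean ler_pdivrMr // => h.
apply: le_trans (le_trans h _); first by apply: avg_le => x _; rewrite mono0 !mulr1.
rewrite !big_distrl /= le_eqVlt; apply/orP; left; apply/eqP; apply: eq_bigr => i _.
rewrite (mean_ext (f := fun x => mono [::] x * _ * _ * _) (g := fun x => expR (H x))).
  by rewrite /corr /gibbs_mean -/(hamK K S); ring.
by move=> x; rewrite mono0 !mul1r.
Qed.

End Comparison.

(** * Perturbation of the field *)

Section FieldComparison.
Context {R : realType} {I : eqType}.
Implicit Types (x y : I -> bool) (S V : seq I).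

Lemma field_sign S o (H : (I -> bool) -> R) (b B : I -> R) : pos H ->
  (forall i, `|b i| <= B i) ->
  `|gibbs_mean S (fun x => H x + \sum_(i <- S) b i * spin (x i)) (fun x => spin (x o))| <=
  gibbs_mean S (fun x => H x + \sum_(i <- S) B i * spin (x i)) (fun x => spin (x o)).
Proof.
move=> pH bB; set Hb := fun x => H x + \sum_(i <- S) b i * _.
set HB := fun x => H x + \sum_(i <- S) B i * _.
(* The sign [eps] treats both halves of the absolute value at once. *)
have key eps : eps = 1 \/ eps = -1 ->
    eps * gibbs_mean S Hb (fun x => spin (x o)) <= gibbs_mean S HB (fun x => spin (x o)).
  move=> epsE; rewrite /gibbs_mean ler_pdivlMr ?mean_exp_gt0 //.
  set Nb := mean S _; set Zb := mean S _; set ZB := mean S _.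
  rewrite (_ : eps * (Nb / Zb) * ZB = eps * Nb * ZB / Zb); last by ring.
  rewrite ler_pdivrMr ?mean_exp_gt0 // -subr_ge0 /Nb /Zb /ZB.
  rewrite -(meanZ S eps) [X in _ - X]mulrC !mean_mul -meanB.
  rewrite (mean_ext (g := fun x => mean S (fun y =>
     (spin (x o) - eps * spin (y o)) * expR (HB x + Hb y)))); last first.
    by move=> x; rewrite -meanB; apply: mean_ext => y; rewrite expRD; ring.
  rewrite mean_replica; apply: mean_ge0 => t _.
  rewrite (mean_ext (g := fun x => (1 - eps * spin (t o)) * (spin (x o) *
    expR ((H x + H (flip t x)) + \sum_(i <- S) (B i + b i * spin (t i)) * spin (x i))))); last first.
    move=> x; rewrite /HB /Hb.
    have -> : \sum_(i <- S) b i * spin (flip t x i) = \sum_(i <- S) b i * spin (t i) * spin (x i).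
      by apply: eq_bigr => i _; rewrite /flip spin_eq mulrA.
    have -> : \sum_(i <- S) (B i + b i * spin (t i)) * spin (x i) =
      \sum_(i <- S) B i * spin (x i) + \sum_(i <- S) b i * spin (t i) * spin (x i).
      by rewrite -big_split; apply: eq_bigr => i _; rewrite mulrDl.
    by rewrite /flip spin_eq addrACA; ring.
  rewrite meanZ mulr_ge0 //.
    by rewrite subr_ge0; case: epsE (@spin_pm R (t o)) => -> [] ->; lra.
  apply: griffiths1; apply: posM; first exact: pos_spin.
  apply: pos_exp; apply: posD; first exact: pos_replica.
  apply: pos_sum => i _; apply: posZ; last exact: pos_spin.
  have := bB i; rewrite ler_norml => /andP[h1 h2].
  by case: (@spin_pm R (t i)) => ->; lra.
have := key 1 (or_introl erefl); have := key (-1) (or_intror erefl).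
by rewrite ler_norml; lra.
Qed.

Lemma partition_le S (H1 H2 : (I -> bool) -> R) :
  mean S (fun x => expR (H1 x)) <=
  mean S (fun x => expR (H2 x)) * expR (gibbs_mean S H1 (fun x => H1 x - H2 x)).
Proof.
set m := gibbs_mean _ _ _.
rewrite -ler_pdivrMr ?expR_gt0 // -expRN mulrC.
have Z1 := mean_exp_gt0 S H1.
have -> : expR (- m) * mean S (fun x => expR (H1 x)) =
  mean S (fun x => expR (- m) * ((1 - (H1 x - H2 x - m)) * expR (H1 x))).
  rewrite meanZ; congr (_ * _).
  rewrite [RHS](mean_ext (g := fun x => (1 + m) * expR (H1 x) - (H1 x - H2 x) * expR (H1 x))).
    rewrite meanB meanZ.
    have -> : mean S (fun x => (H1 x - H2 x) * expR (H1 x)) = m * mean S (fun x => expR (H1 x)).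
      by rewrite /m /gibbs_mean divfK // gt_eqF.
    by ring.
  by move=> x; ring.
apply: avg_le => x _.
have -> : expR (H2 x) = expR (- m) * (expR (- (H1 x - H2 x - m)) * expR (H1 x)).
  by rewrite -!expRD; congr expR; ring.
by rewrite ler_wpM2l ?expR_ge0 // ler_wpM2r ?expR_ge0 // expR_ge1Dx.
Qed.

(* Jensen's inequality; the one-point functions are bounded by [field_sign], which
   makes the fields nonnegative, and [field_ineq]. *)
Theorem field_perturbation (K : I -> I -> R) S (b b' B : I -> R) :
  (forall i j, 0 <= K i j) -> (forall i, `|b' i| <= B i) ->
  mean S (fun x => expR (hamK K S x + \sum_(i <- S) b' i * spin (x i))) <=
  mean S (fun x => expR (hamK K S x + \sum_(i <- S) b i * spin (x i))) *
    expR (\sum_(i <- S) \sum_(j <- S) `|b' i - b i| * (B j * corr K S i j)).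
Proof.
move=> K0 b'B; apply: le_trans (partition_le _ _ (fun x => hamK K S x + \sum_(i <- S) b i * spin (x i))) _.
have B0 i : 0 <= B i by apply: le_trans (b'B i).
apply: ler_wpM2l; [exact/ltW/mean_exp_gt0|rewrite ler_expR].
set H' := fun x => hamK K S x + \sum_(i <- S) b' i * spin (x i).
have -> : gibbs_mean S H' (fun x => H' x - (hamK K S x + \sum_(i <- S) b i * spin (x i))) =
  \sum_(i <- S) (b' i - b i) * gibbs_mean S H' (fun x => spin (x i)).
  rewrite /gibbs_mean.
  under eq_bigr do rewrite mulrA -meanZ.
  rewrite -big_distrl /= -mean_sum; congr (_ / _); apply: mean_ext => x.
  rewrite /H' opprD addrACA subrr add0r -sumrB big_distrl.
  by apply: eq_bigr => i _ /=; ring.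
rewrite big_seq [leRHS]big_seq; apply: ler_sum => i iS; rewrite -big_distrr /=.
apply: le_trans (ler_norm _) _; rewrite normrM ler_wpM2l //.
apply: le_trans (field_sign S i (pos_hamK S K0) b'B) _.
exact: field_ineq.
Qed.

End FieldComparison.

(** * A lower bound on the growth of the magnetization *)

Section Susceptibility.
Context {R : realType} {I : eqType}.
Context (K : I -> I -> R) (o : I) (c : R).
Context (K0 : forall i j, 0 <= K i j) (Ksym : forall i j, K i j = K j i) (c0 : 0 <= c).
Implicit Types (V S : seq I) (a e f : I -> R) (z : I + I -> bool).

(* Two replicas in the field [a]; [e] penalizes agreement of the replicas, as does
   the part of the field that has been expanded. *)
Definition rep_energy V a e z : R :=
  hamK K V (z \o inl) + hamK K V (z \o inr) +
  \sum_(x <- V) (a x * (sl x z + sr x z) - e x * (1 + tau x z)).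

(** As s - s' = s (1 - tau), and likewise for products of two spins, the parenthesis is the
    difference of the energies of the two replicas in the field [f]; the half is that of [hamK]. *)
Definition obs V f z : R := sl o z *
  (2^-1 * (\sum_(x <- V) \sum_(y <- V) K x y * (sl x z * sl y z * (1 - tau x z * tau y z)))
   + \sum_(x <- V) f x * (sl x z * (1 - tau x z))) - c * (1 - tau o z).

(** For [e] = 0 this is Z^2 times the covariance of s_o with the energy, minus c Z^2 (1 - <s_o>^2).
    The observable keeps the field [a + e] because an expanded field still counts there. *)
Definition psi V a e : R :=
  mean (dbl V) (fun z => expR (rep_energy V a e z) * obs V (fun x => a x + e x) z).

(** The counterpart of [phiS] at an intermediate stage: the outside of [S] consists of field,
    expanded field and remaining spins. Both branches of [psi_open] leave it unchanged. *)
Definition escape V a e S : R :=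
  \sum_(x <- S) corr K S o x * (a x + e x + \sum_(y <- V | y \notin S) K x y).

Lemma mean_supp_eq (J : eqType) (l : seq J) (f g : (J -> bool) -> R) :
  (forall x : J -> bool, (forall i, i \notin l -> x i) -> f x = g x) -> mean l f = mean l g.
Proof. by move=> h; apply: avg_eqx => y hy; apply: h => i /hy ->. Qed.

(** With y = t x, every tau becomes a spin of [t]: the penalty is constant in [x], the factor
    [1 - mono A t] is nonnegative, and the rest is in the cone. *)
Lemma replica_ge0 V a e A : (forall x, 0 <= a x) ->
  0 <= mean (dbl V) (fun z => expR (rep_energy V a e z) *
     (monol A z * (1 - \prod_(x <- A) tau x z))).
Proof.
move=> a0; rewrite mean_dbl mean_replica; apply: mean_ge0 => t _.
have tauE x i : tau i (pair_conf x (flip t x)) = spin (t i) :> R.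
  by rewrite /tau /sl /sr /= /flip spin_eq mulrCA spin2 mulr1.
rewrite (mean_ext (g := fun x => (expR (- \sum_(i <- V) e i * (1 + spin (t i))) * (1 - mono A t)) *
   (mono A x * expR ((hamK K V x + hamK K V (flip t x)) +
     \sum_(i <- V) a i * (1 + spin (t i)) * spin (x i))))); last first.
  move=> x.
  have -> : \prod_(i <- A) tau i (pair_conf x (flip t x)) = mono A t :> R.
    by apply: eq_bigr => i _; rewrite tauE.
  have -> : rep_energy V a e (pair_conf x (flip t x)) = - (\sum_(i <- V) e i * (1 + spin (t i))) +
     ((hamK K V x + hamK K V (flip t x)) + \sum_(i <- V) a i * (1 + spin (t i)) * spin (x i)).
    rewrite addrCA /rep_energy; congr (_ + _); rewrite -sumrN -big_split; apply: eq_bigr => i _ /=.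
    by rewrite tauE /sl /sr /= /flip spin_eq; ring.
  have mE : monol A (pair_conf x (flip t x)) = mono A x :> R by [].
  by rewrite [expR (- _ + _)]expRD mE; ring.
rewrite meanZ mulr_ge0 //.
  by rewrite mulr_ge0 ?expR_ge0 // subr_ge0 mono_le1.
apply: griffiths1; apply: posM; first exact: pos_monom.
apply: pos_exp; apply: posD; first exact/pos_replica/pos_hamK.
apply: pos_sum => i _; apply: posZ; last exact: pos_spin.
by rewrite mulr_ge0 //; case: (@spin_pm R (t i)) => ->; lra.
Qed.

(** When [o] has joined the plus boundary, both of its spins are + and the negative term vanishes;
    every other term is covered by [replica_ge0]. *)
Lemma psi_notin V a e : o \notin V -> (forall x, 0 <= a x) -> (forall x, 0 <= e x) ->
  0 <= psi V a e.
Proof.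
move=> oV a0 e0; rewrite /psi.
rewrite (@mean_supp_eq _ _ _ (fun z =>
   2^-1 * (\sum_(x <- V) \sum_(y <- V) K x y * (expR (rep_energy V a e z) *
     (monol [:: x; y] z * (1 - \prod_(i <- [:: x; y]) tau i z))))
   + \sum_(x <- V) (a x + e x) * (expR (rep_energy V a e z) *
     (monol [:: x] z * (1 - \prod_(i <- [:: x]) tau i z))))); last first.
  move=> z hz.
  have o1 : sl o z = 1 :> R by rewrite /sl hz // mem_dbl.
  have o2 : tau o z = 1 :> R by rewrite /tau o1 /sr hz ?mul1r // mem_dblr.
  rewrite /obs o1 o2 subrr mulr0 subr0 mul1r mulrDr mulrCA !big_distrr /=.
  congr (_ + _).
    apply: eq_bigr => x _; rewrite !big_distrr /=; apply: eq_bigr => y _.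
    by rewrite /monol !big_cons !big_nil /=; ring.
  by apply: eq_bigr => x _; rewrite /monol !big_seq1; ring.
rewrite meanD meanZ !mean_sum addr_ge0 //.
  rewrite mulr_ge0 ?invr_ge0 // sumr_ge0 // => x _.
  rewrite mean_sum sumr_ge0 // => y _; rewrite meanZ mulr_ge0 //.
  exact: replica_ge0.
by apply: sumr_ge0 => x _; rewrite meanZ mulr_ge0 ?addr_ge0 //; apply: replica_ge0.
Qed.

Lemma hamK_flip V x (D : I -> bool) : {in V, forall i j : I, j \in V -> D i = D j} ->
  hamK K V (flip D x) = hamK K V x.
Proof.
move=> h; rewrite !hamKE; congr (_ * _); apply: eq_big_seq => i iV; apply: eq_big_seq => j jV.
by rewrite /flip !spin_eq (h i iV j jV); congr (_ * _); rewrite mulrACA spin2 mul1r.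
Qed.

(** Without field the pair term drops out by spin flip symmetry. Flipping the second replica then
    turns the penalty into an attraction between the replicas; by Griffiths' inequality this only
    increases the mean of s_o s_x, so that the sum of [e x * corr K V o x] has to beat 2 c. *)
Lemma psi_nofield V a e : uniq V -> o \in V -> (forall x, x \in V -> a x = 0) ->
  (forall x, 0 <= e x) -> 2 * c <= \sum_(x <- V) e x * corr K V o x -> 0 <= psi V a e.
Proof.
move=> uV oV a0 e0 hc.
pose W z : R := expR (hamK K V (z \o inl) + hamK K V (z \o inr) - \sum_(x <- V) e x * (1 + tau x z)).
have WE z : expR (rep_energy V a e z) = W z.
  congr expR; rewrite /rep_energy -sumrN; congr (_ + _).
  by apply: eq_big_seq => x xV; rewrite a0 // mul0r sub0r.
pose Q z : R := sl o z * (2^-1 * \sum_(x <- V) \sum_(y <- V)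
  K x y * (sl x z * sl y z * (1 - tau x z * tau y z))).
pose P z : R := \sum_(x <- V) e x * (sl o z * sl x z * (1 - tau x z)) - c * (1 - tau o z).
have -> : psi V a e = mean (dbl V) (fun z => W z * Q z) + mean (dbl V) (fun z => W z * P z).
  rewrite -meanD; apply: mean_ext => z; rewrite WE -mulrDr; congr (_ * _).
  rewrite /obs /Q /P mulrDr -addrA; congr (_ + (_ - _)).
  rewrite big_distrr; apply: eq_big_seq => x xV /=.
  by rewrite a0 // add0r; ring.
have WF z : W (flip (flipD V) z) = W z.
  rewrite /W.
  have -> : flip (flipD V) z \o inl = flip (fun i => i \notin V) (z \o inl) by [].
  have -> : flip (flipD V) z \o inr = flip (fun i => i \notin V) (z \o inr) by [].
  rewrite !hamK_flip; try by move=> i iV j jV; rewrite iV jV.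
  by under eq_bigr do rewrite tau_flip.
(* A flip of both replicas preserves the weight and every tau, but changes the sign of s_o. *)
have Q0 : mean (dbl V) (fun z => W z * Q z) = 0.
  set m := mean _ _; suff : m = - m by lra.
  rewrite /m -meanN -[LHS](@mean_flip _ _ _ _ (flipD V)); last first.
    by move=> [] i; rewrite ?mem_dbl ?mem_dblr.
  apply: mean_ext => z; rewrite WF -mulrN; congr (_ * _).
  rewrite /Q sl_flip oV mulN1r mulNr; congr (- (_ * (_ * _))).
  apply: eq_big_seq => x xV; apply: eq_big_seq => y yV.
  by rewrite !tau_flip !sl_flip xV yV; ring.
rewrite Q0 add0r.
(* The flip of the second replica alone: tau changes sign, so [- e x * (1 + tau)] becomes the
   constant [- e x] plus [e x * tau]. *)
pose D : I + I -> bool := fun i => match i with inl i => true | inr i => i \notin V end.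
rewrite -(@mean_flip _ _ _ _ D); last by move=> [] i //; rewrite mem_dblr.
have slD i z : sl i (flip D z) = sl i z :> R.
  by rewrite /sl /flip spin_eq mul1r.
have tauD i z : i \in V -> tau i (flip D z) = - tau i z :> R.
  by move=> iV; rewrite /tau slD /sr /flip /= spin_eq iV /= mulN1r mulrN.
pose g z : R := \sum_(x <- V) e x * tau x z.
pose H2 z : R := hamK K V (z \o inl) + hamK K V (z \o inr).
pose E0 : R := expR (- \sum_(x <- V) e x).
rewrite (mean_ext (g := fun z => E0 * ((\sum_(x <- V) e x * (sl o z * sl x z * expR (H2 z + g z)))
   + (\sum_(x <- V) e x * (sl o z * sr x z * expR (H2 z + g z)))
   - c * ((1 + tau o z) * expR (H2 z + g z))))); last first.
  move=> z.
  have -> : W (flip D z) = E0 * expR (H2 z + g z).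
    rewrite /W -expRD.
    have -> : flip D z \o inl = z \o inl.
      by apply/funext => i; rewrite /= /flip /=; case: (z (inl i)).
    have -> : flip D z \o inr = flip (fun i => i \notin V) (z \o inr) by [].
    rewrite hamK_flip; last by move=> i iV j jV; rewrite iV jV.
    congr expR; rewrite /H2 [RHS]addrC -[RHS]addrA; congr (_ + _).
    rewrite /g -!sumrN -big_split /=; apply: eq_big_seq => x xV.
    by rewrite tauD //; ring.
  rewrite /P !mulrBr !big_distrr -!big_split /=; congr (_ - _).
    rewrite [RHS]big_distrr /=; apply: eq_big_seq => x xV; rewrite !slD tauD //.
    have -> : sr x z = sl x z * tau x z :> R by rewrite /tau mulrA spin2 mul1r.
    by ring.
  by rewrite tauD //; ring.
pose M := mean (dbl V) (fun z => expR (H2 z + g z)).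
have M0 : 0 <= M by exact/ltW/mean_exp_gt0.
have pH2 : pos H2.
  by apply: posD; apply: pos_comp; apply: pos_hamK.
have pg : pos g by apply: pos_sum => x _; apply: posZ => //; apply: pos_tau.
(* Dropping the attraction [g] decouples the replicas, and the mean of s_o s_x is then [corr]. *)
have h1 x : corr K V o x * M <= mean (dbl V) (fun z => sl o z * sl x z * expR (H2 z + g z)).
  have pf : pos (fun z => sl o z * sl x z : R) by apply: posM; apply: pos_sl.
  have := gibbs_mean_incr (dbl V) pH2 pg pf.
  rewrite {2}/gibbs_mean ler_pdivlMr ?mean_exp_gt0 //; congr (_ * _ <= _).
  rewrite /gibbs_mean.
  have mE (f : (I -> bool) -> R) : mean (dbl V) (fun z => f (z \o inl) * expR (H2 z)) =
      mean V (fun x => f x * expR (hamK K V x)) * mean V (fun x => expR (hamK K V x)).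
    rewrite -mean_dbl_mul; apply: mean_ext => z.
    by rewrite /H2 expRD; ring.
  rewrite (mE (fun y => spin (y o) * spin (y x))).
  have -> : mean (dbl V) (fun z => expR (H2 z)) =
      mean V (fun x => expR (hamK K V x)) * mean V (fun x => expR (hamK K V x)).
    rewrite -[X in X * _](mean_ext (f := fun x => 1 * expR (hamK K V x))); last by move=> y; rewrite mul1r.
    by rewrite -mE; apply: mean_ext => z; rewrite mul1r.
  have Z := mean_exp_gt0 V (hamK K V).
  by rewrite /corr /gibbs_mean; field; rewrite gt_eqF.
have h2 x : 0 <= mean (dbl V) (fun z => sl o z * sr x z * expR (H2 z + g z)).
  apply: griffiths1; apply: posM; last exact/pos_exp/posD.
  by apply: posM; [apply: pos_sl|apply: pos_sr].
have h3 : mean (dbl V) (fun z => (1 + tau o z) * expR (H2 z + g z)) <= 2 * M.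
  rewrite /M -meanZ; apply: avg_le => z _; rewrite ler_wpM2r ?expR_ge0 //.
  by case: (@tau_pm R _ o z) => ->; lra.
rewrite meanZ mulr_ge0 ?expR_ge0 //.
rewrite meanB meanD !mean_sum meanZ subr_ge0.
apply: (@le_trans _ _ (2 * c * M)).
  by rewrite -mulrA mulrCA ler_wpM2l.
apply: (le_trans (ler_wpM2r M0 hc)).
rewrite -[leLHS]addr0; apply: lerD.
  rewrite big_distrl /=; apply: ler_sum => x _; rewrite meanZ -mulrA.
  exact: ler_wpM2l.
by apply: sumr_ge0 => x _; rewrite meanZ mulr_ge0.
Qed.

Lemma hamK_perm V V' x : perm_eq V V' -> hamK K V x = hamK K V' x.
Proof.
move=> p; rewrite !hamKE (perm_big _ p) /=; congr (_ * _).
by apply: eq_bigr => i _; rewrite (perm_big _ p).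
Qed.

Lemma psi_perm V V' a e : perm_eq V V' -> psi V a e = psi V' a e.
Proof.
move=> p; rewrite /psi (@mean_perm _ _ _ (dbl V')).
- apply: mean_ext => z; congr (expR _ * _).
    by rewrite /rep_energy !(hamK_perm _ p) (perm_big _ p).
  rewrite /obs !(perm_big _ p) /=; congr (_ * (_ * _ + _) - _).
  by apply: eq_bigr => i _; rewrite (perm_big _ p).
- by move=> [] i; rewrite ?mem_dbl ?mem_dblr (perm_mem p).
by move=> [] i; rewrite ?mem_dbl ?mem_dblr (perm_mem p).
Qed.

(** The factor (1 + s_i)/2 is the indicator of s_i = +, and [mean] puts + at every site that is not
    averaged over: [i] joins the boundary. *)
Lemma mean_proj (J : eqType) (i : J) (l : seq J) (f : (J -> bool) -> R) : i \notin l ->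
  mean (i :: l) (fun z : J -> bool => (1 + spin (z i)) / 2 * f z) = 2^-1 * mean l f.
Proof.
move=> il; rewrite /mean /= /avg1.
have h x : avg l (fun z : J -> bool => (1 + spin (z i)) / 2 * f z) x = (1 + spin (x i)) / 2 * avg l f x.
  rewrite avgMl // => y j b jl; rewrite upd_neq //.
  by apply: contraTneq jl => <-.
rewrite !h !updE /spin.
have -> : upd (fun=> true) i true = fun=> true by apply/funext => j; rewrite /upd; case: ifP.
by field.
Qed.

(* The factor of the field at [v] is split as
   [expR (a (s + s') - e (1 + s s')) = expR (- (a + e) (1 + s s')) +
   2 * sh (2 * a) * expR (- 2 * e) * (indicator of s = s' = 1)]; in the second term [v]
   joins the plus boundary. *)
Lemma psi_open v V a e : uniq (v :: V) ->
  exists2 k, 0 <= a v -> 0 <= k & psi (v :: V) a e =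
    psi (v :: V) (fun x => if x == v then 0 else a x) (fun x => if x == v then e x + a x else e x)
    + k * psi V (fun x => a x + K v x) e.
Proof.
move=> /= /andP[vV uV].
(* One half for the spin at [v] in each replica; [expR (K v v)] is the diagonal term of [hamK] at
   [v], one half from each replica. *)
exists (2^-1 * (2^-1 * (expR (- (2 * e v)) * (2 * sh (2 * a v)) * expR (K v v)))).
  move=> av; have s0 : 0 <= sh (2 * a v) by apply: sh_ge0; rewrite mulr_ge0.
  by do 2 (apply: mulr_ge0; first by rewrite invr_ge0);
    repeat (apply: mulr_ge0 => //); rewrite ?expR_ge0.
set a0 := fun x => if x == v then 0 else a x; set e0 := fun x => if x == v then _ else _.
pose X z : R := expR (hamK K (v :: V) (z \o inl) + hamK K (v :: V) (z \o inr) +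
  \sum_(x <- V) (a x * (sl x z + sr x z) - e x * (1 + tau x z))).
have E1 z : expR (rep_energy (v :: V) a e z) = expR (rep_energy (v :: V) a0 e0 z) +
   expR (- (2 * e v)) * (2 * sh (2 * a v)) * ((1 + spin (z (inl v))) / 2 * ((1 + spin (z (inr v))) / 2 * X z)).
  rewrite /rep_energy !big_cons {1}/a0 {1}/e0 eqxx mul0r sub0r.
  have -> : \sum_(x <- V) (a0 x * (sl x z + sr x z) - e0 x * (1 + tau x z)) =
     \sum_(x <- V) (a x * (sl x z + sr x z) - e x * (1 + tau x z)).
    apply: eq_big_seq => x xV; rewrite /a0 /e0.
    by have -> : (x == v) = false by apply: contraNF vV => /eqP <-.
  have XE s : expR (hamK K (v :: V) (z \o inl) + hamK K (v :: V) (z \o inr) +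
     (s + \sum_(x <- V) (a x * (sl x z + sr x z) - e x * (1 + tau x z)))) = expR s * X z.
    by rewrite addrCA expRD.
  rewrite !XE; set Y := X z.
  rewrite /tau -/(sl v z) -/(sr v z) /sh.
  case: (@sl_pm R _ v z) (@sr_pm R _ v z) => -> [] ->.
  - rewrite (_ : a v * (1 + 1) - e v * (1 + 1 * 1) = - (2 * e v) + 2 * a v); last by ring.
    rewrite (_ : - ((e v + a v) * (1 + 1 * 1)) = - (2 * e v) + - (2 * a v)); last by ring.
    by rewrite !expRD; field.
  - rewrite (_ : a v * (1 + -1) - e v * (1 + 1 * -1) = 0); last by ring.
    rewrite (_ : - ((e v + a v) * (1 + 1 * -1)) = 0); last by ring.
    by field.
  - rewrite (_ : a v * (-1 + 1) - e v * (1 + -1 * 1) = 0); last by ring.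
    rewrite (_ : - ((e v + a v) * (1 + -1 * 1)) = 0); last by ring.
    by field.
  rewrite (_ : a v * (-1 + -1) - e v * (1 + -1 * -1) = - ((e v + a v) * (1 + -1 * -1))); last by ring.
  by field.
(* Moving the field at [v] from [a] to [e] preserves their sum, hence the observable. *)
have f0 : (fun x => a0 x + e0 x) = (fun x => a x + e x).
  by apply/funext => x; rewrite /a0 /e0; case: eqP => // ->; ring.
rewrite /psi f0.
pose O z := obs (v :: V) (fun x => a x + e x) z.
rewrite (mean_ext (g := fun z => expR (rep_energy (v :: V) a0 e0 z) * O z +
  expR (- (2 * e v)) * (2 * sh (2 * a v)) * ((1 + spin (z (inl v))) / 2 *
    ((1 + spin (z (inr v))) / 2 * (X z * O z))))); last first.
  by move=> z; rewrite E1 /O; ring.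
rewrite meanD meanZ; congr (_ + _).
rewrite (@mean_perm _ _ _ (inl v :: inr v :: dbl V)); last 2 first.
- by case=> i h; rewrite 2!in_cons; move: h; rewrite ?mem_dbl ?mem_dblr in_cons;
    case/orP => [/eqP ->|->]; rewrite ?eqxx ?orbT.
- by case=> i; rewrite 2!in_cons ?mem_dbl ?mem_dblr in_cons => /or3P[/eqP h|/eqP h|->];
    rewrite ?orbT //; case: h => ->; rewrite eqxx.
rewrite mean_proj; last by rewrite inE mem_dbl.
rewrite mean_proj; last by rewrite mem_dblr.
rewrite (@mean_supp_eq _ _ _ (fun z => expR (K v v) *
   (expR (rep_energy V (fun x => a x + K v x) e z) * obs V (fun x => a x + K v x + e x) z))).
  by rewrite meanZ; ring.
move=> z hz.
have zl : sl v z = 1 :> R by rewrite /sl hz // mem_dbl.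
have zr : sr v z = 1 :> R by rewrite /sr hz // mem_dblr.
have tv : tau v z = 1 :> R by rewrite /tau zl zr mulr1.
(* With + at [v], its couplings become the field [K v] on the remaining sites. *)
have hamE (f : I -> I + I) : spin (z (f v)) = 1 :> R ->
   hamK K (v :: V) (z \o f) = hamK K V (z \o f) + \sum_(y <- V) K v y * spin (z (f y)) + K v v / 2.
  move=> fv; rewrite !hamKE !big_cons /= fv.
  under [X in _ + X]eq_bigr do rewrite big_cons /= fv.
  rewrite big_split /=.
  have -> : \sum_(i <- V) K i v * (spin (z (f i)) * 1) = \sum_(y <- V) K v y * spin (z (f y)).
    by apply: eq_bigr => i _; rewrite Ksym mulr1.
  have -> : \sum_(j <- V) K v j * (1 * spin (z (f j))) = \sum_(y <- V) K v y * spin (z (f y)).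
    by apply: eq_bigr => i _; rewrite mul1r.
  by field.
have -> : X z = expR (K v v) * expR (rep_energy V (fun x => a x + K v x) e z).
  rewrite -expRD; congr expR; rewrite !hamE // /rep_energy.
  rewrite (_ : \sum_(x <- V) ((a x + K v x) * (sl x z + sr x z) - e x * (1 + tau x z)) =
    \sum_(x <- V) (a x * (sl x z + sr x z) - e x * (1 + tau x z)) +
    (\sum_(x <- V) K v x * sl x z + \sum_(x <- V) K v x * sr x z)).
    by rewrite /sl /sr; field.
  by rewrite -!big_split; apply: eq_bigr => i _ /=; ring.
rewrite -mulrA; congr (_ * (_ * _)).
rewrite /O /obs; congr (_ * _ - _).
rewrite !big_cons tv zl subrr !mulr0 !add0r.
under [X in _ * (_ + X) + _]eq_bigr do rewrite big_cons tv zl.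
rewrite big_split /=.
have -> : \sum_(i <- V) K i v * (sl i z * 1 * (1 - tau i z * 1)) =
   \sum_(y <- V) K v y * (sl y z * (1 - tau y z)).
  by apply: eq_bigr => i _; rewrite Ksym !mulr1.
have -> : \sum_(j <- V) K v j * (1 * sl j z * (1 - 1 * tau j z)) =
   \sum_(y <- V) K v y * (sl y z * (1 - tau y z)).
  by apply: eq_bigr => i _; rewrite !mul1r.
have -> : \sum_(x <- V) (a x + K v x + e x) * (sl x z * (1 - tau x z)) =
  \sum_(x <- V) (a x + e x) * (sl x z * (1 - tau x z)) + \sum_(y <- V) K v y * (sl y z * (1 - tau y z)).
  by rewrite -big_split; apply: eq_bigr => i _ /=; ring.
by field.
Qed.

(** One branch of [psi_open] lowers the number of sites with a field, the other removes a site: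
    hence the double induction. It ends with [psi_notin], or with [psi_nofield], for which the
    hypothesis at [S] = [V] is the one required. *)
Lemma psi_ge0 V a e : uniq V -> (forall x, 0 <= a x) -> (forall x, 0 <= e x) ->
  (forall S, uniq S -> {subset S <= V} -> o \in S -> 2 * c <= escape V a e S) ->
  0 <= psi V a e.
Proof.
have [n] := ubnP (size V); elim: n V a e => // n IHn V a e.
have [m] := ubnP (count (fun x => a x != 0) V); elim: m V a e => // m IHm V a e.
rewrite ltnS => cm sV uV a0 e0 hS.
have [oV|oV] := boolP (o \in V); last exact: psi_notin.
have [[v vV av]|az] := pselect (exists2 v, v \in V & a v != 0); last first.
  have az' x : x \in V -> a x = 0.
    by move=> xV; apply/eqP/negPn/negP => h; apply: az; exists x.
  apply: psi_nofield => //; apply: le_trans (hS V uV (fun _ h => h) oV) _.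
  rewrite /escape le_eqVlt; apply/orP; left; apply/eqP; apply: eq_big_seq => x xV.
  rewrite az' // add0r mulrC big_seq_cond big1 ?addr0 //.
  by move=> i /andP[->].
have pV := perm_to_rem vV.
have uV' : uniq (v :: rem v V) by rewrite -(perm_uniq pV).
rewrite (psi_perm _ _ pV); have [k k0 ->] := psi_open a e uV'.
rewrite -(psi_perm _ _ pV); apply: addr_ge0.
  apply: IHm => //.
  - apply: leq_trans cm; rewrite !(permP pV) /= !eqxx /= av add0n add1n ltnS.
    by apply: sub_count => x /=; case: ifP => //; rewrite eqxx.
  - by move=> x; case: ifP.
  - by move=> x; case: ifP => // _; rewrite addr_ge0.
  move=> S uS SV oS; apply: le_trans (hS S uS SV oS) _.
  rewrite /escape le_eqVlt; apply/orP; left; apply/eqP; apply: eq_bigr => x _.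
  by congr (_ * (_ + _)); case: eqP => // ->; ring.
apply: mulr_ge0; first exact: k0.
apply: IHn => //.
- by rewrite size_rem // -ltnS prednK //; case: (V) vV.
- exact: rem_uniq.
- by move=> x; rewrite addr_ge0.
move=> S uS SV oS.
have vS : v \notin S by apply/negP => /SV; rewrite mem_rem_uniq // inE eqxx.
have SV' : {subset S <= V} by move=> x /SV /mem_rem.
apply: le_trans (hS S uS SV' oS) _.
rewrite /escape le_eqVlt; apply/orP; left; apply/eqP; apply: eq_bigr => x _; congr (_ * _).
by rewrite (perm_big _ pV) /= big_cons vS (Ksym x v); ring.
Qed.

(** Divided by Z^2 this reads c (1 - m^2) <= cov(s_o, H). If [H] is b times a fixed energy, the
    covariance is b times the derivative of m in b. *)
Theorem magnetization_growth V a : uniq V -> o \in V -> (forall x, 0 <= a x) ->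
  (forall S, uniq S -> {subset S <= V} -> o \in S -> 2 * c <= escape V a (fun=> 0) S) ->
  let H x := hamK K V x + \sum_(i <- V) a i * spin (x i) in
  let Z := mean V (fun x => expR (H x)) in
  let N := mean V (fun x => spin (x o) * expR (H x)) in
  is_true (c * (Z ^+ 2 - N ^+ 2) <= mean V (fun x => spin (x o) * H x * expR (H x)) * Z
    - N * mean V (fun x => H x * expR (H x))).
Proof.
move=> uV oV a0 hS H Z N.
have h := psi_ge0 uV a0 (fun=> lexx 0) hS.
rewrite -subr_ge0; move: h; congr (_ <= _).
pose w x := expR (H x).
rewrite /psi (mean_ext (g := fun z =>
   (spin (z (inl o)) * H (z \o inl) * w (z \o inl)) * w (z \o inr)
   - (spin (z (inl o)) * w (z \o inl)) * (H (z \o inr) * w (z \o inr))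
   - c * (w (z \o inl) * w (z \o inr)
     - (spin (z (inl o)) * w (z \o inl)) * (spin (z (inr o)) * w (z \o inr))))); last first.
  move=> z.
  have -> : expR (rep_energy V a (fun=> 0) z) = w (z \o inl) * w (z \o inr).
    rewrite /w -expRD; congr expR; rewrite /H addrACA; congr (_ + _).
    by rewrite -big_split; apply: eq_bigr => i _; rewrite mul0r subr0 mulrDr.
  have -> : obs V (fun x => a x + 0) z = sl o z * (H (z \o inl) - H (z \o inr)) - c * (1 - tau o z).
    rewrite /obs /H !hamKE opprD addrACA -mulrBr -!sumrB; congr (_ * (_ * _ + _) - _).
      apply: eq_bigr => i _; rewrite -sumrB; apply: eq_bigr => j _.
      rewrite /tau /sl /sr /=.
      case: (@spin_pm R (z (inl i))) (@spin_pm R (z (inl j))) => -> [] ->; ring.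
    apply: eq_bigr => i _; rewrite /tau /sl /sr /= addr0.
    by case: (@spin_pm R (z (inl i))) => ->; ring.
  by rewrite /tau /sl /sr; ring.
rewrite !meanB meanZ meanB (mean_dbl_mul V (fun x => spin (x o) * H x * w x) w).
rewrite (mean_dbl_mul V (fun x => spin (x o) * w x) (fun x => H x * w x)).
rewrite (mean_dbl_mul V w w) (mean_dbl_mul V (fun x => spin (x o) * w x) (fun x => spin (x o) * w x)).
by rewrite -/Z -/N; ring.
Qed.

End Susceptibility.

(** * Sharpness of the phase transition *)

Section SubSums.
Context {R : realType} {I : eqType}.

Lemma sum_filterC (S V : seq I) (F : I -> R) : uniq V -> uniq S -> {subset S <= V} ->
  \sum_(i <- V) F i = \sum_(i <- S) F i + \sum_(i <- V | i \notin S) F i.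
Proof.
move=> uV uS SV; rewrite -[X in _ = _ + X]big_filter.
have pV : perm_eq V (S ++ [seq i <- V | i \notin S]).
  rewrite uniq_perm // ?cat_uniq ?uS ?filter_uniq //=.
    by rewrite andbT; apply/hasPn => i; rewrite mem_filter => /andP[].
  by move=> i; rewrite mem_cat mem_filter; case: (boolP (i \in S)) => [/SV ->|].
by rewrite (perm_big _ pV) big_cat.
Qed.

Lemma ler_sum_subset (S V : seq I) (F : I -> R) : uniq V -> uniq S -> {subset S <= V} ->
  (forall i, 0 <= F i) -> \sum_(i <- S) F i <= \sum_(i <- V) F i.
Proof.
by move=> uV uS SV F0; rewrite (sum_filterC F uV uS SV) lerDl sumr_ge0.
Qed.

Lemma is_derive_mean (l : seq I) (f E : (I -> bool) -> R) (b : R) :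
  is_derive b 1 (fun b => mean l (fun x => f x * expR (b * E x)))
    (mean l (fun x => f x * E x * expR (b * E x))).
Proof.
rewrite /mean; elim: l (fun=> true) => [|i l IH] x /=.
  by apply: is_derive_eq; rewrite /GRing.scale /=; ring.
have h1 := IH (upd x i true); have h2 := IH (upd x i false).
rewrite /avg1 (_ : (fun b => _) = (2^-1 : R) \*:
   ((fun b => avg l (fun x => f x * expR (b * E x)) (upd x i true)) +
    (fun b => avg l (fun x => f x * expR (b * E x)) (upd x i false)))); last first.
  by apply/funext => c; rewrite mulrC.
by apply: is_derive_eq; rewrite mulrC.
Qed.

Lemma corr_map {J : eqType} (h : I -> J) (K : I -> I -> R) (K' : J -> J -> R) S i j :
  injective h -> (forall i j, K' (h i) (h j) = K i j) ->
  corr K' (map h S) (h i) (h j) = corr K S i j.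
Proof.
move=> hi hK; rewrite /corr /gibbs_mean.
have HE z : hamK K' (map h S) z = hamK K S (z \o h).
  rewrite !hamKE big_map; congr (_ * _); apply: eq_bigr => k _; rewrite big_map.
  by apply: eq_bigr => k' _; rewrite hK.
rewrite -(mean_map S (fun x => expR (hamK K S x)) hi).
rewrite -(mean_map S (fun x => spin (x i) * spin (x j) * expR (hamK K S x)) hi).
by congr (_ / _); apply: mean_ext => z; rewrite HE.
Qed.

End SubSums.

Section Sharpness.
Context {R : realType} (J : nat -> R) (T : R).
Context (J_ge0 : forall k, 0 <= J k).
Context (JT : forall (i : int) (S : seq int), uniq S -> \sum_(j <- S) J `|i - j|%N <= T).
Implicit Types (S V : seq int) (b : R).

Definition coupling b (i j : int) : R := b * J `|i - j|%N.

(* With [T] the total coupling of a site, the coupling of [i] to the sites outside [S]. *)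
Definition outfield S (i : int) : R := T - \sum_(j <- S) J `|i - j|%N.

(** The functional of Duminil-Copin and Tassion, with [b * J] in place of its tanh; the couplings to
    the infinitely many sites outside [S] are summed up in [outfield]. *)
Definition phiS b S : R := \sum_(i <- S) corr (coupling b) S 0 i * (b * outfield S i).

(** Plus spins at all sites off [V] act on [V] only as a field, so that this boundary condition fits
    a finite system. *)
Definition plus_energy V x : R :=
  hamK (coupling 1) V x + \sum_(i <- V) outfield V i * spin (x i).

Definition plus_mag b V : R := gibbs_mean V (fun x => b * plus_energy V x) (fun x => spin (x 0)).

Lemma coupling_ge0 b i j : 0 <= b -> 0 <= coupling b i j.
Proof. by move=> b0; rewrite mulr_ge0. Qed.

Lemma coupling_sym b i j : coupling b i j = coupling b j i.
Proof. by rewrite /coupling distnC. Qed.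

Lemma hamK_coupling b V x : hamK (coupling b) V x = b * hamK (coupling 1) V x.
Proof.
rewrite !hamKE mulrCA; congr (_ * _); rewrite big_distrr; apply: eq_bigr => i _ /=.
by rewrite big_distrr; apply: eq_bigr => j _ /=; rewrite /coupling mul1r; ring.
Qed.

Lemma outfield_ge0 V i : uniq V -> 0 <= outfield V i.
Proof. by move=> uV; rewrite subr_ge0 JT. Qed.

Lemma corr_coupling_le b b' V i j : 0 <= b -> b <= b' ->
  corr (coupling b) V i j <= corr (coupling b') V i j.
Proof.
move=> b0 bb'; rewrite [X in _ <= X]/corr.
rewrite (_ : hamK (coupling b') V = fun x => hamK (coupling b) V x + hamK (coupling (b' - b)) V x).
  apply: gibbs_mean_incr; [| |exact: pos_spin2].
    by apply: pos_hamK => k l; apply: coupling_ge0.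
  by apply: pos_hamK => k l; apply: coupling_ge0; rewrite subr_ge0.
apply/funext => x; rewrite (hamK_coupling b') (hamK_coupling b) (hamK_coupling (b' - b)); ring.
Qed.

Lemma phiS_le b b' S : 0 <= b -> b <= b' -> uniq S -> phiS b S <= phiS b' S.
Proof.
move=> b0 bb' uS; apply: ler_sum => i _; apply: ler_pM.
- by apply: corr_ge0 => k l; apply: coupling_ge0.
- by rewrite mulr_ge0 // outfield_ge0.
- exact: corr_coupling_le.
by rewrite ler_wpM2r // outfield_ge0.
Qed.

Lemma plus_magE b V : plus_mag b V = mean V (fun x => spin (x 0) * expR (b * plus_energy V x)) /
  mean V (fun x => 1 * expR (b * plus_energy V x)).
Proof. by congr (_ / _); apply: mean_ext => x; rewrite mul1r. Qed.

Lemma plus_mag_ge0 b V : 0 <= b -> uniq V -> 0 <= plus_mag b V.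
Proof.
move=> b0 uV; apply: gibbs_mean_ge0; last exact: pos_spin.
apply: posZ => //; apply: posD.
  by apply: pos_hamK => i j; apply: coupling_ge0.
by apply: pos_sum => i _; apply: posZ; [exact: outfield_ge0|exact: pos_spin].
Qed.

(** The growth inequality with c = 1/2 and the field of the plus boundary. *)
Lemma plus_mag_growth b V : 0 < b -> uniq V -> 0 \in V ->
  (forall S, uniq S -> 0 \in S -> 1 <= phiS b S) ->
  exists2 d, is_derive b 1 (plus_mag^~ V) d & (1 - plus_mag b V ^+ 2) / (2 * b) <= d.
Proof.
move=> b_gt0 uV oV hphi; have b0 := ltW b_gt0.
set E := plus_energy V.
pose N b := mean V (fun x => spin (x 0) * expR (b * E x)).
pose Z b := mean V (fun x => 1 * expR (b * E x)).
have Z1 c : Z c = mean V (fun x => expR (c * E x)) by apply: mean_ext => x; rewrite mul1r.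
have Z0 c : 0 < Z c by rewrite Z1 mean_exp_gt0.
have dN := is_derive_mean V (fun x => spin (x 0)) E b.
have dZ := is_derive_mean V (fun=> 1) E b.
set N' := mean V _ in dN; set Z' := mean V _ in dZ.
have ZN0 : Z b != 0 by rewrite gt_eqF.
exists ((N' * Z b - N b * Z') / Z b ^+ 2).
  have -> : plus_mag^~ V = N \* (fun c => (Z c)^-1).
    by apply/funext => c; rewrite plus_magE.
  have dZV := is_deriveV ZN0 dZ.
  apply: is_derive_eq; rewrite /GRing.scale /= -/(N b) -/(Z b).
  by rewrite -exprVn; field.
(* The couplings from [S] to the rest of [V] and those to the outside of [V] together make up
   [outfield S], so [escape] is [phiS b S]. *)
have hS S : uniq S -> {subset S <= V} -> 0 \in S ->
    2 * 2^-1 <= escape (coupling b) 0 V (fun i => b * outfield V i) (fun=> 0) S.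
  move=> uS SV oS; rewrite divff //; apply: le_trans (hphi S uS oS) _.
  rewrite le_eqVlt; apply/orP; left; apply/eqP; apply: eq_bigr => i _; congr (_ * _).
  rewrite addr0 /coupling -big_distrr -mulrDr /outfield; congr (_ * _).
  by rewrite (sum_filterC _ uV uS SV); ring.
have := magnetization_growth (fun i j => coupling_ge0 i j b0) (coupling_sym b)
   (_ : 0 <= 2^-1) uV oV (fun i => mulr_ge0 b0 (outfield_ge0 i uV)) hS.
rewrite invr_ge0 ler0n => /(_ isT) key; cbv zeta in key; move: key.
pose H x := hamK (coupling b) V x + \sum_(i <- V) b * outfield V i * spin (x i).
have HE x : H x = b * E x.
  rewrite /H /E /plus_energy hamK_coupling [RHS]mulrDr; congr (_ + _).
  rewrite big_distrr; apply: eq_bigr => i _ /=.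
  by rewrite mulrA.
have -> : mean V (fun x => expR (H x)) = Z b by rewrite Z1; apply: mean_ext => x; rewrite HE.
have -> : mean V (fun x => spin (x 0) * expR (H x)) = N b by apply: mean_ext => x; rewrite HE.
have -> : mean V (fun x => spin (x 0) * H x * expR (H x)) = b * N'.
  by rewrite -meanZ; apply: mean_ext => x; rewrite HE; ring.
have -> : mean V (fun x => H x * expR (H x)) = b * Z'.
  by rewrite -meanZ; apply: mean_ext => x; rewrite HE; ring.
move=> key; rewrite plus_magE -/(N b) -/(Z b).
rewrite ler_pdivlMr ?exprn_gt0 // expr_div_n.
rewrite [X in X <= _](_ : _ = (2^-1 * (Z b ^+ 2 - N b ^+ 2)) / b); last first.
  by field; rewrite ZN0 gt_eqF.
by rewrite ler_pdivrMr //; apply: le_trans key _; rewrite le_eqVlt; apply/orP; left; apply/eqP; ring.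
Qed.

(** Suppose m(b') < 1/2. The derivative is nonnegative from [b] on, so m < 1/2 at the intermediate
    point x of the mean value theorem, and the derivative there is at least (1/2) / (2 x) >= 1 / (4
    b'). The bound does not depend on [V], which lets it survive the limit of infinite volume. *)
Lemma plus_mag_lower b b' V : 0 < b -> b < b' -> uniq V -> 0 \in V ->
  (forall S, uniq S -> 0 \in S -> 1 <= phiS b S) ->
  Num.min (2^-1) ((b' - b) / (4 * b')) <= plus_mag b' V.
Proof.
move=> b0 bb' uV oV hphi.
have [m12|m12] := leP (2^-1) (plus_mag b' V); first by rewrite ge_min m12.
rewrite ge_min; apply/orP; right.
pose P (c d : R) := is_derive c 1 (plus_mag^~ V) d /\ (1 - plus_mag c V ^+ 2) / (2 * c) <= d.
have gr c : b <= c -> exists d, P c d.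
  move=> bc; have [|S uS oS|d d1 d2] := @plus_mag_growth c V _ uV oV.
  - exact: lt_le_trans bc.
  - exact: le_trans (hphi S uS oS) (phiS_le (ltW b0) bc uS).
  by exists d.
have [g gP] : exists g : R -> R, forall c, b <= c -> P c (g c).
  have h c : exists d, b <= c -> P c d.
    by have [/gr[d]|h] := pselect (b <= c); [exists d|exists 0 => /h].
  by have [g gP] := choice h; exists g.
have mvt c : b <= c -> c < b' -> exists2 x, x \in `]c, b'[ &
    plus_mag b' V - plus_mag c V = g x * (b' - c).
  move=> bc cb'; apply: (@MVT R (plus_mag^~ V) g) => //.
    by move=> x /andP[/= cx _]; have [] := gP x (le_trans bc (ltW cx)).
  apply: derivable_within_continuous => x /andP[/= cx _].
  by have [[]] := gP x (le_trans bc cx).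
have m_le1 c : plus_mag c V <= 1.
  by apply: gibbs_mean_le => x; case: (@spin_pm R (x 0)) => ->; lra.
have [x xI xE] := mvt b (lexx _) bb'.
have bx : b < x by move: xI; rewrite in_itv /= => /andP[].
have xb' : x < b' by move: xI; rewrite in_itv /= => /andP[].
have x0 : 0 < x by apply: lt_trans bx.
have mx0 : 0 <= plus_mag x V by rewrite plus_mag_ge0 // ltW.
have gx y : b <= y -> 0 <= g y.
  move=> by_; have [_] := gP y by_; apply: le_trans.
  rewrite divr_ge0 ?subr_ge0 ?mulr_ge0 ?(le_trans (ltW b0) by_) //.
  by rewrite expr_le1 // plus_mag_ge0 // (le_trans (ltW b0) by_).
have mxb' : plus_mag x V <= plus_mag b' V.
  have [y yI yE] := mvt x (ltW bx) xb'.
  move: (yI); rewrite in_itv /= => /andP[xy _].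
  rewrite -subr_ge0 yE; apply: mulr_ge0; last by rewrite subr_ge0 ltW.
  by apply: gx; rewrite ltW // (lt_trans bx).
have mb0 := plus_mag_ge0 (ltW b0) uV.
have [_ gxl] := gP x (ltW bx).
apply: (@le_trans _ _ (g x * (b' - b))); last by rewrite -xE; lra.
rewrite mulrC ler_wpM2r ?subr_ge0 ?(ltW bb') //.
apply: le_trans gxl; apply: (@le_trans _ _ (2^-1 / (2 * x))).
  rewrite (_ : 2^-1 / (2 * x) = (4 * x)^-1); last by field; rewrite gt_eqF.
  by rewrite lef_pV2 ?posrE ?mulr_gt0 // ?(lt_trans x0) // ler_pM2l // ltW.
rewrite ler_wpM2r ?invr_ge0 ?mulr_ge0 ?(ltW x0) //.
have : plus_mag x V ^+ 2 <= 2^-1 ^+ 2.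
  by rewrite ler_pXn2r ?nnegrE ?invr_ge0 //; lra.
by rewrite expr2; lra.
Qed.

Lemma shift_inj (w : int) : injective (fun i : int => i + w).
Proof. exact: addIr. Qed.

(** Lieb's inequality around each site [w], with the translate of [S0] to [w], gives X <= |S0| + p X
    for the largest susceptibility X of a site of [V]. As [V] is finite, X is finite and the
    inequality can be solved for it. *)
Lemma finite_susceptibility b S0 : 0 <= b -> uniq S0 -> 0 \in S0 -> phiS b S0 < 1 ->
  exists2 chi, 0 <= chi & forall V w, uniq V -> w \in V ->
    \sum_(z <- V) corr (coupling b) V w z <= chi.
Proof.
move=> b0 uS0 oS0 phi1; set p := phiS b S0 in phi1.
have p1 : 0 < 1 - p by rewrite subr_gt0.
have cg i j : 0 <= coupling b i j by exact: coupling_ge0.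
exists ((size S0)%:R / (1 - p)); first by rewrite divr_ge0 // ltW.
move=> V w0 uV w0V.
pose chi w := \sum_(z <- V) corr (coupling b) V w z.
pose X := \big[Num.max/0]_(w <- V) chi w.
have Xge w : w \in V -> chi w <= X by move=> wV; apply: le_bigmax_seq.
have X0 : 0 <= X.
  by apply: le_trans (Xge w0 w0V); apply: sumr_ge0 => z _; apply: corr_ge0.
suff step w : w \in V -> chi w <= (size S0)%:R + p * X.
  have p0 : 0 <= p.
    by apply: sumr_ge0 => i _; rewrite mulr_ge0 ?corr_ge0 // mulr_ge0 // outfield_ge0.
  have XX : X <= (size S0)%:R + p * X.
    by rewrite {1}/X big_seq; apply: bigmax_le => //; rewrite addr_ge0 // mulr_ge0.
  by apply: le_trans (Xge w0 w0V) _; rewrite ler_pdivlMr //; lra.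
move=> wV.
pose h i := i + w.
have hi : injective h by exact: shift_inj.
pose S := [seq v <- V | v - w \in S0].
have uS : uniq S by exact: filter_uniq.
have SV : {subset S <= V} by move=> i; rewrite mem_filter => /andP[].
have wS : w \in S by rewrite mem_filter subrr oS0.
have uh : uniq (map h S0) by rewrite map_inj_uniq.
have Sh : {subset S <= map h S0}.
  move=> i; rewrite mem_filter => /andP[iS _]; apply/mapP; exists (i - w) => //.
  by rewrite /h subrK.
(* Cutting the translate of [S0] down to [V] can only lower correlations. *)
have corrS i : i \in S -> corr (coupling b) S w i <= corr (coupling b) S0 0 (i - w).
  move=> iS; apply: le_trans (corr_mono cg (coupling_sym b) uh uS Sh wS iS) _.
  rewrite -(corr_map S0 0 (i - w) hi (_ : forall i j, coupling b (h i) (h j) = coupling b i j)).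
    by rewrite /h add0r subrK.
  by move=> k l; rewrite /coupling /h (_ : k + w - (l + w) = k - l)//; ring.
rewrite /chi (sum_filterC _ uV uS SV); apply: lerD.
  apply: (@le_trans _ _ (\sum_(z <- S) 1)).
    by apply: ler_sum => i _; apply: corr_le1.
  rewrite big_const_seq count_predT iter_addr_0 ler_nat.
  rewrite -(size_map (fun v => v - w)); apply: uniq_leq_size.
    by rewrite map_inj_uniq //; apply: addIr.
  by move=> _ /mapP[v + ->]; rewrite mem_filter => /andP[].
apply: (@le_trans _ _ (\sum_(z <- V | z \notin S) \sum_(i <- S)
   \sum_(j <- V | j \notin S) coupling b i j * corr (coupling b) S w i * corr (coupling b) V j z)).
  apply: ler_sum => z zS.
  apply: le_trans (lieb_ineq cg (coupling_sym b) uV uS SV wS zS) _.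
  by apply: ler_sum => i _; rewrite big_filter.
rewrite exchange_big /=; under eq_bigr do rewrite exchange_big /=.
apply: (@le_trans _ _ (\sum_(i <- S) corr (coupling b) S0 0 (i - w) * (b * outfield S0 (i - w)) * X)).
  rewrite big_seq [leRHS]big_seq; apply: ler_sum => i iS.
  apply: (@le_trans _ _ (\sum_(j <- V | j \notin S) coupling b i j * corr (coupling b) S w i * X)).
    rewrite big_seq_cond [leRHS]big_seq_cond; apply: ler_sum => j /andP[jV jS].
    rewrite -big_distrr /=; apply: ler_wpM2l; first by apply: mulr_ge0; [exact: cg|exact: corr_ge0].
    apply: le_trans (Xge j jV); rewrite /chi (sum_filterC _ uV uS SV) lerDr.
    by apply: sumr_ge0 => z _; apply: corr_ge0.
  rewrite -big_distrl /= ler_wpM2r // -big_distrl /= mulrC; apply: ler_pM.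
  - by apply: corr_ge0.
  - by apply: sumr_ge0 => j _; apply: cg.
  - exact: corrS.
  (* The sites of [V] outside [S] avoid the whole translate of [S0], so their coupling to [i] is
     part of its [outfield]. *)
  rewrite /coupling -big_distrr /= ler_wpM2l // /outfield lerBrDr.
  have := JT i (_ : uniq ([seq j <- V | j \notin S] ++ map h S0)).
  rewrite big_cat big_filter big_map /=.
  rewrite (_ : \sum_(j <- S0) J `|i - h j|%N = \sum_(j <- S0) J (absz (i - w - j)%R)); last first.
    by apply: eq_bigr => j _; rewrite /h (_ : i - (j + w) = i - w - j)//; ring.
  apply; rewrite cat_uniq filter_uniq // uh andbT /=; apply/hasPn => _ /mapP[j jS0 ->].
  rewrite mem_filter negb_and; case: (boolP (h j \in V)) => hV; rewrite ?orbT //= orbF negbK.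
  by rewrite mem_filter hV andbT /h addrK.
rewrite -big_distrl /= ler_wpM2r // /p /phiS.
rewrite -(big_map (fun v => v - w) xpredT (fun i => corr (coupling b) S0 0 i * (b * outfield S0 i))).
apply: ler_sum_subset => //.
- by rewrite map_inj_uniq //; apply: addIr.
- by move=> _ /mapP[v + ->]; rewrite mem_filter => /andP[].
by move=> i; rewrite mulr_ge0 ?corr_ge0 // mulr_ge0 // outfield_ge0.
Qed.

End Sharpness.

(** * Energies in infinite volume *)

Section UnorderedSum.
Context {R : realType} {I : choiceType}.
Implicit Types (D B : set I) (f g : I -> R).

Definition abs_summable D f := (\esum_(i in D) `|f i|%:E < +oo)%E.

Lemma esum_subset D D' (a : I -> \bar R) : D `<=` D' -> (forall i, 0 <= a i)%E ->
  (\esum_(i in D) a i <= \esum_(i in D') a i)%E.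
Proof.
move=> DD' a0; rewrite [leRHS](esumID D) // setIidr //.
by rewrite leeDl // esum_ge0.
Qed.

Lemma abs_summable_sub D D' f : D `<=` D' -> abs_summable D' f -> abs_summable D f.
Proof.
by move=> DD'; apply: le_lt_trans; apply: esum_subset => // i; rewrite lee_fin.
Qed.

Lemma pos_part_fin D f : abs_summable D f ->
  (\esum_(i in D) (Num.max (f i) 0)%:E \is a fin_num) /\
  fine (\esum_(i in D) (Num.max (f i) 0)%:E) <= fine (\esum_(i in D) `|f i|%:E).
Proof.
move=> fD.
have h : (\esum_(i in D) (Num.max (f i) 0)%:E <= \esum_(i in D) `|f i|%:E)%E.
  by apply: le_esum => i _; rewrite lee_fin ge_max ler_norm normr_ge0.
have p0 : (0 <= \esum_(i in D) (Num.max (f i) 0)%:E)%E.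
  by apply: esum_ge0 => i _; rewrite lee_fin le_max lexx orbT.
have fin1 : \esum_(i in D) (Num.max (f i) 0)%:E \is a fin_num.
  by rewrite ge0_fin_numE //; apply: le_lt_trans fD.
split => //; apply: fine_le => //; rewrite ge0_fin_numE //.
by apply: le_trans h.
Qed.

Lemma abs_summableN D f : abs_summable D f -> abs_summable D (fun i => - f i).
Proof.
rewrite /abs_summable; suff -> : (\esum_(i in D) `|- f i|%:E = \esum_(i in D) `|f i|%:E)%E by [].
by apply: eq_esum => i _; rewrite normrN.
Qed.

Lemma usum_split D B f : abs_summable D f ->
  unordered_sum D f = unordered_sum (D `&` B) f + unordered_sum (D `&` ~` B) f.
Proof.
move=> fD.
have half g : abs_summable D g -> fine (\esum_(i in D) (Num.max (g i) 0)%:E) =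
   fine (\esum_(i in D `&` B) (Num.max (g i) 0)%:E) +
   fine (\esum_(i in D `&` ~` B) (Num.max (g i) 0)%:E).
  move=> gD; rewrite (esumID B); last by move=> i _; rewrite lee_fin le_max lexx orbT.
  rewrite fineD //.
    by have [] := @pos_part_fin (D `&` B) g (abs_summable_sub (@subIsetl _ _ _) gD).
  by have [] := @pos_part_fin (D `&` ~` B) g (abs_summable_sub (@subIsetl _ _ _) gD).
rewrite /unordered_sum (half f) // (half (fun i => - f i)); first by ring.
exact: abs_summableN.
Qed.

Lemma usum_abs D f : abs_summable D f ->
  `|unordered_sum D f| <= fine (\esum_(i in D) `|f i|%:E).
Proof.
move=> fD; have [_ h1] := pos_part_fin fD.
have [_] := pos_part_fin (abs_summableN fD).
have -> : \esum_(i in D) `|- f i|%:E = \esum_(i in D) `|f i|%:E.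
  by apply: eq_esum => i _; rewrite normrN.
move=> h2; rewrite /unordered_sum.
have p0 g : 0 <= fine (\esum_(i in D) (Num.max (g i) 0)%:E).
  by apply/fine_ge0/esum_ge0 => i _; rewrite lee_fin le_max lexx orbT.
have := p0 f; have := p0 (fun i => - f i); rewrite ler_norml; lra.
Qed.

Lemma eq_usum D f g : (forall i, D i -> f i = g i) -> unordered_sum D f = unordered_sum D g.
Proof.
by move=> h; rewrite /unordered_sum; congr (fine _ - fine _); apply: eq_esum => i Di; rewrite h.
Qed.

Lemma usum_pos D f : (forall i, D i -> 0 <= f i) ->
  unordered_sum D f = fine (\esum_(i in D) (f i)%:E).
Proof.
move=> f0; rewrite /unordered_sum [X in _ - fine X]esum1 ?subr0; last first.
  by move=> i Di; rewrite max_r // oppr_le0 f0.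
by congr fine; apply: eq_esum => i Di; rewrite max_l // f0.
Qed.

Lemma usumN D f : unordered_sum D (fun i => - f i) = - unordered_sum D f.
Proof.
rewrite /unordered_sum opprB; congr (_ - fine _).
by apply: eq_esum => i _; rewrite opprK.
Qed.

Lemma usum_seq (s : seq I) f : uniq s -> unordered_sum [set` s] f = \sum_(i <- s) f i.
Proof.
move=> us; have half g : fine (\esum_(i in [set` s]) (Num.max (g i) 0)%:E) =
    \sum_(i <- s) Num.max (g i) 0.
  rewrite esum_fset //; last by move=> i _; rewrite lee_fin le_max lexx orbT.
  by rewrite -fsbig_seq // sumEFin.
rewrite /unordered_sum !half -sumrB; apply: eq_bigr => i _.
by rewrite /Num.max oppr_lt0; case: ltgtP => [h|h|->]; rewrite ?oppr0; lra.
Qed.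

Lemma esum_tail D f (eps : R) : abs_summable D f -> 0 < eps ->
  exists s : seq I, [/\ uniq s, [set` s] `<=` D &
    fine (\esum_(i in D `&` ~` [set` s]) `|f i|%:E) <= eps].
Proof.
move=> fD e0; set S := (\esum_(i in D) `|f i|%:E)%E in fD.
have a0 i : (0 <= `|f i|%:E)%E by rewrite lee_fin.
have Sfin : S \is a fin_num by rewrite ge0_fin_numE // esum_ge0.
have [_ [F [finF FD] <-] hF] := ub_ereal_sup_adherent e0 Sfin.
have [s us sF] : exists2 s : seq I, uniq s & [set` s] = F.
  exists (finmap.enum_fset (fset_set F)); first exact: finmap.fset_uniq.
  by rewrite -[RHS]fset_setK.
exists s; split => //; first by rewrite sF.
have tail_fin : \esum_(i in D `&` ~` [set` s]) `|f i|%:E \is a fin_num.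
  rewrite ge0_fin_numE ?esum_ge0 //; apply: le_lt_trans fD.
  by apply: esum_subset => //; apply: subIsetl.
have {hF} : (S - eps%:E < \esum_(i in F) `|f i|%:E)%E by rewrite esum_fset.
rewrite -lee_fin fineK // -sF {1}/S (esumID [set` s]) // setIidr; last by rewrite sF.
set A := \esum_(i in [set` s]) _.
have Afin : A \is a fin_num.
  rewrite ge0_fin_numE ?esum_ge0 //; apply: le_lt_trans fD.
  by apply: esum_subset => //; rewrite sF.
rewrite -(fineK Afin) -(fineK tail_fin) -EFinN -!EFinD lte_fin lee_fin; lra.
Qed.

End UnorderedSum.

(** * The energy of a finite volume in Z and its value under a constant boundary condition *)

Section Energy.
Context {R : realType} (J : nat -> R).
Context (J_ge0 : forall k, 0 <= J k) (J0 : J 0%N = 0).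
Context (J_summable : (\sum_(0 <= k <oo) (J k)%:E < +oo)%E).
Implicit Types (L : {fset int}) (x y : int -> bool).

Let Je_ge0 (i : int) : (0 <= (J `|i|%N)%:E)%E. Proof. by rewrite lee_fin. Qed.

Lemma J_int_fin : (\esum_(i in [set: int]) (J `|i|%N)%:E < +oo)%E.
Proof.
have Jfin : (\esum_(k in [set: nat]) (J k)%:E < +oo)%E.
  by rewrite -nneseries_esumT // => n; rewrite lee_fin.
rewrite (esumID [set i : int | 0 <= i]) // !setTI lte_add_pinfty //.
  rewrite (@reindex_esum _ _ _ [set: nat] _ Posz) //; split.
  - by move=> n _ /=.
  - by move=> m n _ _ [].
  by move=> [n|n] //= _; exists n.
rewrite (@reindex_esum _ _ _ [set n : nat | (0 < n)%N] _ (fun n => - n%:Z)).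
  under eq_esum do rewrite abszN absz_nat.
  by apply: le_lt_trans Jfin; apply: esum_subset => // n; rewrite lee_fin.
split.
- by move=> n /= n0; apply/negP; rewrite -ltNge oppr_lt0.
- by move=> m n _ _ /oppr_inj[].
move=> [n|n] /= h; first by exfalso; apply: h.
by exists n.+1 => //; rewrite NegzE.
Qed.

Definition Jtot : R := fine (\esum_(i in [set: int]) (J `|i|%N)%:E).

Lemma esum_shift (i : int) :
  (\esum_(j in [set: int]) (J `|i - j|%N)%:E = \esum_(j in [set: int]) (J `|j|%N)%:E)%E.
Proof.
rewrite [RHS](@reindex_esum _ _ _ [set: int] _ (fun j => i - j)) //; split => //.
  by move=> j k _ _ /addrI/oppr_inj.
by move=> j _; exists (i - j) => //; ring.
Qed.

Lemma Jtot_ge (i : int) (S : seq int) : uniq S -> \sum_(j <- S) J `|i - j|%N <= Jtot.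
Proof.
move=> uS; rewrite -lee_fin fineK; last first.
  by rewrite ge0_fin_numE ?J_int_fin // esum_ge0.
rewrite -(esum_shift i) -sumEFin; apply: esum_ge; exists [set` S].
  by split => //; apply: finite_seq.
by rewrite -fsbig_seq.
Qed.

Lemma esum_outside (i : int) (S : seq int) : uniq S ->
  (\esum_(j in ~` [set` S]) (J `|i - j|%N)%:E = (outfield J Jtot S i)%:E)%E.
Proof.
move=> uS; have Tfin : (\esum_(i in [set: int]) (J `|i|%N)%:E)%E \is a fin_num.
  by rewrite ge0_fin_numE ?J_int_fin // esum_ge0.
have := esum_shift i; rewrite (esumID [set` S]) // !setTI => h.
have hS : (\esum_(j in [set` S]) (J `|i - j|%N)%:E = (\sum_(j <- S) J `|i - j|%N)%:E)%E.
  transitivity (\sum_(j \in [set` S]) (J `|i - j|%N)%:E)%E; first by apply: esum_fset => [|j _]; [exact: finite_seq|rewrite lee_fin].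
  rewrite -fsbig_seq //.
  by rewrite sumEFin.
by rewrite /outfield EFinB /Jtot fineK // -h hS addeAC subee // add0e.
Qed.

Definition pairJ (p : int * int) : R := J `|p.1 - p.2|%N.

Definition star (i : int) (A : set int) : set (int * int) :=
  [set p | p.1 < p.2 /\ ((p.1 = i /\ A p.2) \/ (p.2 = i /\ A p.1))].

Lemma esum_star i A : ~ A i ->
  (\esum_(p in star i A) (pairJ p)%:E = \esum_(j in A) (J `|i - j|%N)%:E)%E.
Proof.
move=> nA; pose e (j : int) := if i < j then (i, j) else (j, i).
rewrite (@reindex_esum _ _ _ A _ e).
  by apply: eq_esum => j _; rewrite /pairJ /e; case: ifP => //= _; rewrite distnC.
split.
- move=> j Aj; rewrite /e /star; case: ltgtP => /= [ij|ji|ij].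
  + by split => //; left.
  + by split => //; right.
  by case: nA; rewrite ij.
- move=> j k _ _; rewrite /e; case: ltP => ij; case: ltP => ik [] //.
  + by move=> h1 h2; rewrite -h1 h2.
  by move=> h1 h2; rewrite h1 h2.
move=> [p q] [/= pq [[ip Aq]|[iq Ap]]].
  by exists q => //; rewrite /e -ip pq.
by exists p => //; rewrite /e -iq ltNge (ltW pq).
Qed.

Definition touching L : set (int * int) :=
  [set p | p.1 < p.2 /\ ((p.1 \in L) || (p.2 \in L))].

Definition pair_energy x (p : int * int) : R := pairJ p * (spin (x p.1) * spin (x p.2)).

Lemma abs_pair_energy x p : `|pair_energy x p| = pairJ p.
Proof.
rewrite normrM ger0_norm ?J_ge0 //.
by case: (@spin_pm R (x p.1)) (@spin_pm R (x p.2)) => -> [] ->;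
  rewrite ?mulrNN ?mulrN ?mulNr ?normrN ?mulr1 ?normr1 mulr1.
Qed.

(** Each further site adds at most its star, whose total coupling is at most that of a site to all
    of Z. *)
Lemma touching_fin L : (\esum_(p in touching L) (pairJ p)%:E < +oo)%E.
Proof.
pose D (l : seq int) : set (int * int) := [set p | p.1 < p.2 /\ ((p.1 \in l) || (p.2 \in l))].
have p0 p : (0 <= (pairJ p)%:E)%E by rewrite lee_fin J_ge0.
suff h l : (\esum_(p in D l) (pairJ p)%:E < +oo)%E by exact: (h L).
elim: l => [|i l IH].
  rewrite (_ : D [::] = set0) ?esum_set0 //.
  by rewrite -subset0 => p [].
apply: (@le_lt_trans _ _ (\esum_(p in star i (~` [set i])) (pairJ p)%:E + \esum_(p in D l) (pairJ p)%:E)%E).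
  rewrite (esumID (star i (~` [set i]))) //; apply: leeD; apply: esum_subset => //.
  move=> [p q] [[/= pq h] ns]; split => //=.
  move: h; rewrite !inE => /orP[/orP[/eqP pi|->]//|/orP[/eqP qi|->]]; last by rewrite orbT.
    case: ns; split => //=; left; split => //= qi.
    by move: pq; rewrite pi qi ltxx.
  case: ns; split => //=; right; split => //= pi.
  by move: pq; rewrite pi qi ltxx.
rewrite lte_add_pinfty // esum_star //; last by apply.
apply: le_lt_trans J_int_fin; rewrite -(esum_shift i).
by apply: esum_subset => // j; rewrite lee_fin.
Qed.

Lemma pair_energy_summable L x : abs_summable (touching L) (pair_energy x).
Proof.
rewrite /abs_summable (eq_esum (b := fun p => (pairJ p)%:E)); first exact: touching_fin.
by move=> p _; rewrite abs_pair_energy.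
Qed.

Lemma energyE L x : energy J L x = unordered_sum (touching L) (pair_energy x).
Proof. by []. Qed.

Lemma energy_quasilocal L (eps : R) : 0 < eps -> exists G : seq int,
  forall x y, (forall i, i \in G -> x i = y i) -> `|energy J L x - energy J L y| <= eps.
Proof.
move=> e0; have e2 : 0 < eps / 2 by rewrite divr_gt0.
have sumJ : abs_summable (touching L) pairJ.
  rewrite /abs_summable (eq_esum (b := fun p => (pairJ p)%:E)); first exact: touching_fin.
  by move=> p _; rewrite ger0_norm // J_ge0.
have [s [us sL tail]] := esum_tail sumJ e2.
exists (map fst s ++ map snd s) => x y xy.
rewrite !energyE (usum_split [set` s] (pair_energy_summable L x)).
rewrite (usum_split [set` s] (pair_energy_summable L y)).
rewrite setIidr // !usum_seq //.
rewrite (eq_big_seq (pair_energy y)); last first.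
  move=> p ps; rewrite /pair_energy !xy // mem_cat; apply/orP.
    by right; apply: map_f.
  by left; apply: map_f.
rewrite opprD addrACA subrr add0r; apply: le_trans (ler_normB _ _) _.
have h z : `|unordered_sum (touching L `&` ~` [set` s]) (pair_energy z)| <= eps / 2.
  apply: le_trans (usum_abs _) _.
    exact: abs_summable_sub (@subIsetl _ _ _) (pair_energy_summable L z).
  apply: le_trans tail; rewrite le_eqVlt; apply/orP; left; apply/eqP; congr fine.
  by apply: eq_esum => p _; rewrite abs_pair_energy ger0_norm // J_ge0.
by have := h x; have := h y; lra.
Qed.

(** The difference of the two energies involves only pairs that avoid [L]. *)
Lemma energy_consistent L L' x y : {subset L <= L'} ->
  (forall i, i \notin L -> x i = y i) ->
  energy J L' x - energy J L x = energy J L' y - energy J L y.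
Proof.
move=> LL' xy.
have E z : energy J L' z - energy J L z = unordered_sum (touching L' `&` ~` touching L) (pair_energy z).
  rewrite !energyE (usum_split (touching L) (pair_energy_summable L' z)) setIidr; first by ring.
  by move=> p [pp /orP[]] /LL' h; split => //; rewrite h ?orbT.
rewrite !E; apply: eq_usum => p [[pp _] nt].
have : ~~ ((p.1 \in L) || (p.2 \in L)) by apply/negP => h; apply: nt.
by rewrite negb_or => /andP[p1 p2]; rewrite /pair_energy !xy.
Qed.

(** [hamK] is half a sum over ordered pairs, whose diagonal vanishes because [J 0] = 0. *)
Lemma usum_inside L x :
  unordered_sum [set p : int * int | p.1 < p.2 /\ (p.1 \in L) && (p.2 \in L)] (pair_energy x)
  = hamK (coupling J 1) (finmap.enum_fset L) x.
Proof.
set l := finmap.enum_fset L.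
have ul : uniq l by exact: finmap.fset_uniq.
pose s := [seq p <- [seq (i, j) | i <- l, j <- l] | p.1 < p.2].
have us : uniq s by apply/filter_uniq/allpairs_uniq => // -[a b] [c d] _ _ [-> ->].
rewrite (_ : [set p : int * int | _] = [set` s]); last first.
  apply/seteqP; split => -[i j] /=.
    by move=> [ij /andP[iL jL]]; rewrite mem_filter /= ij; apply/allpairsP; exists (i, j).
  rewrite mem_filter /= => /andP[ij /allpairsP[[a b] /= [aL bL [ei ej]]]]; subst i j.
  by split => //; apply/andP.
rewrite usum_seq // big_filter big_mkcond big_allpairs_dep /= hamKE.
pose F (i j : int) : R := if i < j then pair_energy x (i, j) else 0.
have h : \sum_(i <- l) \sum_(j <- l) coupling J 1 i j * (spin (x i) * spin (x j)) =
    \sum_(i <- l) \sum_(j <- l) F i j + \sum_(i <- l) \sum_(j <- l) F j i.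
  rewrite -big_split; apply: eq_bigr => i _; rewrite -big_split; apply: eq_bigr => j _ /=.
  rewrite /F /pair_energy /pairJ /coupling mul1r; case: (ltgtP i j) => /= [ij|ij|->].
  - by rewrite addr0.
  - by rewrite add0r distnC; ring.
  by rewrite distnn J0 mul0r addr0.
rewrite h [X in _ + X]exchange_big /=.
by rewrite -/F; field.
Qed.

Lemma usum_star i (A : set int) x s : ~ A i -> (forall j, A j -> x j = s) ->
  (\esum_(j in A) (J `|i - j|%N)%:E)%E \is a fin_num ->
  unordered_sum (star i A) (pair_energy x) =
    spin s * (fine (\esum_(j in A) (J `|i - j|%N)%:E) * spin (x i)).
Proof.
move=> nA As fin1.
have h p : star i A p -> pair_energy x p = spin s * spin (x i) * pairJ p.
  by move=> [pp [[p1 /As p2]|[p2 /As p1]]]; rewrite /pair_energy p1 p2; ring.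
have [E|E] : spin s * spin (x i) = 1 :> R \/ spin s * spin (x i) = -1 :> R.
  by case: (@spin_pm R s) (@spin_pm R (x i)) => -> [] ->; rewrite ?mulr1 ?mulrNN ?mulr1; [left|right|right|left]; lra.
- rewrite (eq_usum (g := pairJ)); last by move=> p /h ->; rewrite E mul1r.
  rewrite usum_pos; last by move=> p _; apply: J_ge0.
  by rewrite esum_star // mulrCA E mulr1.
rewrite (eq_usum (g := fun p => - pairJ p)); last by move=> p /h ->; rewrite E mulN1r.
rewrite usumN usum_pos; last by move=> p _; apply: J_ge0.
by rewrite esum_star // mulrCA E mulrN1.
Qed.

(** A pair that touches [L] lies inside [L] or belongs to the star of exactly one site of [L]
    towards the complement. This is where the field [outfield] of [plus_energy] comes from. *)
Lemma energy_boundary L x s : (forall i, i \notin L -> x i = s) ->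
  energy J L x = hamK (coupling J 1) (finmap.enum_fset L) x +
    spin s * \sum_(i <- finmap.enum_fset L) outfield J Jtot (finmap.enum_fset L) i * spin (x i).
Proof.
move=> xs; set l := finmap.enum_fset L.
have ul : uniq l by exact: finmap.fset_uniq.
pose In := [set p : int * int | p.1 < p.2 /\ (p.1 \in L) && (p.2 \in L)].
rewrite energyE (usum_split In (pair_energy_summable L x)) setIidr; last first.
  by move=> p [pp /andP[p1 _]]; split => //; rewrite p1.
rewrite usum_inside; congr (_ + _).
pose A : set int := ~` [set` l].
pose D (k : seq int) : set (int * int) := [set p | exists2 i, i \in k & star i A p].
have DL (k : seq int) : {subset k <= l} -> D k `<=` touching L.
  move=> kl p [i ik [pp [[pi Ap]|[pi Ap]]]]; split => //; apply/orP; [left|right];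
    by apply: kl; rewrite pi.
have fin1 i : (\esum_(j in A) (J `|i - j|%N)%:E)%E \is a fin_num.
  by rewrite esum_outside.
have nA i : i \in l -> ~ A i by move=> il; apply.
have -> : touching L `&` ~` In = D l.
  apply/seteqP; split => p.
    move=> [[pp h] nin].
    case/orP: h => hp.
      exists p.1 => //; split => //; left; split => // p2.
      by apply: nin; split => //; apply/andP.
    exists p.2 => //; split => //; right; split => // p1.
    by apply: nin; split => //; apply/andP.
  move=> Dp; split; first exact: DL Dp.
  move: Dp => [i il [pp [[_ Ap]|[_ Ap]]]] [_ /andP[h1 h2]]; exact: Ap.
rewrite big_distrr /=.
(* The stars are split off one by one; their outer set [A] remains the complement of all of [L]. *)
suff h (k : seq int) : uniq k -> {subset k <= l} -> unordered_sum (D k) (pair_energy x) =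
    \sum_(i <- k) spin s * (outfield J Jtot l i * spin (x i)) by exact: h.
elim: k => [|i k IH] /=.
  move=> _ _; rewrite big_nil (_ : D [::] = [set` (Nil (int * int))]) ?usum_seq ?big_nil //.
  by apply/seteqP; split => p // [].
move=> /andP[ik uk] kl.
have kl' : {subset k <= l} by move=> j jk; apply: kl; rewrite inE jk orbT.
have il : i \in l by apply: kl; rewrite mem_head.
have Dsum := abs_summable_sub (DL _ kl) (pair_energy_summable L x).
rewrite (usum_split (star i A) Dsum) big_cons; congr (_ + _).
  rewrite (_ : _ `&` _ = star i A); last first.
    by rewrite setIidr // => p h; exists i; rewrite ?mem_head.
  rewrite (@usum_star i A x s) //; last by move=> j Aj; apply: xs; apply/negP.
  by rewrite esum_outside.
rewrite -IH //; congr (unordered_sum _ _); apply/seteqP; split => p.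
  move=> [[j]]; rewrite inE => /orP[/eqP -> //|jk] h _; by exists j.
move=> [j jk h]; split; first by exists j => //; rewrite inE jk orbT.
move: h => [pp [[h1 h2]|[h1 h2]]] [_ [[h3 h4]|[h3 h4]]].
- by move: ik; rewrite -h3 h1 jk.
- by apply: h2; rewrite h3.
- by apply: h2; rewrite h3.
by move: ik; rewrite -h3 h1 jk.
Qed.

End Energy.

(** * Gibbs kernels *)

Section ProductTopology.
Context {I : eqType}.
Implicit Types (x y : config I) (G : seq I).

Definition agree_on G (x : config I) : set (config I) :=
  [set y | forall i, i \in G -> y i = x i].

Lemma nbhs_agree G x : nbhs x (agree_on G x).
Proof.
elim: G => [|i G IH]; first by apply: filterS (filterT) => y _ i.
have hi : nbhs x [set y : config I | y i = x i].
  have hb : nbhs (x i) [set x i] by apply: discrete_set1.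
  exact: (@proj_continuous I (fun=> bool) i x [set x i] hb).
apply: filterS (filterI hi IH) => y [/= yi yG] j.
by rewrite inE => /orP[/eqP ->//|/yG].
Qed.

Definition agree_filter x : set_system (config I) :=
  filter_from [set: seq I] (fun G => agree_on G x).

Lemma agree_filter_filter x : Filter (agree_filter x).
Proof.
apply: filter_from_filter; first by exists [::].
move=> G G' _ _; exists (G ++ G') => // y h; split => i iG; apply: h;
  by rewrite mem_cat iG ?orbT.
Qed.

Lemma agree_nbhs x (U : set (config I)) : nbhs x U -> exists G, agree_on G x `<=` U.
Proof.
have FF := agree_filter_filter x.
have cv : agree_filter x --> x.
  apply/cvg_sup => i V [W] [[B] oB <-] /= Bxi BV.
  exists [:: i] => // y /= h; apply: BV => /=.
  by rewrite h // mem_head.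
by move=> /cv [G _ h]; exists G.
Qed.

(** Uniform continuity in terms of coordinates: the set [G] does not depend on the configuration. *)
Definition quasilocal {R : realType} (f : config I -> R) :=
  forall eps, 0 < eps -> exists G, forall x y, agree_on G x y -> `|f x - f y| <= eps.

Lemma quasilocal_continuous {R : realType} (f : config I -> R) : quasilocal f -> continuous f.
Proof.
move=> qf x; apply/cvgrPdist_le => eps e0.
have [G h] := qf eps e0.
by near=> y; apply: h; near: y; exact: nbhs_agree.
Unshelve. all: end_near. Qed.

Lemma config_compact : compact [set: config I].
Proof.
have := @tychonoff I (fun=> bool) (fun=> setT) (fun=> bool_compact).
by congr compact; apply/seteqP; split.
Qed.

End ProductTopology.

Section GibbsKernel.
Context {R : realType} (J : nat -> R) (beta : R).
Context (J_ge0 : forall k, 0 <= J k) (J0 : J 0%N = 0) (beta_ge0 : 0 <= beta).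
Context (J_summable : (\sum_(0 <= k <oo) (J k)%:E < +oo)%E).
Implicit Types (L : {fset int}) (x y : int -> bool) (f g : (int -> bool) -> R).

Let seqL L : seq int := finmap.enum_fset L.

Definition boltz L x : R := expR (beta * energy J L x).

(** The Gibbs kernel as an operator on functions; the normalizations of the two averages cancel,
    which makes it agree with [gibbs_kernel] on indicators of cylinders. *)
Definition gibbs_avg L f x : R := avg (seqL L) (fun y => f y * boltz L y) x / avg (seqL L) (boltz L) x.

Lemma avg_gt0 (l : seq int) f x : (forall y, 0 < f y) -> 0 < avg l f x.
Proof.
by move=> f0; elim: l x => //= i l IH x; rewrite /avg1 divr_gt0 // addr_gt0.
Qed.

Lemma boltz_gt0 L x : 0 < boltz L x. Proof. exact: expR_gt0. Qed.

(** The ratio [r] of the Boltzmann weights of [L'] and [L] does not depend on the spins in [L].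
    Averaging over [L] first therefore changes neither side, and the partition function of [L]
    cancels. *)
Lemma gibbs_avg_consistent L L' f x : {subset L <= L'} ->
  gibbs_avg L' (gibbs_avg L f) x = gibbs_avg L' f x.
Proof.
move=> LL'; rewrite /gibbs_avg; congr (_ / _).
set l := seqL L; set l' := seqL L'.
have ll' : {subset l <= l'} by move=> i /LL'.
pose r y := boltz L' y / boltz L y.
have ir : indep l r.
  move=> y i b il; rewrite /r /boltz -!expRB -!mulrBr.
  rewrite (@energy_consistent _ _ J_ge0 J_summable L L' (upd y i b) y LL') // => j jL.
  by rewrite upd_neq //; apply: contraNneq jL => ->.
have rE y : boltz L' y = boltz L y * r y.
  by rewrite /r mulrCA divff ?mulr1 // gt_eqF // boltz_gt0.
have E h : avg l' h x = avg l' (avg l h) x by rewrite avg_sub.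
rewrite E [RHS]E.
congr (avg l' _ x); apply/funext => y.
rewrite [RHS](_ : _ = avg l (fun z => f z * boltz L z) y * r y); last first.
  by rewrite -avgMr //; congr avg; apply/funext => z; rewrite rE mulrA.
rewrite (_ : avg l _ y = avg l (boltz L) y *
    (avg l (fun z => f z * boltz L z) y / avg l (boltz L) y * r y)).
  by rewrite mulrA [X in X * _ = _]mulrC divfK // gt_eqF // avg_gt0 // => z; apply: boltz_gt0.
pose q z := avg l (fun z => f z * boltz L z) z / avg l (boltz L) z * r z.
have iq : indep l q.
  apply: indepM => // z i b il.
  by rewrite !(@indep_avg _ _ l _ z i b il).
rewrite -/(q y) -(avgMr _ _ iq); congr avg; apply/funext => z.
by rewrite rE /q; ring.
Qed.

Lemma gibbs_avgM L f g x : indep (seqL L) g ->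
  gibbs_avg L (fun y => g y * f y) x = g x * gibbs_avg L f x.
Proof.
move=> ig; rewrite /gibbs_avg mulrA -avgMl //; congr (_ / _).
by congr avg; apply/funext => y; rewrite mulrA.
Qed.

Lemma gibbs_avgD L f g x : gibbs_avg L (fun y => f y + g y) x = gibbs_avg L f x + gibbs_avg L g x.
Proof.
rewrite /gibbs_avg -mulrDl -avgD; congr (_ / _); congr avg; apply/funext => y.
by rewrite mulrDl.
Qed.

Lemma gibbs_avg_ge0 L f x : (forall y, 0 <= f y) -> 0 <= gibbs_avg L f x.
Proof.
move=> f0; apply: divr_ge0; last by apply/ltW/avg_gt0 => y; apply: boltz_gt0.
rewrite -(avg_cst (seqL L) 0 x); apply: avg_le => y _.
by rewrite mulr_ge0 // ltW // boltz_gt0.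
Qed.

Lemma gibbs_avg1 L x : gibbs_avg L (fun=> 1) x = 1.
Proof.
rewrite /gibbs_avg (_ : (fun y => 1 * boltz L y) = boltz L).
  by rewrite divff // gt_eqF // avg_gt0 // => y; apply: boltz_gt0.
by apply/funext => y; rewrite mul1r.
Qed.

Lemma gibbs_avgZ L c f x : gibbs_avg L (fun y => c * f y) x = c * gibbs_avg L f x.
Proof. exact: gibbs_avgM. Qed.

Lemma glueE L (s : {ffun L -> bool}) x (i : L) : Defs.glue s x (val i) = s i.
Proof. by rewrite /Defs.glue valK. Qed.

Lemma glue_out L (s : {ffun L -> bool}) x i : i \notin L -> Defs.glue s x i = x i.
Proof. by move=> iL; rewrite /Defs.glue insubF //; apply/negbTE. Qed.

Lemma avg_prod_eq (l : seq int) (v : int -> bool) x : uniq l ->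
  avg l (fun y => \prod_(i <- l) ((y i == v i)%:R : R)) x = 2^-1 ^+ size l.
Proof.
elim: l x => [|i l IH] x /=; first by rewrite big_nil.
move=> /andP[il ul]; rewrite /avg1.
have h y : avg l (fun y => \prod_(i <- i :: l) ((y i == v i)%:R : R)) y = (y i == v i)%:R * 2^-1 ^+ size l.
  rewrite -(IH y ul) -(@avgMl _ _ l _ (fun y => (y i == v i)%:R)).
    by congr (avg l _ y); apply/funext => z; rewrite big_cons.
  by move=> z j b jl; rewrite upd_neq //; apply: contraTneq jl => <-.
by rewrite !h !updE exprS; case: (v i) => /=; field.
Qed.

Lemma avg_glue L f x :
  avg (seqL L) f x = 2^-1 ^+ size (seqL L) * \sum_(s : {ffun L -> bool}) f (Defs.glue s x).
Proof.
have uL : uniq (seqL L) by exact: finmap.fset_uniq.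
(* A partition of unity: for each [y] that equals [x] off [L], exactly one [s] satisfies
   [glue s x = y]. *)
transitivity (avg (seqL L) (fun y => \sum_(s : {ffun L -> bool})
    f (Defs.glue s x) * \prod_(i <- seqL L) ((y i == Defs.glue s x i)%:R : R)) x); last first.
  rewrite avg_sum mulrC big_distrl; apply: eq_bigr => s _ /=.
  by rewrite avgZ avg_prod_eq.
apply: avg_eqx => y yx.
pose s0 : {ffun L -> bool} := [ffun i => y (val i)].
rewrite (bigD1 s0) //= [X in _ + X]big1 ?addr0.
  have -> : Defs.glue s0 x = y.
    apply/funext => i; case: (boolP (i \in L)) => iL; last by rewrite glue_out // yx.
    by rewrite (glueE s0 x [` iL]%fset) ffunE.
  by rewrite big1 ?mulr1 // => i _; rewrite eqxx.
move=> s ss0; have [k sk] : exists k, s k != s0 k.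
  apply/existsP; rewrite -negb_forall; apply: contra ss0 => /forallP h.
  by apply/eqP/ffunP => k; apply/eqP.
apply/eqP; rewrite mulf_eq0; apply/orP; right; rewrite prodf_seq_eq0.
apply/hasP; exists (val k) => /=; first exact: valP.
by rewrite glueE; move: sk; rewrite ffunE eq_sym => /negPf ->.
Qed.

Lemma gibbs_kernelE L (s : {ffun L -> bool}) x :
  gibbs_kernel J beta s x = gibbs_avg L (\1_(cylinder s : set (int -> bool))) x.
Proof.
rewrite /gibbs_avg !avg_glue invfM mulrACA divff ?mul1r; last first.
  by rewrite expf_neq0 // invr_eq0 pnatr_eq0.
rewrite /gibbs_kernel; congr (_ / _).
rewrite (bigD1 s) //= big1 ?addr0 => [|t ts].
  by rewrite indicE mem_set ?mul1r // => k; rewrite glueE.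
rewrite indicE memNset ?mul0r // => h; move/eqP: ts; apply.
by apply/ffunP => k; rewrite -(glueE t x) h.
Qed.

Lemma gibbs_kernel_quasilocal L (s : {ffun L -> bool}) :
  quasilocal (gibbs_kernel J beta s : config int -> R).
Proof.
move=> eps e0.
(* Numerator and denominator of the kernel each change by a factor of at most exp(beta d), and exp(2
   beta d) <= 1 + eps. The + 1 keeps [d] meaningful at [beta] = 0. As the kernel lies in [0, 1], the
   relative error [eps] is also an absolute one. *)
pose d := ln (1 + eps) / (2 * beta + 1).
have b1 : 0 < 2 * beta + 1 by rewrite ltr_wpDl // mulr_ge0.
have l0 : 0 < ln (1 + eps) by rewrite ln_gt0 // ltrDl.
have d0 : 0 < d by rewrite divr_gt0.
have [G hG] := energy_quasilocal J_ge0 J_summable L d0.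
exists G.
pose Z x := \sum_(t : {ffun L -> bool}) expR (beta * energy J L (Defs.glue t x)).
have key x y : (forall i, i \in G -> x i = y i) ->
    gibbs_kernel J beta s x <= (1 + eps) * gibbs_kernel J beta s y.
  move=> xy.
  have hE (t : {ffun L -> bool}) : energy J L (Defs.glue t x) <= energy J L (Defs.glue t y) + d.
    have : forall i, i \in G -> Defs.glue t x i = Defs.glue t y i.
      by move=> i iG; rewrite /Defs.glue; case: insubP => // _; rewrite xy.
    by move=> /hG; rewrite ler_norml => /andP[_]; rewrite lerBlDl addrC.
  have hE' (t : {ffun L -> bool}) : energy J L (Defs.glue t y) <= energy J L (Defs.glue t x) + d.
    have : forall i, i \in G -> Defs.glue t y i = Defs.glue t x i.
      by move=> i iG; rewrite /Defs.glue; case: insubP => // _; rewrite xy.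
    by move=> /hG; rewrite ler_norml => /andP[_]; rewrite lerBlDl addrC.
  have e1 (u v : R) : u <= v + d -> expR (beta * u) <= expR (beta * d) * expR (beta * v).
    by move=> uv; rewrite -expRD ler_expR -mulrDr ler_wpM2l // addrC.
  have Zpos z : 0 < Z z.
    rewrite /Z (bigD1 s) //= ltr_pwDl ?expR_gt0 // sumr_ge0 // => t _; exact: expR_ge0.
  have Zle : Z y <= expR (beta * d) * Z x.
    by rewrite /Z big_distrr; apply: ler_sum => t _ /=; apply: e1.
  rewrite /gibbs_kernel -/(Z x) -/(Z y) ler_pdivrMr // mulrAC mulrA ler_pdivlMr // -mulrA.
  have : expR (beta * d) * expR (beta * d) <= 1 + eps.
    rewrite -expRD -[leRHS]lnK ?posrE ?addr_gt0 // ler_expR /d -mulrDl.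
    rewrite mulrA ler_pdivrMr //; nra.
  move=> h; apply: (@le_trans _ _ ((expR (beta * d) * expR (beta * energy J L (Defs.glue s y))) *
     (expR (beta * d) * Z x))).
    by apply: ler_pM; [exact: expR_ge0|exact: ltW|exact: e1|].
  by rewrite mulrACA [Z x * _]mulrC; apply: ler_wpM2r => //; rewrite mulr_ge0 ?expR_ge0 // ltW.
have k1 x : gibbs_kernel J beta s x <= 1.
  rewrite gibbs_kernelE -[leRHS](gibbs_avg1 L x) -subr_ge0 -mulN1r -gibbs_avgZ -gibbs_avgD.
  apply: gibbs_avg_ge0 => y; rewrite indicE; case: (_ \in _) => /=; lra.
have k0 x : 0 <= gibbs_kernel J beta s x.
  by rewrite gibbs_kernelE; apply: gibbs_avg_ge0 => y; rewrite indicE.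
move=> x y xy; rewrite ler_norml.
have xy' i : i \in G -> x i = y i by move=> /xy ->.
have := key x y xy'; have := key y x xy.
have := k1 x; have := k1 y; have := k0 x; have := k0 y; nra.
Qed.

End GibbsKernel.

(** * The measure of a positive linear functional *)

Section UnitLebesgue.
Context {R : realType}.

Definition unit_leb : set (measurableTypeR R) -> \bar R :=
  mrestr lebesgue_measure (measurable_itv `[(0:R), 1[).

HB.instance Definition _ := Measure.on unit_leb.

Lemma unit_lebT : unit_leb setT = 1%E.
Proof.
rewrite /unit_leb /mrestr setTI.
by have := @lebesgue_measure_itv R `[0, 1[; rewrite /= lte_fin ltr01 sube0.
Qed.

HB.instance Definition _ := Measure_isProbability.Build _ _ _ unit_leb unit_lebT.

End UnitLebesgue.

Lemma continuous_borel {R : realType} (f : config int -> R) :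
  continuous f -> measurable_fun setT (f : borel_config -> R).
Proof.
move=> /continuousP cf; apply: (measurability (@measurable_realfun.RGenOInfty.G R)).
  exact: measurable_realfun.RGenOInfty.measurableE.
move=> _ [_ [r ->] <-]; rewrite setTI.
by apply: sub_sigma_algebra; apply: cf; apply: interval_open.
Qed.

Definition bnd {R : realType} {X : Type} (f : X -> R) := exists M, forall x, `|f x| <= M.

Lemma bndD {R : realType} {X : Type} (f g : X -> R) : bnd f -> bnd g -> bnd (fun x => f x + g x).
Proof.
by move=> [M hM] [N hN]; exists (M + N) => x; apply: le_trans (ler_normD _ _) (lerD _ _).
Qed.

Lemma bndM {R : realType} {X : Type} (f g : X -> R) : bnd f -> bnd g -> bnd (fun x => f x * g x).
Proof.
by move=> [M hM] [N hN]; exists (M * N) => x; rewrite normrM ler_pM.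
Qed.

Lemma bnd_cst {R : realType} {X : Type} (c : R) : bnd (fun _ : X => c).
Proof. by exists `|c|. Qed.

Lemma bnd_bool {R : realType} {X : Type} (b : X -> bool) : bnd (fun x => (b x)%:R : R).
Proof. by exists 1 => x; case: (b x); rewrite ?normr1 ?normr0. Qed.

Lemma bnd_sum {R : realType} {X : Type} (T : Type) (s : seq T) (F : T -> X -> R) :
  (forall t, bnd (F t)) -> bnd (fun x => \sum_(t <- s) F t x).
Proof.
move=> hF; elim: s => [|t s [M hM]].
  by exists 0 => x; rewrite big_nil normr0.
have [N hN] := hF t; exists (N + M) => x; rewrite big_cons.
exact: le_trans (ler_normD _ _) (lerD _ _).
Qed.

Section Riesz.
Context {R : realType}.
Context (ell : ((int -> bool) -> R) -> R).
Context (ellD : forall f g, bnd f -> bnd g -> ell (fun x => f x + g x) = ell f + ell g).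
Context (ellZ : forall c f, bnd f -> ell (fun x => c * f x) = c * ell f).
Context (ell_ge0 : forall f, bnd f -> (forall x, 0 <= f x) -> 0 <= ell f).
Context (ell1 : ell (fun=> 1) = 1).
Implicit Types (w : seq bool) (x y : int -> bool) (u : R) (f : (int -> bool) -> R).

(** The enumeration 0, -1, 1, -2, 2, etc. of Z, by which cylinders become binary words. *)
Definition site (n : nat) : int := if odd n then Negz n./2 else Posz n./2.
Definition rank_site (i : int) : nat := match i with Posz n => n.*2 | Negz n => n.*2.+1 end.

Lemma siteK : cancel site rank_site.
Proof.
move=> n; rewrite /site; case: ifP => on /=.
  by rewrite -[RHS]odd_double_half on.
by rewrite -[RHS]odd_double_half on.
Qed.

Lemma rank_siteK : cancel rank_site site.
Proof.
by case=> n; rewrite /site /= odd_double /= ?doubleK ?uphalf_double // -uphalfE uphalf_double.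
Qed.

(** Words are read backwards: the head is the spin at the last site of the enumeration reached so
    far, so that refining a cylinder is a cons. *)
Fixpoint cylw w x : bool :=
  if w is b :: w' then (x (site (size w')) == b) && cylw w' x else true.

Definition weight w : R := ell (fun x => (cylw w x)%:R).

Lemma weight_ge0 w : 0 <= weight w.
Proof. by apply: ell_ge0 => [|x]; [exact: bnd_bool|rewrite ler0n]. Qed.

Lemma weight0 : weight [::] = 1.
Proof. by rewrite /weight /= ell1. Qed.

Lemma weight_split w : weight w = weight (true :: w) + weight (false :: w).
Proof.
rewrite /weight -ellD; try exact: bnd_bool; congr ell; apply/funext => x /=.
by case: (x _); case: (cylw w x) => /=; rewrite ?addr0 ?add0r.
Qed.

(** The interval of a word is cut in two: on the left the extension by [false], of length
    [weight (false :: w)], on the right the extension by [true]. *)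
Fixpoint left_end w : R :=
  if w is b :: w' then left_end w' + (if b then weight (false :: w') else 0) else 0.

Fixpoint word u (k : nat) : seq bool :=
  if k is k'.+1 then (left_end (word u k') + weight (false :: word u k') <= u) :: word u k' else [::].

Lemma word_in u k : 0 <= u < 1 ->
  left_end (word u k) <= u < left_end (word u k) + weight (word u k).
Proof.
move=> u01; elim: k => [|k /andP[l r]] /=; first by rewrite weight0 add0r.
have [h|h] := leP (left_end (word u k) + weight (false :: word u k)) u.
  by rewrite h /= -addrA [weight (false :: _) + _]addrC -weight_split.
by rewrite addr0 l h.
Qed.

Lemma word_eq u w : left_end w <= u < left_end w + weight w -> word u (size w) = w.
Proof.
elim: w => //= b w IH /andP[l r].
have [wt wf] := (weight_ge0 (true :: w), weight_ge0 (false :: w)).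
have ws := weight_split w.
rewrite IH; last first.
  by apply/andP; split; case: b l r => l r; lra.
by congr cons; case: b l r => l r; [rewrite l | rewrite leNgt; apply/negbTE; rewrite negbK; lra].
Qed.

(* The intervals [left_end w, left_end w + weight w[ are nested like the
   cylinders; the spin at the k-th site is read off the k-th of them that contains [u]. *)
Definition sample u : int -> bool := fun i => head false (word u (rank_site i).+1).

Lemma cylw_sample u w : cylw w (sample u) = (word u (size w) == w).
Proof.
elim: w => //= b w ->; rewrite /sample siteK /= eqseq_cons.
case: (word u (size w) =P w) => [->|]; rewrite ?andbF // !andbT.
Qed.

Lemma measurable_word k w : measurable [set u : measurableTypeR R | word u k = w].
Proof.
elim: k w => [|k IH] [|b w] /=.
- by rewrite (_ : [set u | _] = setT) //; apply/seteqP; split.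
- by rewrite (_ : [set u | _] = set0) //; apply/seteqP; split.
- by rewrite (_ : [set u | _] = set0) //; apply/seteqP; split.
pose c := left_end w + weight (false :: w).
rewrite (_ : [set u | _] = [set u | word u k = w] `&` (if b then `[c, +oo[%classic else ~` `[c, +oo[%classic)).
  by apply: measurableI => //; case: b; [|apply: measurableC]; apply: measurable_itv.
apply/seteqP; split => u /=.
  move=> [h e]; split => //; rewrite e in h; rewrite -/c in h.
  case: b h => h; rewrite /= in_itv /= andbT //.
  by rewrite h.
move=> [-> ]; rewrite -/c; case: b => /=; rewrite in_itv /= andbT.
  by move=> ->.
by move=> /negP/negbTE ->.
Qed.

Lemma cylw_agree w x y : cylw w x -> cylw w y ->
  forall j, (j < size w)%N -> x (site j) = y (site j).
Proof.
elim: w => //= b w IH /andP[/eqP xb xw] /andP[/eqP yb yw] j.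
rewrite ltnS leq_eqVlt => /orP[/eqP ->|jw]; first by rewrite xb yb.
exact: IH.
Qed.

Fixpoint spell x k : seq bool := if k is k'.+1 then x (site k') :: spell x k' else [::].

Lemma size_spell x k : size (spell x k) = k.
Proof. by elim: k => //= k ->. Qed.

Lemma cylw_spell x k : cylw (spell x k) x.
Proof. by elim: k => //= k ->; rewrite size_spell eqxx. Qed.

Lemma sites_bound (G : seq int) : exists k, forall i, i \in G -> (rank_site i < k)%N.
Proof.
exists (\max_(i <- G) rank_site i).+1 => i iG; rewrite ltnS.
exact: leq_bigmax_seq.
Qed.

Lemma spell_agree (G : seq int) : exists k, forall x y, cylw (spell x k) y -> agree_on G x y.
Proof.
have [k hk] := sites_bound G; exists k => x y xy i iG.
rewrite -(rank_siteK i); apply: esym; apply: (cylw_agree (cylw_spell x k) xy).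
by rewrite size_spell hk.
Qed.

Lemma measurable_sample : measurable_fun setT (sample : measurableTypeR R -> borel_config).
Proof.
apply: (@measurability _ _ (measurableTypeR R) borel_config setT sample (@open (config int))) => //.
move=> _ [U oU <-]; rewrite setTI.
(* An open set is the union of the cylinders that it contains, and there are only countably many
   words. *)
pose B (n : nat) : set (measurableTypeR R) :=
  if choice.unpickle n is Some w then
    if pselect (forall y, cylw w y -> U y) then [set u | word u (size w) = w] else set0
  else set0.
rewrite (_ : _ @^-1` U = \bigcup_n B n).
  apply: bigcupT_measurable => n; rewrite /B; case: (choice.unpickle n) => [w|] //.
  by case: (pselect _) => ?; [exact: measurable_word|exact: measurable0].
apply/seteqP; split => u /=.
  move=> Uu; have [G hG] := agree_nbhs (open_nbhs_nbhs (conj oU Uu)).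
  have [k hk] := spell_agree G.
  exists (choice.pickle (spell (sample u) k)) => //; rewrite /B choice.pickleK.
  case: (pselect _) => [?|[]].
    by apply/eqP; rewrite -cylw_sample cylw_spell.
  by move=> y h; apply/hG/hk.
move=> [n _]; rewrite /B; case: (choice.unpickle n) => // w; case: (pselect _) => // h /= hw.
by apply: h; rewrite cylw_sample hw.
Qed.

Definition riesz_rv : {mfun measurableTypeR R >-> borel_config} := mfun_Sub (mem_set measurable_sample).

Definition riesz_measure : probability borel_config R := distribution unit_leb riesz_rv.

(** The sample lands in the cylinder of [w] exactly when [u] lies in the interval of [w], whose
    length is [weight w]. *)
Lemma riesz_cyl w : riesz_measure [set x | cylw w x] = (weight w)%:E.
Proof.
rewrite /riesz_measure /= /distribution /pushforward /unit_leb /mrestr.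
rewrite (_ : _ `&` _ = `[left_end w, left_end w + weight w[%classic).
  rewrite lebesgue_measure_itv /=; case: ifPn => h.
    by rewrite -EFinB addrAC subrr add0r.
  have := weight_ge0 w; rewrite le_eqVlt => /orP[/eqP <- //|h'].
  by move: h; rewrite lte_fin ltrDl h'.
have l0 : 0 <= left_end w /\ left_end w + weight w <= 1.
  elim: (w) => [|b w' [l r]] /=; first by rewrite weight0; lra.
  have := weight_ge0 (true :: w'); have := weight_ge0 (false :: w'); have := weight_split w'.
  by case: b; lra.
apply/seteqP; split => u /=; rewrite !in_itv /=.
  move=> [+ u01]; rewrite cylw_sample => /eqP <-.
  exact: word_in.
move=> h; split; last by move: h l0; lra.
by rewrite cylw_sample word_eq.
Qed.

Fixpoint words k : seq (seq bool) :=
  if k is k'.+1 then [seq true :: w | w <- words k'] ++ [seq false :: w | w <- words k'] else [:: [::]].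

Lemma size_words k w : w \in words k -> size w = k.
Proof.
elim: k w => [|k IH] w /=; first by rewrite inE => /eqP ->.
by rewrite mem_cat => /orP[] /mapP[w' /IH <- ->].
Qed.

Lemma sum_words (g : seq bool -> R) k x :
  \sum_(w <- words k) g w * (cylw w x)%:R = g (spell x k).
Proof.
elim: k g => [|k IH] g /=; first by rewrite big_seq1 mulr1.
rewrite big_cat !big_map /= -(IH (fun w => g (x (site k) :: w))) -big_split /=.
apply: eq_big_seq => w /size_words ->.
by case: (x (site k)); rewrite /= ?mulr0 ?addr0 ?add0r.
Qed.

Lemma ell_sum (s : seq (seq bool)) (F : seq bool -> (int -> bool) -> R) :
  (forall w, bnd (F w)) -> ell (fun x => \sum_(w <- s) F w x) = \sum_(w <- s) ell (F w).
Proof.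
move=> bF; elim: s => [|w s IH].
  rewrite big_nil -[RHS](mul0r (ell (fun=> 1))) -ellZ; last exact: bnd_cst.
  by congr ell; apply/funext => x; rewrite big_nil mul0r.
rewrite big_cons -IH -ellD //; last exact: bnd_sum.
by congr ell; apply/funext => x; rewrite big_cons.
Qed.

Lemma ell_le f g : bnd f -> bnd g -> (forall x, f x <= g x) -> ell f <= ell g.
Proof.
move=> bf bg fg; have bN : bnd (fun x => -1 * f x) by apply: bndM => //; apply: bnd_cst.
rewrite -subr_ge0 -mulN1r -ellZ // -ellD //; apply: ell_ge0 => [|x]; first exact: bndD.
by rewrite mulN1r subr_ge0.
Qed.

Fixpoint realize w : int -> bool :=
  if w is b :: w' then upd (realize w') (site (size w')) b else fun=> false.

Lemma cylw_realize w : cylw w (realize w).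
Proof.
suff h v y : (forall j, (j < size v)%N -> y (site j) = realize v (site j)) -> cylw v y.
  exact: h.
elim: v y => //= b v IH y h; rewrite h // updE eqxx /=; apply: IH => j jv.
rewrite h ?(ltn_trans jv) // upd_neq //; apply/eqP => /(can_inj siteK) e.
by move: jv; rewrite e ltnn.
Qed.

Lemma measurable_cylw w : measurable ([set x | cylw w x] : set borel_config).
Proof.
elim: w => [|b w IH] /=.
  by rewrite (_ : [set x | _] = setT) //; apply/seteqP; split.
rewrite (_ : [set x | _] = [set x | x (site (size w)) = b] `&` [set x | cylw w x]).
  apply: measurableI => //; apply: sub_sigma_algebra; rewrite openE => x /= xb.
  apply: filterS (nbhs_agree [:: site (size w)] x) => y h /=.
  by rewrite h ?mem_head.
by apply/seteqP; split => x /= => [/andP[/eqP]|[-> ->]]; rewrite ?eqxx.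
Qed.

Lemma quasilocal_approx f eps : quasilocal f -> 0 < eps ->
  exists k, forall x, `|f x - f (realize (spell x k))| <= eps.
Proof.
move=> qf e0; have [G hG] := qf eps e0; have [k hk] := spell_agree G.
by exists k => x; apply/hG/hk/cylw_realize.
Qed.

Lemma mem_words x k : spell x k \in words k.
Proof.
elim: k => //= k IH; rewrite mem_cat; case: (x _); rewrite ?map_f ?orbT //.
Qed.

Lemma quasilocal_bounded f : quasilocal f -> exists M, forall x, `|f x| <= M.
Proof.
move=> qf; have [k hk] := quasilocal_approx qf ltr01.
exists (1 + \sum_(w <- words k) `|f (realize w)|) => x.
have -> : f x = (f x - f (realize (spell x k))) + f (realize (spell x k)) by ring.
apply: le_trans (ler_normD _ _) _; apply: lerD => //.
by rewrite (big_rem (spell x k)) ?mem_words //= lerDl sumr_ge0.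
Qed.

Lemma quasilocal_integrable (mu : probability borel_config R) f : quasilocal f ->
  mu.-integrable setT (EFin \o f).
Proof.
move=> qf; apply: measurable_bounded_integrable => //.
- by apply: le_lt_trans (probability_le1 _ _) _ => //; rewrite ltry.
- exact: continuous_borel (quasilocal_continuous qf).
have [M hM] := quasilocal_bounded qf.
by exists M; split; [exact: num_real|move=> r Mr x _; apply: le_trans (hM x) (ltW Mr)].
Qed.

Lemma quasilocal_truncate f k : quasilocal (fun x => f (realize (spell x k))).
Proof.
move=> eps e0; exists (map site (iota 0 k)) => x y xy.
suff -> : spell y k = spell x k by rewrite subrr normr0 ltW.
elim: k xy => [//|k IH] xy; rewrite /=; congr cons.
  by apply: xy; apply: map_f; rewrite mem_iota leq0n add0n /=.
apply: IH => i /mapP[j jk ->]; apply: xy; apply: map_f.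
by move: jk; rewrite !mem_iota /= !add0n => /ltnW.
Qed.

(** Integral and functional agree on cylinder functions, by [riesz_cyl]. Both are positive and
    normalized, so a uniform approximation of [f] within eps/2 moves each of them by at most
    eps/2. *)
Theorem riesz f : quasilocal f ->
  (\int[riesz_measure]_x (f x)%:E = (ell f)%:E)%E.
Proof.
move=> qf.
pose fk k x := \sum_(w <- words k) f (realize w) * (cylw w x)%:R.
have fkE k x : fk k x = f (realize (spell x k)) by rewrite /fk sum_words.
have cyl_int w : riesz_measure.-integrable setT (fun x => (cylw w x)%:R%:E).
  rewrite (_ : (fun x => _) = EFin \o \1_[set x | cylw w x]).
    by apply: integrable_indic => //; apply: measurable_cylw.
  apply/funext => x; rewrite /= indicE; congr (_%:R%:E).
  by case: (boolP (cylw w x)) => h; [rewrite mem_set|rewrite memNset //; exact/negP].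
have ifk k : (\int[riesz_measure]_x (fk k x)%:E = (ell (fk k))%:E)%E.
  have bcyl w : bnd (fun x => f (realize w) * (cylw w x)%:R).
    by apply: bndM; [exact: bnd_cst|exact: bnd_bool].
  rewrite /fk ell_sum //; under eq_integral do rewrite -sumEFin.
  rewrite integral_sum //; last first.
    move=> w; rewrite (_ : (fun x => _) = (fun x => (f (realize w))%:E * (cylw w x)%:R%:E)%E).
    exact: integrableZl.
  by apply/funext => x; rewrite EFinM.
  rewrite -sumEFin; apply: eq_bigr => w _.
  under eq_integral do rewrite EFinM.
  rewrite integralZl //.
  rewrite ellZ; last exact: bnd_bool.
  rewrite EFinM; congr (_ * _)%E; rewrite -/(weight w) -riesz_cyl -[X in riesz_measure X]setIT -integral_indic //; last first.
    exact: measurable_cylw.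
  apply: eq_integral => x _; rewrite indicE; congr (_%:R%:E).
  by case: (boolP (cylw w x)) => h; [rewrite mem_set|rewrite memNset //; exact/negP].
have intf := quasilocal_integrable riesz_measure qf.
have fin1 := integrable_fin_num measurableT intf.
rewrite -(fineK fin1); congr (_%:E); apply/eqP; rewrite -subr_eq0 -normr_le0.
apply/ler_addgt0Pl => eps e0; rewrite addr0.
have e2 : 0 < eps / 2 by rewrite divr_gt0.
have [k hk] := quasilocal_approx qf e2.
have fkT : fk k = fun x => f (realize (spell x k)) by apply/funext => x; rewrite fkE.
have intk : riesz_measure.-integrable setT (EFin \o fk k).
  by rewrite fkT; apply/quasilocal_integrable/quasilocal_truncate.
have h1 : `|fine (\int[riesz_measure]_x (EFin \o f) x) - ell (fk k)| <= eps / 2.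
  rewrite -lee_fin -abse_EFin EFinB fineK // -ifk -integralB //.
  apply: le_trans (le_abse_integral _ _ _) _ => //.
    by apply: measurable_int (integrableB _ intf intk).
  apply: (@le_trans _ _ (\int[riesz_measure]_x (eps / 2)%:E)%E).
    apply: ge0_le_integral => //.
    - exact: measurable_int (integrable_abse (integrableB measurableT intf intk)).
    by move=> x _; rewrite /= lee_fin fkE; exact: hk.
  by rewrite integral_cst // [X in (_ * X)%E](_ : _ = 1%E) ?mule1 //; exact: probability_setT.
have h2 : `|ell f - ell (fk k)| <= eps / 2.
  have cst c : ell (fun=> c) = c.
    rewrite -[RHS]mulr1 -ell1 -ellZ; last exact: bnd_cst.
    by congr ell; apply/funext => x; rewrite mulr1.
  have bf : bnd f by have [M hM] := quasilocal_bounded qf; exists M.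
  have bk : bnd (fk k).
    by apply: bnd_sum => w; apply: bndM; [exact: bnd_cst|exact: bnd_bool].
  rewrite ler_norml -lerBlDr -lerBrDr.
  have D c : ell (fk k) + c = ell (fun x => fk k x + c).
    by rewrite ellD ?cst //; exact: bnd_cst.
  rewrite [X in X && _](_ : _ = (ell (fk k) - eps / 2 <= ell f)); last first.
    by rewrite lerBlDr [in RHS]addrC -lerBlDr; lra.
  rewrite [X in _ && X](_ : _ = (ell f <= ell (fk k) + eps / 2)); last by lra.
  rewrite !D; apply/andP; split; apply: ell_le => //;
    try (by apply: bndD => //; apply: bnd_cst); move=> x; rewrite fkE; have := hk x;
    rewrite ler_norml; lra.
rewrite (_ : _ - _ = (fine (\int[riesz_measure]_x (EFin \o f) x) - ell (fk k)) -
   (ell f - ell (fk k))); last by ring.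
by apply: le_trans (ler_normB _ _) _; lra.
Qed.

End Riesz.

(** * Infinite-volume Gibbs measures *)

(** A bounded sequence has a cluster point along the filter by compactness, and an ultrafilter
    converges to its cluster points. *)
Lemma ultra_cvg {R : realType} (U : set_system nat) (a : nat -> R) :
  UltraFilter U -> bnd a -> cvg (a @ U).
Proof.
move=> UU [M hM]; have FU : ProperFilter (a @ U) by apply: fmap_proper_filter.
have [|p [_ clp]] := @segment_compact R (- M) M (a @ U) FU.
  by apply: (@filterS _ U _ setT) => [n _ /=|]; [rewrite in_itv /= -ler_norml|exact: filterT].
apply/cvg_ex; exists p => V pV.
have [//|nV] := in_ultra_setVsetC (a @^-1` V) UU.
by have [y [] ] := clp _ _ (nV : (a @ U) (~` V)) pV.
Qed.

Section UltraLimit.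
Context {R : realType} (U : set_system nat) (UU : UltraFilter U).
Implicit Types a b : nat -> R.

Definition ulim a : R := lim (a @ U).

Lemma ulimD a b : bnd a -> bnd b -> ulim (fun n => a n + b n) = ulim a + ulim b.
Proof. by move=> ba bb; apply: limD; apply: ultra_cvg. Qed.

Lemma ulimZ c a : bnd a -> ulim (fun n => c * a n) = c * ulim a.
Proof.
move=> ba; apply: cvg_lim => //; apply: cvgM; first exact: cvg_cst.
exact: ultra_cvg.
Qed.

Lemma ulim_le a b : bnd a -> bnd b -> (\near U, a U <= b U) -> ulim a <= ulim b.
Proof.
move=> ba bb h; rewrite -subr_ge0.
have -> : ulim b - ulim a = ulim (fun n => b n + - 1 * a n).
  rewrite ulimD ?ulimZ ?mulN1r //; by apply: bndM => //; apply: bnd_cst.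
apply: limr_ge.
  apply: ultra_cvg; apply: bndD => //; by apply: bndM => //; apply: bnd_cst.
by apply: filterS h => n h; rewrite mulN1r subr_ge0.
Qed.

Lemma ulim_cst c : ulim (fun=> c) = c.
Proof. by apply: cvg_lim => //; apply: cvg_cst. Qed.

Lemma eq_ulim a b : (\near U, a U = b U) -> ulim a = ulim b.
Proof.
move=> h; rewrite /ulim; congr (lim _); apply/seteqP; split => V hV.
  by apply: filterS (filterI h hV) => n [/= <-].
by apply: filterS (filterI h hV) => n [/= ->].
Qed.

End UltraLimit.

Section QuasilocalOps.
Context {R : realType}.
Implicit Types (f g : config int -> R).

Lemma quasilocalM f g : quasilocal f -> quasilocal g -> quasilocal (fun x => f x * g x).
Proof.
move=> qf qg eps e0.
have [M hM] := quasilocal_bounded qf; have [N hN] := quasilocal_bounded qg.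
have M0 : 0 <= M by apply: le_trans (hM (fun=> true)).
have N0 : 0 <= N by apply: le_trans (hN (fun=> true)).
have [d d0 hd] : exists2 d, 0 < d & d * N + M * d <= eps.
  have s0 : 0 < N + M + 1 by rewrite ltr_wpDl // addr_ge0.
  exists (eps / (N + M + 1)); first by rewrite divr_gt0.
  rewrite [M * _]mulrC -mulrDr mulrAC ler_pdivrMr // ler_pM2l //; lra.
have [G hG] := qf d d0; have [G' hG'] := qg d d0.
exists (G ++ G') => x y xy.
rewrite (_ : f x * g x - f y * g y = (f x - f y) * g x + f y * (g x - g y)); last by ring.
apply: le_trans (ler_normD _ _) _; rewrite !normrM; apply: le_trans hd.
apply: lerD; apply: ler_pM => //.
  by apply: hG => i iG; apply: xy; rewrite mem_cat iG.
by apply: hG' => i iG; apply: xy; rewrite mem_cat iG orbT.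
Qed.

Lemma quasilocalB f g : quasilocal f -> quasilocal g -> quasilocal (fun x => f x - g x).
Proof.
move=> qf qg eps e0; have e2 : 0 < eps / 2 by rewrite divr_gt0.
have [G hG] := qf _ e2; have [G' hG'] := qg _ e2.
exists (G ++ G') => x y xy.
rewrite (_ : _ - _ = (f x - f y) - (g x - g y)); last by ring.
apply: le_trans (ler_normB _ _) _; rewrite [leRHS]splitr; apply: lerD.
  by apply: hG => i iG; apply: xy; rewrite mem_cat iG.
by apply: hG' => i iG; apply: xy; rewrite mem_cat iG orbT.
Qed.

Definition local_set (A : set (config int)) (G : seq int) :=
  forall x y, agree_on G x y -> A x -> A y.

Lemma agree_onC G (x y : config int) : agree_on G x y -> agree_on G y x.
Proof. by move=> h i /h ->. Qed.

Lemma quasilocal_indic A G : local_set A G -> quasilocal (\1_A : config int -> R).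
Proof.
move=> lA eps e0; exists G => x y xy; rewrite !indicE.
have -> : (x \in A) = (y \in A).
  by apply/idP/idP => /set_mem h; apply/mem_set; [exact: lA xy h|exact: lA (agree_onC xy) h].
by rewrite subrr normr0 ltW.
Qed.

Lemma local_measurable A G : local_set A G -> measurable (A : set borel_config).
Proof.
move=> lA; apply: sub_sigma_algebra; change (@open (config int) A); rewrite openE => x Ax.
by apply: filterS (nbhs_agree G x) => y /lA; apply.
Qed.

End QuasilocalOps.

(** * From an invariant positive functional to a Gibbs measure *)

Section DLR.
Context {R : realType} (J : nat -> R) (beta : R).
Context (J_ge0 : forall k, 0 <= J k) (J0 : J 0%N = 0) (beta_ge0 : 0 <= beta).
Context (J_summable : (\sum_(0 <= k <oo) (J k)%:E < +oo)%E).
Context (ell : ((int -> bool) -> R) -> R).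
Context (ellD : forall f g, bnd f -> bnd g -> ell (fun x => f x + g x) = ell f + ell g).
Context (ellZ : forall c f, bnd f -> ell (fun x => c * f x) = c * ell f).
Context (ell_ge0 : forall f, bnd f -> (forall x, 0 <= f x) -> 0 <= ell f).
Context (ell1 : ell (fun=> 1) = 1).
Context (ell_dlr : forall (L : {fset int}) f, ell (gibbs_avg J beta L f) = ell f).

Let mu : probability borel_config R := riesz_measure ell.

Definition local_off (L : {fset int}) : set (set borel_config) :=
  [set A | exists2 G, (forall i : int, i \in G -> i \notin L) & local_set A G].

Lemma local_off_setI L : setI_closed (local_off L).
Proof.
move=> A B [G GL lA] [G' GL' lB]; exists (G ++ G').
  by move=> i; rewrite mem_cat => /orP[/GL|/GL'].
move=> x y xy [Ax Bx]; split.
  by apply: lA Ax => i iG; apply: xy; rewrite mem_cat iG.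
by apply: lB Bx => i iG; apply: xy; rewrite mem_cat iG orbT.
Qed.

Lemma outside_sub L : outside L `<=` <<s local_off L >>.
Proof.
apply: sub_sigma_algebra2 => _ [i [b [iL ->]]].
exists [:: i]; first by move=> j; rewrite inE => /eqP ->.
by move=> x y h /= <-; apply: h; rewrite mem_head.
Qed.

Lemma local_cylinder (L : {fset int}) (s : {ffun L -> bool}) : local_set (cylinder s) (finmap.enum_fset L).
Proof. by move=> x y h sx k; rewrite -sx; apply: h; exact: valP. Qed.

Lemma indep_gibbs_avg L f : indep (finmap.enum_fset L) (gibbs_avg J beta L f).
Proof. by move=> x i b iL; rewrite /gibbs_avg !(@indep_avg _ _ (finmap.enum_fset L) _ x i b iL). Qed.

Section Kernel.
Context (L : {fset int}) (s : {ffun L -> bool}).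

Let k : config int -> R := gibbs_kernel J beta s.
Let g : config int -> R := fun x => \1_(cylinder s : set (config int)) x - k x.

Let quasilocal_k : quasilocal k.
Proof. exact: gibbs_kernel_quasilocal. Qed.

Let quasilocal_g : quasilocal g.
Proof. by apply: quasilocalB => //; apply/quasilocal_indic/local_cylinder. Qed.

Let integrable_g : mu.-integrable setT (EFin \o g).
Proof. exact: quasilocal_integrable. Qed.

(** [gibbs_avg] for the volume [L] leaves the functional unchanged. Neither the indicator of [A] nor
    [k] depends on the spins in [L], and the indicator of the cylinder has average [k]; so the
    averaged integrand is 0. *)
Lemma local_off_integral A : local_off L A -> (\int[mu]_(x in A) (g x)%:E = 0)%E.
Proof.
move=> [G GL lA]; rewrite integral_mkcond.
transitivity (\int[mu]_x (\1_A x * g x)%:E)%E.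
  apply: eq_integral => x _; rewrite patchE indicE; case: (x \in A); by rewrite ?mul1r ?mul0r.
rewrite riesz //; last by apply: quasilocalM => //; exact: quasilocal_indic lA.
rewrite -(ell_dlr L) (_ : gibbs_avg J beta L _ = fun x => 0 * 1).
  by rewrite ellZ ?mul0r //; exact: bnd_cst.
apply/funext => x; rewrite gibbs_avgM; last first.
  move=> y i b iL; rewrite !indicE; congr (_%:R); congr nat_of_bool.
  have h : agree_on G (upd y i b) y.
    move=> j jG; rewrite upd_neq //; apply: contraTneq iL => <-; exact: GL.
  by apply/idP/idP => /set_mem hh; apply/mem_set; [exact: lA h hh|exact: lA (agree_onC h) hh].
rewrite /g (_ : (fun y => _ - k y) = (fun y => \1_(cylinder s : set (int -> bool)) y + -1 * (k y * 1))); last first.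
  by apply/funext => y; rewrite mulr1 mulN1r.
rewrite gibbs_avgD gibbs_avgZ gibbs_avgM; last first.
  by move=> y i b iL; rewrite /k !gibbs_kernelE; exact: indep_gibbs_avg.
by rewrite gibbs_avg1 mulr1 mulN1r /k gibbs_kernelE subrr mulr0 mul0r.
Qed.

(** Dynkin's pi-lambda theorem. Measurability is carried along because complements and countable
    unions need it for the additivity of the integral. *)
Lemma outside_integral A : outside L A -> measurable A /\ (\int[mu]_(x in A) (g x)%:E = 0)%E.
Proof.
move=> /outside_sub; rewrite -setI_closed_g_dynkin_g_sigma_algebra; last exact: local_off_setI.
pose P : set (set borel_config) := fun A => measurable A /\ (\int[mu]_(x in A) (g x)%:E = 0)%E.
move=> dA; suff [dP GP] : dynkin P /\ local_off L `<=` P by exact: (smallest_sub dP GP dA).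
split.
  have gT : (\int[mu]_x (g x)%:E = 0)%E by apply: local_off_integral; exists [::].
  split; first by split.
  - move=> B [mB B0]; split; first exact: measurableC.
    have := gT; rewrite -(setUv B) integral_setU //; last 2 first.
    + by rewrite setUv; exact: (measurable_int mu integrable_g).
    + by apply/disj_setPCl.
    + by rewrite B0 add0e.
    + exact: measurableC.
  move=> F tF PF; split; first by apply: bigcup_measurable => n _; exact: (PF n).1.
  rewrite integral_bigcup //.
  - by rewrite eseries0 // => n _ _; exact: (PF n).2.
  - by move=> n; exact: (PF n).1.
  apply: integrableS integrable_g => //.
  by apply: bigcup_measurable => n _; exact: (PF n).1.
move=> B lB; split; last exact: local_off_integral.
by case: lB => G _ /local_measurable.
Qed.

Lemma outside_kernel A : outside L A ->
  mu (A `&` cylinder s) = (\int[mu]_(x in A) (k x)%:E)%E.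
Proof.
move=> /outside_integral [mA].
have mc : measurable (cylinder s) := local_measurable (@local_cylinder L s).
have i1 : mu.-integrable A (EFin \o (\1_(cylinder s : set borel_config) : borel_config -> R)).
  apply: (integrableS measurableT) => //; apply: integrable_indic => //.
have i2 : mu.-integrable A (EFin \o k).
  by apply: (integrableS measurableT) => //; apply: quasilocal_integrable.
rewrite (_ : (fun x => _) = (fun x => (EFin \o (\1_(cylinder s : set borel_config) : borel_config -> R)) x - (EFin \o k) x)%E) //.
rewrite integralB // integral_indic // setIC.
have f2 := integrable_fin_num mA i2.
have f1 : mu (A `&` cylinder s) \is a fin_num.
  exact: fin_num_measure (measurableI _ _ mA mc).
move=> h; rewrite -[LHS](subeK _ f2) h add0e //.
Qed.

End Kernel.

Lemma riesz_gibbs : gibbs J beta mu.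
Proof. by move=> L s A oA; exact: outside_kernel. Qed.

End DLR.

(** * The plus and the minus state *)

Section InfiniteVolume.
Context {R : realType} (J : nat -> R) (beta : R).
Context (J_ge0 : forall k, 0 <= J k) (J0 : J 0%N = 0) (beta_ge0 : 0 <= beta).
Context (J_summable : (\sum_(0 <= k <oo) (J k)%:E < +oo)%E).
Context (U : set_system nat) (UU : UltraFilter U) (oU : \oo `<=` U).
Implicit Types (f g : (int -> bool) -> R) (s : bool).

Definition volume n : {fset int} := seq_fset tt (map site (iota 0 n)).

Lemma mem_volume n i : (i \in volume n) = (rank_site i < n)%N.
Proof.
rewrite seq_fsetE; apply/mapP/idP => [[k]|h].
  by rewrite mem_iota => /andP[_ kn] ->; rewrite siteK.
by exists (rank_site i); rewrite ?mem_iota ?rank_siteK.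
Qed.

Definition state s f : R := ulim U (fun n => gibbs_avg J beta (volume n) f (fun=> s)).

Lemma bnd_gibbs_avg s f : bnd f -> bnd (fun n => gibbs_avg J beta (volume n) f (fun=> s)).
Proof.
move=> [M hM]; exists M => n; rewrite ler_norml; apply/andP; split.
  rewrite -subr_ge0 opprK -[X in _ + X]mulr1 -(gibbs_avg1 J beta (volume n) (fun=> s)) -gibbs_avgZ -gibbs_avgD.
  by apply: gibbs_avg_ge0 => y; have := hM y; rewrite ler_norml mulr1; lra.
rewrite -subr_ge0 -[X in X - _]mulr1 -(gibbs_avg1 J beta (volume n) (fun=> s)) -gibbs_avgZ -mulN1r -gibbs_avgZ -gibbs_avgD.
by apply: gibbs_avg_ge0 => y; have := hM y; rewrite ler_norml mulr1; lra.
Qed.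

Lemma stateD s f g : bnd f -> bnd g -> state s (fun x => f x + g x) = state s f + state s g.
Proof.
move=> bf bg; rewrite /state -ulimD; try exact: bnd_gibbs_avg.
by congr ulim; apply/funext => n; rewrite gibbs_avgD.
Qed.

Lemma stateZ s c f : bnd f -> state s (fun x => c * f x) = c * state s f.
Proof.
move=> bf; rewrite /state -ulimZ; last exact: bnd_gibbs_avg.
by congr ulim; apply/funext => n; rewrite gibbs_avgZ.
Qed.

Lemma state_ge0 s f : bnd f -> (forall x, 0 <= f x) -> 0 <= state s f.
Proof.
move=> bf f0; rewrite -(ulim_cst UU 0); apply: ulim_le.
- exact: bnd_cst.
- exact: bnd_gibbs_avg.
by apply: (@filterS _ U _ setT) => [n _|]; [exact: gibbs_avg_ge0|exact: filterT].
Qed.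

Lemma state1 s : state s (fun=> 1) = 1.
Proof.
by rewrite -[RHS](ulim_cst UU); congr ulim; apply/funext => n; rewrite gibbs_avg1.
Qed.

Lemma state_dlr s (L : {fset int}) f : state s (gibbs_avg J beta L f) = state s f.
Proof.
apply: eq_ulim; apply: oU; have [k hk] := sites_bound (finmap.enum_fset L).
exists k => // n /= kn; apply: gibbs_avg_consistent => // i iL.
by rewrite mem_volume; apply: leq_trans kn; apply: hk.
Qed.

Definition gibbs_state s : probability borel_config R := riesz_measure (state s).

Lemma gibbs_state_gibbs s : gibbs J beta (gibbs_state s).
Proof.
apply: riesz_gibbs => //.
- exact: stateD.
- exact: stateZ.
- exact: state_ge0.
- exact: state1.
- exact: state_dlr.
Qed.

Lemma gibbs_avg_plus L : gibbs_avg J beta L (fun x => spin (x 0)) (fun=> true) =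
  plus_mag J (Jtot J) beta (finmap.enum_fset L).
Proof.
rewrite /gibbs_avg /plus_mag /gibbs_mean /mean.
have E y : (forall i, i \notin finmap.enum_fset L -> y i = true) ->
    boltz J beta L y = expR (beta * plus_energy J (Jtot J) (finmap.enum_fset L) y).
  by move=> h; rewrite /boltz (energy_boundary J_ge0 J0 J_summable h) mul1r.
by congr (_ / _); apply: avg_eqx => y hy; rewrite E.
Qed.

(** Global spin flip exchanges the two boundary conditions and changes the sign of the
    observable. *)
Lemma gibbs_avg_minus L : gibbs_avg J beta L (fun x => spin (x 0)) (fun=> false) =
  - plus_mag J (Jtot J) beta (finmap.enum_fset L).
Proof.
set l := finmap.enum_fset L.
rewrite /gibbs_avg /plus_mag /gibbs_mean /mean.
have ff : (fun=> false) = flip (fun=> false) (fun=> true) :> (int -> bool).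
  by apply/funext.
have sN b : spin (false == b) = - spin b :> R by case: b; rewrite /spin /= ?opprK.
have E y : (forall i, i \notin l -> y i = true) ->
    boltz J beta L (flip (fun=> false) y) = expR (beta * plus_energy J (Jtot J) l y).
  move=> h; rewrite /boltz (@energy_boundary _ _ J_ge0 J0 J_summable _ _ false); last first.
    by move=> i /h; rewrite /flip => ->.
  have -> : hamK (coupling J 1) l (flip (fun=> false) y) = hamK (coupling J 1) l y.
    rewrite !hamKE; congr (_ * _); apply: eq_bigr => i _; apply: eq_bigr => j _.
    by rewrite /flip !sN mulrNN.
  rewrite -/l /plus_energy mulN1r -sumrN; congr (expR (_ * (_ + _))).
  by apply: eq_bigr => i _; rewrite /flip sN mulrN opprK.
rewrite ff -!avg_flip -mulNr -avgN; congr (_ / _); apply: avg_eqx => y hy.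
  by rewrite E // /flip sN mulNr.
by rewrite E.
Qed.

Lemma bnd_spin0 : bnd (fun x : int -> bool => spin (x 0) : R).
Proof. by exists 1 => x; case: (@spin_pm R (x 0)) => ->; rewrite ?normrN normr1. Qed.

Lemma quasilocal_spin0 : quasilocal (fun x : config int => spin (x 0) : R).
Proof.
by move=> e e0; exists [:: 0] => x y h; rewrite h ?mem_head // subrr normr0 ltW.
Qed.

(** The spin at 0 would have mean at least c in the plus state and at most -c in the minus state,
    although uniqueness makes the two measures equal. *)
Lemma unique_plus_mag c : unique_gibbs J beta -> 0 < c ->
  (forall V, uniq V -> 0 \in V -> c <= plus_mag J (Jtot J) beta V) -> False.
Proof.
move=> [mu [_ uni]] c0 hc.
have nearV : \near U, (0 \in volume U).
  by apply: oU; exists 1%N => // n /= n1; rewrite mem_volume.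
have hp : c <= state true (fun x => spin (x 0)).
  rewrite -(ulim_cst UU c); apply: ulim_le; [exact: bnd_cst|exact/bnd_gibbs_avg/bnd_spin0|].
  apply: filterS nearV => n h; rewrite gibbs_avg_plus; apply: hc => //.
  exact: finmap.fset_uniq.
have hm : state false (fun x => spin (x 0)) <= - c.
  rewrite -(ulim_cst UU (- c)); apply: ulim_le; [exact/bnd_gibbs_avg/bnd_spin0|exact: bnd_cst|].
  apply: filterS nearV => n h; rewrite gibbs_avg_minus lerN2; apply: hc => //.
  exact: finmap.fset_uniq.
have E s : (\int[gibbs_state s]_x (spin (x 0) : R)%:E = (state s (fun x => spin (x 0)))%:E)%E.
  apply: riesz; [exact: stateD|exact: stateZ|exact: state_ge0|exact: state1|exact: quasilocal_spin0].
have := E true; have := E false.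
rewrite (eq_measure_integral (gibbs_state true)) => [->|A mA _]; last first.
  by apply: etrans (uni _ (gibbs_state_gibbs false) A mA) _; exact/esym/(uni _ (gibbs_state_gibbs true)).
move=> [] h; move: hp hm; rewrite h; lra.
Qed.

End InfiniteVolume.

Section Subcritical.
Context {R : realType} (J : nat -> R).
Context (J_ge0 : forall k, 0 <= J k) (J0 : J 0%N = 0).
Context (J_summable : (\sum_(0 <= k <oo) (J k)%:E < +oo)%E).

(** If every [S] had [phiS] at least 1 at [beta], the plus magnetization would be bounded away from
    0 at a larger [b'], contrary to uniqueness there. *)
Lemma subcritical_phiS (beta : R) : 0 <= beta -> (beta%:E < critical_value J)%E ->
  exists S : seq int, [/\ uniq S, 0 \in S & phiS J (Jtot J) beta S < 1].
Proof.
(* The differential inequality divides by the inverse temperature; at [beta] = 0 the functional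
   itself is 0. *)
rewrite le_eqVlt => /orP[/eqP <- _|b0].
  exists [:: 0]; split => //; rewrite /phiS big1 ?ltr01 // => i _; by rewrite mul0r mulr0.
move=> /ereal_sup_gt[bc [bc0 uni] bbc].
(* Room above [beta] is essential: the magnetization gains its lower bound between [beta] and [b'],
   and uniqueness must still hold at [b']. *)
have [b' bb' b'c] : exists2 b', beta < b' & (b'%:E < bc)%E.
  case: bc {bc0 uni} bbc => [r| |] //=; last by move=> _; exists (beta + 1); rewrite ?ltrDl ?ltry.
  by rewrite lte_fin => br; exists ((beta + r) / 2); rewrite ?lte_fin midf_lt.
have ug := uni b' (ltW (lt_trans b0 bb')) b'c.
apply: contrapT => nS.
have [U [UU oU]] := @ultraFilterLemma nat \oo _.
apply: (@unique_plus_mag R J b' J_ge0 J0 (ltW (lt_trans b0 bb')) J_summable U UU oU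
  (Num.min 2^-1 ((b' - beta) / (4 * b'))) ug).
  by rewrite lt_min invr_gt0 ltr0n divr_gt0 // ?subr_gt0 // mulr_gt0 // (lt_trans b0).
move=> V uV V0; apply: plus_mag_lower => //.
  exact: Jtot_ge.
move=> S uS S0; rewrite leNgt; apply/negP => h; apply: nS; by exists S.
Qed.

Lemma subcritical_susceptibility (beta : R) : 0 <= beta -> (beta%:E < critical_value J)%E ->
  exists2 chi, 0 <= chi & forall (V : seq int) w, uniq V -> w \in V ->
    \sum_(z <- V) corr (coupling J beta) V w z <= chi.
Proof.
move=> b0 /(subcritical_phiS b0)[S [uS S0 h]].
apply: (@finite_susceptibility R J (Jtot J)) h => //; exact: Jtot_ge.
Qed.

End Subcritical.

(** * Iterates of the transfer operator *)

Definition cons_conf (b : bool) (x : config nat) : config nat :=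
  fun i => if i is j.+1 then x j else b.

Lemma preimage_left_shift x :
  left_shift @^-1` [set x] = [set` [:: cons_conf true x; cons_conf false x]].
Proof.
apply/seteqP; split => y /=; last by rewrite !inE => /orP[] /eqP ->.
move=> <-; rewrite !inE; case E : (y 0%N); apply/orP; [left|right]; apply/eqP/funext => -[|i] //.
Qed.

Lemma sum_preimage {V : nmodType} (F : config nat -> V) x :
  \sum_(y \in left_shift @^-1` [set x]) F y = F (cons_conf true x) + F (cons_conf false x).
Proof.
rewrite preimage_left_shift -fsbig_seq /=; first by rewrite !big_cons big_nil addr0.
by rewrite andbT inE; apply/eqP => /(congr1 (fun y => y 0%N)).
Qed.

Lemma transferE {R : realType} (psi f : config nat -> R) x :
  transfer psi f x = expR (psi (cons_conf true x)) * f (cons_conf true x) +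
                     expR (psi (cons_conf false x)) * f (cons_conf false x).
Proof. by rewrite /transfer sum_preimage. Qed.

Section Iterates.
Context {R : realType} (psi : config nat -> R).
Implicit Types (f : config nat -> R) (x y : config nat).

Definition shift_by k x : config nat := fun i => x (k + i)%N.

Definition prefixed n x : config nat := fun i => if (i < n)%N then true else x (i - n)%N.

(** The outermost application sums over the spin put in front of [x], which sits at site [n]; the
    [n] inner ones see the enlarged configuration as their boundary. The average turns the sum over
    words into the factor 2^n. *)
Lemma iter_transferE n f x : iter n (transfer psi) f x =
  2 ^+ n * avg (iota 0 n) (fun y => expR (\sum_(0 <= k < n) psi (shift_by k y)) * f y)
    (prefixed n x).
Proof.
elim: n x => [|n IH] x.
  rewrite /= mul1r big_geq // expR0 mul1r; congr f; apply/funext => i.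
  by rewrite /prefixed subn0.
rewrite iterS transferE !IH.
have pE b : prefixed n (cons_conf b x) = upd (prefixed n.+1 x) n b.
  apply/funext => i; rewrite /prefixed /upd ltnS.
  case: (ltngtP i n) => // [ni|->]; last by rewrite subnn.
  by rewrite -(subnSK ni).
rewrite (@avg_perm _ _ (iota 0 n.+1) (n :: iota 0 n)); last 2 first.
- by move=> i; rewrite mem_iota add0n ltnS => h; rewrite in_cons mem_iota add0n -leq_eqVlt.
- by move=> i; rewrite mem_iota in_cons mem_iota !add0n ltnS [(i <= n)%N]leq_eqVlt.
rewrite -[avg (n :: _) _ _]/(avg1 n (avg (iota 0 n) _) _) /avg1 exprS -!pE.
have step b : avg (iota 0 n) (fun y => expR (\sum_(0 <= k < n.+1) psi (shift_by k y)) * f y)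
    (prefixed n (cons_conf b x)) = expR (psi (cons_conf b x)) *
    avg (iota 0 n) (fun y => expR (\sum_(0 <= k < n) psi (shift_by k y)) * f y) (prefixed n (cons_conf b x)).
  rewrite -avgZ; apply: avg_eqx => y hy.
  have hs : shift_by n y = cons_conf b x.
    apply/funext => i; rewrite /shift_by hy ?mem_iota ?add0n -?leqNgt ?leq_addr //.
    by rewrite /prefixed ltnNge leq_addr /= addKn.
  by rewrite big_nat_recr //= hs addrC expRD mulrA.
by rewrite !step; field.
Qed.

End Iterates.

(** * Tails of the coupling and variations of the potential *)

Section Tails.
Context {R : realType} (J : nat -> R).
Context (J_ge0 : forall k, 0 <= J k).
Context (J_summable : (\sum_(0 <= k <oo) (J k)%:E < +oo)%E).
Implicit Types (d : nat -> R).

Definition tail (a : nat) : R := limn (fun N => \sum_(0 <= l < N) J (a + l)%N).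

Definition tail_sum (a : nat) d : R := limn (fun N => \sum_(0 <= l < N) J (a + l)%N * d l).

Let nd (u : nat -> R) : (forall l, 0 <= u l) ->
  {homo (fun N => \sum_(0 <= l < N) u l) : n m / (n <= m)%N >-> n <= m}.
Proof.
move=> u0 n m nm; rewrite (@big_cat_nat _ _ _ n 0 m) //= lerDl sumr_ge0 // => i _; exact: u0.
Qed.

Lemma sum_shift (u : nat -> R) a N : \sum_(0 <= l < N) u (a + l)%N = \sum_(a <= k < a + N) u k.
Proof. by rewrite -{2}[a]add0n big_addn addKn; apply: eq_bigr => i _; rewrite addnC. Qed.

Lemma is_cvg_tail a : cvgn (fun N => \sum_(0 <= l < N) J (a + l)%N).
Proof.
have cJ := nnseries_is_cvg J_ge0 J_summable.
apply: nondecreasing_is_cvgn; first by apply: nd.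
exists (limn (series J)) => _ [N _ <-].
apply: le_trans (nondecreasing_cvgn_le (nd J_ge0) cJ (a + N)%N).
rewrite sum_shift (@big_cat_nat _ _ _ a 0 (a + N)) ?leq_addr //= lerDr sumr_ge0 //.
Qed.

Lemma tail_ge_sum a N : \sum_(0 <= l < N) J (a + l)%N <= tail a.
Proof. by have := nondecreasing_cvgn_le (nd (fun l => J_ge0 (a + l)%N)) (@is_cvg_tail a) N. Qed.

Lemma tail_ge0 a : 0 <= tail a.
Proof. by apply: le_trans (tail_ge_sum a 0); rewrite big_geq. Qed.

Lemma is_cvg_tail_sum a d : bnd d -> cvgn (fun N => \sum_(0 <= l < N) J (a + l)%N * d l).
Proof.
move=> [M hM]; apply: normed_cvg; apply: (@series_le_cvg _ _ (fun l => M * J (a + l)%N)).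
- by move=> n; rewrite normr_ge0.
- by move=> n; rewrite mulr_ge0 //; apply: le_trans (hM 0%N).
- by move=> n; rewrite /= normrM ger0_norm // mulrC ler_wpM2r.
rewrite (_ : series _ = fun N => M * \sum_(0 <= l < N) J (a + l)%N).
  by apply: is_cvgMr; exact: is_cvg_tail.
by apply/funext => N; rewrite /series /= big_distrr.
Qed.

Lemma tail_sumB a d d' : bnd d -> bnd d' ->
  tail_sum a d - tail_sum a d' = tail_sum a (fun l => d l - d' l).
Proof.
move=> bd bd'; rewrite /tail_sum -limB; try exact: is_cvg_tail_sum.
congr (limn _); apply/funext => N; rewrite !fctE -sumrB.
by apply: eq_bigr => l _; rewrite mulrBr.
Qed.

Lemma tail_sum_split u a : bnd u ->
  limn (fun N => \sum_(1 <= j < N) J j * u j) =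
    \sum_(1 <= j < a.+1) J j * u j + tail_sum a.+1 (fun l => u (a.+1 + l)%N).
Proof.
move=> bu; apply: cvg_lim => //; rewrite -(cvg_shiftn a.+1).
rewrite (_ : [sequence _]_n = fun N => \sum_(1 <= j < a.+1) J j * u j +
   \sum_(0 <= l < N) J (a.+1 + l)%N * u (a.+1 + l)%N).
  apply: cvgD; first exact: cvg_cst.
  apply: is_cvg_tail_sum; case: bu => M hM; by exists M.
apply/funext => N /=; rewrite (sum_shift (fun k => J k * u k)) addnC.
by rewrite (@big_cat_nat _ _ _ a.+1) // leq_addr.
Qed.

Lemma tail_sum_le a m d M : (forall l, `|d l| <= M) -> (forall l, (l < m)%N -> d l = 0) ->
  `|tail_sum a d| <= M * tail (a + m).
Proof.
move=> dM d0; have M0 : 0 <= M by apply: le_trans (dM 0%N).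
have bd : bnd d by exists M.
have h N : `|\sum_(0 <= l < N) J (a + l)%N * d l| <= M * tail (a + m).
  have [mN|Nm] := leqP m N; last first.
    rewrite big1_seq ?normr0 ?mulr_ge0 ?tail_ge0 // => l /andP[_].
    by rewrite mem_index_iota => /andP[_ lN]; rewrite d0 ?mulr0 // (ltn_trans lN).
  rewrite (@big_cat_nat _ _ _ m) //= big1_seq ?add0r; last first.
    by move=> l /andP[_]; rewrite mem_index_iota => /andP[_ lN]; rewrite d0 ?mulr0.
  apply: le_trans (ler_norm_sum _ _ _) _.
  apply: (@le_trans _ _ (\sum_(m <= l < N) M * J (a + l)%N)).
    by apply: ler_sum => l _; rewrite normrM ger0_norm // mulrC ler_wpM2r.
  rewrite -big_distrr /= ler_wpM2l //; apply: le_trans (tail_ge_sum (a + m) (N - m)).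
  rewrite -{1}[m]add0n big_addn le_eqVlt; apply/orP; left; apply/eqP; apply: eq_bigr => i _.
  by rewrite addnAC addnA.
rewrite ler_norml; apply/andP; split.
  by apply: limr_ge; [exact: is_cvg_tail_sum|apply: nearW => N; have := h N; rewrite ler_norml => /andP[]].
by apply: limr_le; [exact: is_cvg_tail_sum|apply: nearW => N; have := h N; rewrite ler_norml => /andP[]].
Qed.

Lemma bnd_spin (x : nat -> bool) (h : nat -> nat) : bnd (fun l => spin (x (h l)) : R).
Proof. by exists 1 => l; case: (@spin_pm R (x (h l))) => ->; rewrite ?normrN normr1. Qed.

Lemma phi_split x a : phi J x =
  spin (x 0%N) * (\sum_(1 <= j < a.+1) J j * spin (x j) +
                  tail_sum a.+1 (fun l => spin (x (a.+1 + l)%N))).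
Proof. by rewrite /phi (tail_sum_split a (u := fun j => spin (x j))) //; exact: (bnd_spin x id). Qed.

(** The all-plus configuration and the one that is minus from n + 1 on differ by twice the tail.
    This turns the hypothesis on variations into square summability of the tails. *)
Lemma var_phi n : ((2 * tail n.+1)%:E <= var n.+1 (phi J))%E.
Proof.
apply: ereal_sup_ubound.
exists (fun=> true), (fun i => (i < n.+1)%N); split; first by move=> i ->.
rewrite !(phi_split _ n) !mul1r opprD addrACA.
rewrite [X in X + _](_ : _ = 0) ?add0r; last first.
  rewrite -sumrB big1_seq // => j /andP[_]; rewrite mem_index_iota => /andP[_ ->].
  by rewrite subrr.
have E1 : tail_sum n.+1 (fun l => spin true) = tail n.+1.
  by congr (limn _); apply/funext => N; apply: eq_bigr => l _; rewrite mulr1.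
have E2 : tail_sum n.+1 (fun l => spin ((n.+1 + l < n.+1)%N)) = - tail n.+1.
  rewrite /tail -limN; last exact: is_cvg_tail.
  congr (limn _); apply/funext => N; rewrite !fctE -sumrN; apply: eq_bigr => l _.
  by rewrite ltnNge leq_addr /= mulrN1.
rewrite E1 E2 opprK ger0_norm ?addr_ge0 ?tail_ge0 //; congr (_%:E); ring.
Qed.

Context (phi_sqvar : (\sum_(0 <= n <oo) var n (phi J) ^+ 2 < +oo)%E).

Lemma tail_square_summable : exists Q, forall N, \sum_(0 <= n < N) tail n.+1 ^+ 2 <= Q.
Proof.
have v0 n : (0 <= var n (phi J) ^+ 2)%E by apply: sqre_ge0.
exists (fine (\sum_(0 <= n <oo) var n (phi J) ^+ 2)%E) => N.
rewrite -lee_fin fineK; last by rewrite ge0_fin_numE // nneseries_ge0.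
apply: le_trans (nneseries_lim_ge N.+1 _) => //.
rewrite big_nat_recl //= -sumEFin -[leLHS]add0e; apply: leeD; first exact: v0.
apply: lee_sum => n _; rewrite EFin_expe.
have t0 : (0 <= (tail n.+1)%:E)%E by rewrite lee_fin tail_ge0.
have h : ((tail n.+1)%:E <= var n.+1 (phi J))%E.
  by apply: le_trans (var_phi n); rewrite lee_fin ler_peMl ?tail_ge0 // ler1n.
by rewrite lee_sqr // (le_trans t0).
Qed.

Lemma tail_square_small (eps : R) : 0 < eps -> exists m, forall N,
  \sum_(0 <= n < N) tail (m + n).+1 ^+ 2 <= eps.
Proof.
move=> e0; have [Q hQ] := tail_square_summable.
have hn := nd (fun l => sqr_ge0 (tail l.+1)).
have cv : cvgn (fun N => \sum_(0 <= n < N) tail n.+1 ^+ 2).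
  by apply: nondecreasing_is_cvgn => //; exists Q => _ [N _ <-].
have /cvgrPdist_le/(_ _ e0)[m _ hm] := cv.
exists m => N; have := hm m (leqnn m).
have := nondecreasing_cvgn_le hn cv (m + N)%N.
rewrite (@big_cat_nat _ _ _ m 0 (m + N)) ?leq_addr //= -(sum_shift (fun n => tail n.+1 ^+ 2) m N).
by rewrite ler_norml; lra.
Qed.

End Tails.

(** * The modulus of continuity *)

Lemma avg_local {R : realType} {I : eqType} (l A : seq I) (f : (I -> bool) -> R) x x' :
  (forall y y', (forall i, i \in A -> y i = y' i) -> f y = f y') ->
  (forall i, i \in A -> i \notin l -> x i = x' i) -> avg l f x = avg l f x'.
Proof.
move=> hf; elim: l x x' => [|i l IH] x x' xx' /=; first by apply: hf => i /xx'; apply.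
rewrite /avg1; congr ((_ + _) / _); apply: IH => j jA jl; rewrite /upd;
  by case: eqVneq => // ji; apply: xx' => //; rewrite inE negb_or ji.
Qed.

Section Modulus.
Context {R : realType} (J : nat -> R) (beta : R).
Context (J_ge0 : forall k, 0 <= J k) (J0 : J 0%N = 0) (beta_ge0 : 0 <= beta).
Context (J_summable : (\sum_(0 <= k <oo) (J k)%:E < +oo)%E).
Context (phi_sqvar : (\sum_(0 <= n <oo) var n (phi J) ^+ 2 < +oo)%E).
Context (chi : R) (chi_ge0 : 0 <= chi).
Context (chi_corr : forall (V : seq int) w, uniq V -> w \in V ->
    \sum_(z <- V) corr (coupling J beta) V w z <= chi).
Implicit Types (x y : config nat).

Let psi x := beta * phi J x.

Definition half_coupling (i j : nat) : R := coupling J beta (Posz i) (Posz j).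

(* The field exerted on [k < n] by the configuration [x] placed on n, n + 1, etc. *)
Definition right_field n x (k : nat) : R := beta * tail_sum J (n - k) (fun l => spin (x l)).

Lemma sum_iota n (F : nat -> R) : \sum_(i <- iota 0 n) F i = \sum_(0 <= i < n) F i.
Proof. by rewrite /index_iota subn0. Qed.

Lemma hamK_half n y : hamK half_coupling (iota 0 n) y =
  \sum_(0 <= k < n) \sum_(1 <= j < n - k) beta * J j * (spin (y k) * spin (y (k + j)%N)).
Proof.
pose F (i j : nat) : R := if (i < j)%N then half_coupling i j * (spin (y i) * spin (y j)) else 0.
have h : \sum_(i <- iota 0 n) \sum_(j <- iota 0 n) half_coupling i j * (spin (y i) * spin (y j)) =
    \sum_(i <- iota 0 n) \sum_(j <- iota 0 n) F i j + \sum_(i <- iota 0 n) \sum_(j <- iota 0 n) F j i.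
  rewrite -big_split; apply: eq_bigr => i _; rewrite -big_split; apply: eq_bigr => j _ /=.
  rewrite /F /half_coupling /coupling; case: (ltngtP i j) => /= [ij|ij|->].
  - by rewrite addr0.
  - by rewrite add0r distnC; ring.
  by rewrite distnn J0 mulr0 mul0r addr0.
rewrite hamKE h [X in _ + X]exchange_big /= -/F.
rewrite (_ : _ * _ = \sum_(i <- iota 0 n) \sum_(j <- iota 0 n) F i j); last by field.
rewrite sum_iota; apply: eq_big_nat => k /andP[_ kn]; rewrite sum_iota.
rewrite (@big_cat_nat _ _ _ k.+1) //= big1_seq ?add0r; last first.
  by move=> j /andP[_]; rewrite mem_index_iota ltnS /F => /andP[_ jk]; rewrite ltnNge jk.
rewrite -{1}[k.+1]add1n big_addn; apply: eq_big_nat => j /andP[j1 _].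
rewrite /F -{1}[k]add0n ltn_add2r j1 /half_coupling /coupling addnC.
by congr (_ * J _ * _); lia.
Qed.

(** The k-th summand collects the pairs whose left end is [k]: those with right end below [n] form
    the energy of the interval, the others the field of [x]. *)
Lemma birkhoff n x y : (forall l, y (n + l)%N = x l) ->
  \sum_(0 <= k < n) psi (shift_by k y) =
  hamK half_coupling (iota 0 n) y + \sum_(k <- iota 0 n) right_field n x k * spin (y k).
Proof.
move=> yx; rewrite hamK_half (sum_iota n (fun k => right_field n x k * spin (y k))) -big_split; apply: eq_big_nat => k /andP[_ kn] /=.
have [a aE] : exists a, (n - k = a.+1)%N by exists (n - k).-1; rewrite prednK // subn_gt0.
rewrite /psi (phi_split J_ge0 J_summable _ a) /right_field aE /shift_by addn0.
rewrite (_ : (fun l => spin (y (k + (a.+1 + l))%N)) = fun l => spin (x l)); last first.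
  by apply/funext => l; rewrite addnA -aE subnKC ?yx // ltnW.
rewrite mulrDr mulrDr; congr (_ + _); last by ring.
by rewrite !big_distrr; apply: eq_bigr => j _ /=; ring.
Qed.

Lemma iter_transfer1 n x : iter n (transfer psi) (fun=> 1) x =
  2 ^+ n * mean (iota 0 n) (fun y => expR (hamK half_coupling (iota 0 n) y +
    \sum_(k <- iota 0 n) right_field n x k * spin (y k))).
Proof.
rewrite iter_transferE; congr (_ * _).
rewrite (@avg_eqx _ _ _ _ (fun y => expR (hamK half_coupling (iota 0 n) y +
    \sum_(k <- iota 0 n) right_field n x k * spin (y k)))); last first.
  move=> y hy; rewrite mulr1 (birkhoff (x := x)) // => l.
  by rewrite hy ?mem_iota ?add0n -?leqNgt ?leq_addr // /prefixed ltnNge leq_addr /= addKn.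
apply: (@avg_local _ _ _ (iota 0 n)) => [y y' yy'|i -> //].
rewrite !hamKE; congr expR; congr (_ * _ + _).
  by apply: eq_big_seq => i ii; apply: eq_big_seq => j jj; rewrite !yy'.
by apply: eq_big_seq => i ii; rewrite yy'.
Qed.

Lemma right_field_le n x k : `|right_field n x k| <= beta * tail J (n - k).
Proof.
rewrite /right_field normrM ger0_norm // ler_wpM2l //.
rewrite -[X in tail J X]addn0 -[leRHS]mul1r; apply: tail_sum_le => // l.
by case: (@spin_pm R (x l)) => ->; rewrite ?normrN normr1.
Qed.

Lemma right_fieldB n m x x' k : (forall i, (i < m)%N -> x i = x' i) ->
  `|right_field n x' k - right_field n x k| <= 2 * beta * tail J (n - k + m).
Proof.
move=> xx'; rewrite /right_field -mulrBr normrM ger0_norm // [2 * beta]mulrC -mulrA ler_wpM2l //.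
rewrite tail_sumB //; try exact: (bnd_spin _ id).
apply: tail_sum_le => // l; last by move=> lm; rewrite xx' // subrr.
apply: le_trans (ler_normB _ _) _.
by case: (@spin_pm R (x l)) => ->; case: (@spin_pm R (x' l)) => ->; rewrite ?normrN !normr1.
Qed.

Lemma sum_tail_rev n m : \sum_(i <- iota 0 n) tail J (n - i + m) ^+ 2 =
  \sum_(0 <= l < n) tail J (m + l).+1 ^+ 2.
Proof.
rewrite sum_iota big_nat_rev; apply: eq_big_nat => i /andP[_ lin].
by congr (tail J _ ^+ 2); lia.
Qed.

(** The interval is viewed inside Z through [Posz], where the bound [chi] holds for every finite
    set. *)
Lemma half_corr_sum n i : i \in iota 0 n ->
  \sum_(j <- iota 0 n) corr half_coupling (iota 0 n) i j <= chi.
Proof.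
move=> lin; have inj : injective Posz by move=> ? ? [].
have := @chi_corr (map Posz (iota 0 n)) (Posz i).
rewrite map_inj_uniq // iota_uniq map_f // big_map => /(_ isT isT).
apply: le_trans; rewrite le_eqVlt; apply/orP; left; apply/eqP; apply: eq_bigr => j _.
by rewrite (corr_map (K := half_coupling)).
Qed.

(** In the bilinear form of [field_perturbation] one factor is a difference of fields, small for
    large [m], the other only a bounded field. Young's inequality with weight [t] separates them,
    and the row sums of the kernel are at most [chi] (Schur's test). *)
Lemma iter_transfer1_le n m x x' (t : R) : 0 < t -> (forall i, (i < m)%N -> x i = x' i) ->
  iter n (transfer psi) (fun=> 1) x' <= iter n (transfer psi) (fun=> 1) x *
   expR (beta ^+ 2 * chi * (t * \sum_(0 <= l < n) tail J (m + l).+1 ^+ 2 +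
                            t^-1 * \sum_(0 <= l < n) tail J l.+1 ^+ 2)).
Proof.
move=> t0 xx'; rewrite !iter_transfer1 -mulrA ler_wpM2l ?exprn_ge0 //.
have K0 i j : 0 <= half_coupling i j by apply: coupling_ge0.
have KC i j : half_coupling i j = half_coupling j i by apply: coupling_sym.
apply: le_trans (field_perturbation (iota 0 n) (right_field n x) K0 (right_field_le n x')) _.
apply: ler_wpM2l; first by apply: mean_ge0 => y _; exact: expR_ge0.
rewrite ler_expR -(sum_tail_rev n m) -[X in t^-1 * X](sum_tail_rev n 0).
set l := iota 0 n; set C := corr half_coupling l.
have C0 i j : 0 <= C i j by apply: corr_ge0.
pose a i := tail J (n - i + m); pose c j := tail J (n - j).
apply: (@le_trans _ _ (\sum_(i <- l) \sum_(j <- l) beta ^+ 2 * (t * a i ^+ 2 + t^-1 * c j ^+ 2) * C i j)).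
  apply: ler_sum => i _; apply: ler_sum => j _.
  apply: (@le_trans _ _ (2 * beta * a i * (beta * c j * C i j))).
    apply: ler_wpM2r; first by apply: mulr_ge0 => //; apply: mulr_ge0 => //; exact: tail_ge0.
    exact: right_fieldB.
  rewrite (_ : _ * _ = beta ^+ 2 * (2 * a i * c j) * C i j); last by ring.
  apply: ler_wpM2r => //; apply: ler_wpM2l; first exact: sqr_ge0.
  (* The square behind 2 a c <= t a^2 + c^2 / t. *)
  rewrite -subr_ge0 (_ : _ - _ = t^-1 * (t * a i - c j) ^+ 2).
    by rewrite mulr_ge0 ?sqr_ge0 // invr_ge0 ltW.
  by field; rewrite gt_eqF.
rewrite (_ : \sum_(i <- l) _ = beta ^+ 2 * (t * \sum_(i <- l) a i ^+ 2 * (\sum_(j <- l) C i j) +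
   t^-1 * \sum_(j <- l) c j ^+ 2 * (\sum_(i <- l) C i j))); last first.
  rewrite !big_distrr /= [X in _ = _ * (_ + X)](eq_bigr (fun j => \sum_(i <- l) t^-1 * c j ^+ 2 * C i j)); last first.
    by move=> j _; rewrite big_distrr /= big_distrr; apply: eq_bigr => i _ /=; rewrite mulrA.
  rewrite [X in _ = _ * (_ + X)]exchange_big -big_split big_distrr; apply: eq_bigr => i _ /=.
  rewrite mulrA big_distrr -big_split big_distrr; apply: eq_bigr => j _ /=; ring.
rewrite -mulrA; apply: ler_wpM2l; first exact: sqr_ge0.
rewrite mulrDr; apply: lerD; rewrite mulrCA; apply: ler_wpM2l; rewrite ?invr_ge0 ?(ltW t0) //.
  rewrite big_distrr !big_seq; apply: ler_sum => i il /=; rewrite mulrC ler_wpM2r ?sqr_ge0 //.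
  exact: half_corr_sum.
rewrite big_distrr !big_seq; apply: ler_sum => j jl /=; rewrite addn0 mulrC ler_wpM2r ?sqr_ge0 //.
under eq_bigr => i _ do rewrite /C corrC //.
exact: half_corr_sum.
Qed.

Lemma modulus (eps : R) : 0 < eps -> exists m, forall n x x', (forall i, (i < m)%N -> x i = x' i) ->
  iter n (transfer psi) (fun=> 1) x' <= iter n (transfer psi) (fun=> 1) x * expR eps.
Proof.
move=> e0; have [Q hQ] := tail_square_summable J_ge0 J_summable phi_sqvar.
have Q0 : 0 <= Q by apply: le_trans (hQ 0%N); rewrite big_geq.
pose D := beta ^+ 2 * chi + 1; have b2 : 0 <= beta ^+ 2 * chi by rewrite mulr_ge0 ?sqr_ge0.
have D0 : 0 < D by rewrite ltr_wpDl.
(* This [t] brings the term in [t^-1] below eps/2; afterwards [m] is chosen so that the term in [t]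
   is at most eps/2. The + 1 in [D] and in [Q + 1] only ensures positivity. *)
pose t := 2 * D * (Q + 1) / eps.
have Q1 : 0 < Q + 1 by rewrite ltr_wpDl.
have t0 : 0 < t by rewrite divr_gt0 // !mulr_gt0.
have d0 : 0 < eps / (2 * D * t) by apply: divr_gt0 => //; apply: mulr_gt0 => //; apply: mulr_gt0.
have [m hm] := tail_square_small J_ge0 J_summable phi_sqvar d0.
exists m => n x x' xx'; apply: le_trans (iter_transfer1_le n t0 xx') _.
apply: ler_wpM2l.
  rewrite iter_transfer1 mulr_ge0 ?exprn_ge0 //; apply: mean_ge0 => y _; exact: expR_ge0.
rewrite ler_expR; apply: (@le_trans _ _ (D * (t * (eps / (2 * D * t)) + t^-1 * Q))).
  apply: ler_pM => //.
  - by rewrite addr_ge0 // mulr_ge0 ?invr_ge0 ?(ltW t0) // sumr_ge0 // => l _; exact: sqr_ge0.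
  - by rewrite /D lerDl.
  by apply: lerD; apply: ler_wpM2l; rewrite ?invr_ge0 ?(ltW t0).
rewrite (_ : _ * _ = eps / 2 + (eps / 2) * (Q / (Q + 1))); last first.
  by rewrite /t; field; rewrite !gt_eqF.
have : Q / (Q + 1) <= 1 by rewrite ler_pdivrMr // mul1r lerDl.
nra.
Qed.

(** No agreement is required ([m] = 0), and [t] = 1: a bounded distortion over the whole space. *)
Lemma modulus0 : exists2 W, 0 <= W & forall n x x',
  iter n (transfer psi) (fun=> 1) x' <= iter n (transfer psi) (fun=> 1) x * expR W.
Proof.
have [Q hQ] := tail_square_summable J_ge0 J_summable phi_sqvar.
have Q0 : 0 <= Q by apply: le_trans (hQ 0%N); rewrite big_geq.
have b2 : 0 <= beta ^+ 2 * chi by rewrite mulr_ge0 ?sqr_ge0.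
exists (beta ^+ 2 * chi * (Q + Q)); first by rewrite mulr_ge0 ?addr_ge0.
move=> n x x'; apply: le_trans (@iter_transfer1_le n 0 x x' 1 ltr01 _) _ => //.
apply: ler_wpM2l.
  rewrite iter_transfer1 mulr_ge0 ?exprn_ge0 //; apply: mean_ge0 => y _; exact: expR_ge0.
by rewrite ler_expR invr1 !mul1r; apply: ler_wpM2l => //; apply: lerD.
Qed.

End Modulus.

(** * The eigenfunction *)

Lemma ulim_close {R : realType} (U : set_system nat) (UU : UltraFilter U) (a : nat -> R) w e :
  bnd a -> (\near U, `|a U - w| <= e) -> `|ulim U a - w| <= e.
Proof.
move=> ba h; rewrite ler_norml; apply/andP; split.
  rewrite lerBrDr -(ulim_cst UU (- e + w)); apply: ulim_le => //; first exact: bnd_cst.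
  by apply: filterS h => n; rewrite ler_norml => /andP[]; rewrite lerBrDr.
rewrite lerBlDr -(ulim_cst UU (e + w)); apply: ulim_le => //; first exact: bnd_cst.
by apply: filterS h => n; rewrite ler_norml => /andP[_]; rewrite lerBlDr.
Qed.

Section TransferOps.
Context {R : realType} (psi : config nat -> R).
Implicit Types (f g : config nat -> R).

Lemma transfer_le f g x : (forall y, f y <= g y) -> transfer psi f x <= transfer psi g x.
Proof. by move=> fg; rewrite !transferE; apply: lerD; rewrite ler_wpM2l ?expR_ge0. Qed.

Lemma transferZ c f x : transfer psi (fun y => c * f y) x = c * transfer psi f x.
Proof. by rewrite !transferE; ring. Qed.

Lemma transferB f g x : transfer psi (fun y => f y - g y) x = transfer psi f x - transfer psi g x.
Proof. by rewrite !transferE; ring. Qed.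

Lemma transfer_sum (F : nat -> config nat -> R) N x :
  transfer psi (fun y => \sum_(0 <= n < N) F n y) x = \sum_(0 <= n < N) transfer psi (F n) x.
Proof.
rewrite transferE !big_distrr -big_split; apply: eq_bigr => n _ /=.
by rewrite transferE.
Qed.

Lemma iter_transfer_le n f g x : (forall y, f y <= g y) ->
  iter n (transfer psi) f x <= iter n (transfer psi) g x.
Proof. by move=> fg; elim: n x => [|n IH] x //=; apply: transfer_le. Qed.

Lemma iter_transferZ n c f x :
  iter n (transfer psi) (fun y => c * f y) x = c * iter n (transfer psi) f x.
Proof.
elim: n x => [|n IH] x //=; rewrite -transferZ; congr (transfer psi _ x).
exact/funext.
Qed.

Lemma iter_transfer_gt0 n x : 0 < iter n (transfer psi) (fun=> 1) x.
Proof.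
by elim: n x => [|n IH] x /=; rewrite ?ltr01 // transferE addr_gt0 // mulr_gt0 ?expR_gt0.
Qed.

End TransferOps.

Section Perron.
Context {R : realType} (psi : config nat -> R).
Context (modulus : forall eps : R, 0 < eps -> exists m, forall n x x',
  (forall i, (i < m)%N -> x i = x' i) ->
  iter n (transfer psi) (fun=> 1) x' <= iter n (transfer psi) (fun=> 1) x * expR eps).
Context (W : R) (W0 : 0 <= W) (distortion : forall n x x',
  iter n (transfer psi) (fun=> 1) x' <= iter n (transfer psi) (fun=> 1) x * expR W).
Implicit Types (x : config nat).

Let A n x := iter n (transfer psi) (fun=> 1) x.

Let x0 : config nat := fun=> true.

Let a n := ln (A n x0).

Let A_gt0 n x : 0 < A n x. Proof. exact: iter_transfer_gt0. Qed.

(** By bounded distortion the inner iterate is constant up to the factor exp W, and a constant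
    factors out of the outer one. *)
Lemma log_growth_subadditive m n : a (m + n) <= a m + a n + W.
Proof.
rewrite /a -[W]expRK -!lnM ?posrE ?mulr_gt0 ?expR_gt0 // ler_ln ?posrE ?mulr_gt0 ?expR_gt0 //.
rewrite /A iterD -mulrA [A m x0 * _]mulrC -iter_transferZ.
by apply: iter_transfer_le => y; rewrite mulr1; exact: distortion.
Qed.

Lemma log_growth_superadditive m n : a m + a n <= a (m + n) + W.
Proof.
rewrite /a -[W]expRK -!lnM ?posrE ?mulr_gt0 ?expR_gt0 // ler_ln ?posrE ?mulr_gt0 ?expR_gt0 //.
rewrite /A iterD [leLHS]mulrC [leRHS]mulrC -!iter_transferZ.
by apply: iter_transfer_le => y; rewrite mulr1 mulrC; exact: distortion.
Qed.

Lemma log_growth_mul k n : k%:R * (a n - W) <= a (k * n) /\ a (k * n) <= k%:R * (a n + W).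
Proof.
elim: k => [|k [IH1 IH2]]; first by rewrite !mul0r /a /A /= ln1.
have := log_growth_subadditive n (k * n); have := log_growth_superadditive n (k * n).
by rewrite mulSn -natr1 !mulrDl !mul1r; lra.
Qed.

(** A quantitative form of Fekete's lemma: m (a_n - W) <= a_(mn) <= n (a_m + W) puts every lower
    quotient below every upper one, and [ell] is the supremum of the lower ones. *)
Lemma growth_rate : exists ell, forall n, a n - W <= n%:R * ell /\ n%:R * ell <= a n + W.
Proof.
have cmp n m : m%:R * (a n - W) <= n%:R * (a m + W).
  by apply: le_trans (log_growth_mul m n).1 _; rewrite mulnC; exact: (log_growth_mul n m).2.
pose E := [set (a n.+1 - W) / n.+1%:R | n in [set: nat]].
have ubE m : ubound E ((a m.+1 + W) / m.+1%:R).
  by move=> _ [n _ <-]; rewrite ler_pdivrMr // mulrAC ler_pdivlMr // mulrC [leRHS]mulrC; exact: cmp.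
exists (sup E) => -[|n]; first by rewrite mul0r /a /A /= ln1 sub0r add0r oppr_le0.
split.
  rewrite mulrC -ler_pdivrMr //; apply: sup_upper_bound; last by exists n.
  by split; [exists ((a n.+1 - W) / n.+1%:R); exists n|exists ((a 1 + W) / 1%:R); exact: (ubE 0%N)].
rewrite mulrC -ler_pdivlMr //; apply: sup_le_ub; last exact: ubE.
by exists ((a n.+1 - W) / n.+1%:R); exists n.
Qed.

(** One [W] comes from [growth_rate], the other from moving the base point to [x]. *)
Lemma growth_bounds : exists2 lam, 0 < lam & forall n x,
  expR (- (W + W)) <= A n x / lam ^+ n <= expR (W + W).
Proof.
have [ell hell] := growth_rate; exists (expR ell); first exact: expR_gt0.
move=> n x; have [h1 h2] := hell n.
have p0 : 0 < expR ell ^+ n by rewrite exprn_gt0 // expR_gt0.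
rewrite ler_pdivlMr // ler_pdivrMr // -expRM_natl -!expRD.
have L y : A n y = expR (ln (A n y)) by rewrite lnK ?posrE.
have d1 : ln (A n x) <= a n + W.
  by rewrite /a -[W]expRK -lnM ?posrE ?expR_gt0 // ler_ln ?posrE ?mulr_gt0 ?expR_gt0 //; exact: distortion.
have d2 : a n <= ln (A n x) + W.
  by rewrite /a -[W]expRK -lnM ?posrE ?expR_gt0 // ler_ln ?posrE ?mulr_gt0 ?expR_gt0 //; exact: distortion.
by rewrite L !ler_expR; apply/andP; split; lra.
Qed.

(* The ultralimit of the Cesaro means of [lam ^- n * transfer ^ n 1] inherits
   their uniform modulus of continuity. *)
Theorem perron : exists lam h, [/\ quasilocal h, forall x, 0 < h x &
  forall x, transfer psi h x = lam * h x].
Proof.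
have [lam lam0 hlam] := growth_bounds.
have [U [UU oU]] := @ultraFilterLemma nat \oo _.
pose term n x := A n x / lam ^+ n.
have tb n x : expR (- (W + W)) <= term n x <= expR (W + W) by exact: hlam.
pose c N x := N.+1%:R^-1 * \sum_(0 <= n < N.+1) term n x.
have N0 N : 0 < (N.+1)%:R^-1 :> R by rewrite invr_gt0.
have cst N (k : R) : N.+1%:R^-1 * \sum_(0 <= n < N.+1) k = k.
  by rewrite sumr_const_nat subn0 -[k *+ _]mulr_natl mulKf ?pnatr_eq0.
have cb N x : expR (- (W + W)) <= c N x <= expR (W + W).
  rewrite -{1}(cst N (expR (- (W + W)))) -(cst N (expR (W + W))) /c !ler_pM2l //.
  by apply/andP; split; apply: ler_sum => n _; case/andP: (tb n x).
have bc x : bnd (fun N => c N x).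
  exists (expR (W + W)) => N; have := cb N x; have := expR_gt0 (- (W + W)).
  by rewrite ler_norml; lra.
pose h x := ulim U (fun N => c N x).
have hb x : expR (- (W + W)) <= h x <= expR (W + W).
  rewrite -{1}(ulim_cst UU (expR (- (W + W)))) -(ulim_cst UU (expR (W + W))).
  apply/andP; split; apply: ulim_le => //; try exact: bnd_cst;
    by apply: (@filterS _ U _ setT) => [n _|]; [case/andP: (cb n x)|exact: filterT].
exists lam, h; split.
- move=> eps e0.
  (* The modulus is multiplicative; as [h] is at most exp(2 W), the factor exp d changes it by at
     most [eps]. *)
  pose d := ln (1 + eps / expR (W + W)).
  have e1 : 0 < eps / expR (W + W) by rewrite divr_gt0 // expR_gt0.
  have d0 : 0 < d by rewrite ln_gt0 // ltrDl.
  have ed : expR d = 1 + eps / expR (W + W) by rewrite lnK // posrE addr_gt0.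
  have [m hm] := modulus d0.
  exists (iota 0 m).
  have key x y : agree_on (iota 0 m) x y -> h y <= h x * expR d.
    move=> xy; rewrite mulrC -ulimZ //; apply: ulim_le => //; first exact: bndM (bnd_cst _) (bc x).
    apply: (@filterS _ U _ setT) => [N _|]; last exact: filterT.
    rewrite mulrCA ler_pM2l // big_distrr; apply: ler_sum => n _ /=.
    rewrite /term mulrA ler_pM2r ?invr_gt0 ?exprn_gt0 // mulrC; apply: hm => i im.
    by rewrite xy // mem_iota add0n.
  move=> x y xy; have k1 := key x y xy; have k2 := key y x (fun i iG => esym (xy i iG)).
  move: k1 k2; rewrite ed ler_norml.
  case/andP: (hb x) => _ hx; case/andP: (hb y) => _ hy.
  have X z : h z <= expR (W + W) -> h z * (eps / expR (W + W)) <= eps.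
    by move=> hz; rewrite mulrA ler_pdivrMr ?expR_gt0 // mulrC ler_pM2l.
  by have := X x hx; have := X y hy; rewrite !mulrDr !mulr1; lra.
- by move=> x; apply: lt_le_trans (expR_gt0 _) _; case/andP: (hb x) => h1 _; exact: h1.
move=> x.
(* Applying the operator shifts the Cesaro sum by one index; [err] is the telescoped boundary term,
   of order 1/N. *)
pose err N := N.+1%:R^-1 * (lam * (term N.+1 x - term 0%N x)).
have ce N : expR (psi (cons_conf true x)) * c N (cons_conf true x) +
    expR (psi (cons_conf false x)) * c N (cons_conf false x) = lam * c N x + err N.
  rewrite -transferE [LHS]transferZ transfer_sum /err mulrCA -mulrDr; congr (_ * _).
  rewrite (eq_bigr (fun n => lam * term n.+1 x)); last first.
    move=> n _; rewrite /term.
    rewrite (_ : (fun y => A n y / lam ^+ n) = fun y => (lam ^+ n)^-1 * A n y); last first.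
      by apply/funext => y; rewrite mulrC.
    by rewrite transferZ exprS /A iterS; field; rewrite !gt_eqF // exprn_gt0.
  rewrite -big_distrr -mulrDr; congr (_ * _).
  have := @big_nat_recl R 0 +%R N.+1 0 (fun n => term n x) (leq0n _).
  by rewrite big_nat_recr //= => e; rewrite addrA e; ring.
pose K := lam * (expR (W + W) + expR (W + W)).
have K0 : 0 < K by rewrite mulr_gt0 // addr_gt0 // expR_gt0.
have errK N : `|err N| <= N.+1%:R^-1 * K.
  rewrite /err normrM normrM (ger0_norm (ltW (N0 N))) (ger0_norm (ltW lam0)) ler_pM2l // /K ler_pM2l //.
  have g n : `|term n x| <= expR (W + W).
    by case/andP: (tb n x) => t1 t2; rewrite ger0_norm // (le_trans (expR_ge0 _) t1).
  by apply: le_trans (ler_normB _ _) _; apply: lerD.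
have berr : bnd err.
  exists K => N; apply: le_trans (errK N) _.
  by rewrite ler_piMl ?(ltW K0) // invf_le1 // ler1n.
rewrite transferE /h -!ulimZ // -ulimD; try exact: bndM (bnd_cst _) (bc _).
under [X in ulim U X]funext => N do rewrite ce.
rewrite ulimD //; last exact: bndM (bnd_cst _) (bc _).
apply/eqP; rewrite -subr_eq0 addrAC subrr add0r -normr_le0; apply/ler_addgt0Pl => e e0; rewrite addr0.
rewrite -[ulim U err]subr0; apply: ulim_close => //; apply: oU.
exists (Num.bound (K / e)) => // N /= hN; rewrite subr0; apply: le_trans (errK N) _.
rewrite mulrC ler_pdivrMr // -ler_pdivrMl // mulrC; apply: ltW.
apply: lt_le_trans (archi_boundP _) _; first by rewrite divr_ge0 ?(ltW K0) // ltW.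
by rewrite ler_nat leqW.
Qed.

End Perron.

Section Uniqueness.
Context {R : realType} (psi h : config nat -> R) (lam : R).
Context (h_cont : continuous h) (h_gt0 : forall x, 0 < h x).
Context (h_eigen : forall x, transfer psi h x = lam * h x).
Implicit Types (x : config nat).

Lemma continuous_max (f : config nat -> R) : continuous f -> exists x, forall y, f y <= f x.
Proof.
move=> cf; have ne : [set: config nat] !=set0 by exists (fun=> true).
have [x _ hx] := compact_EVT_max ne (@config_compact nat) (continuous_subspaceT cf).
by exists x => y; apply: hx; rewrite inE.
Qed.

(** At a maximum z of g/h the nonnegative eigenfunction f = c h - g vanishes. A zero of f forces
    zeros at both preimages, so f vanishes on all iterated preimages of z; these are dense, and f is
    continuous. *)
Lemma eigenfunction_unique g : continuous g -> (forall x, transfer psi g x = lam * g x) ->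
  exists c, forall x, g x = c * h x.
Proof.
move=> cg eg.
have cgh : continuous (fun x => g x / h x).
  move=> x; apply: cvgM; first exact: cg.
  by apply: cvgV; [rewrite gt_eqF|exact: h_cont].
have [z hz] := continuous_max cgh; pose c := g z / h z.
exists c; pose f x := c * h x - g x.
have f0 x : 0 <= f x by rewrite subr_ge0 -ler_pdivrMr //; exact: hz.
have ef x : transfer psi f x = lam * f x.
  by rewrite /f transferB transferZ h_eigen eg; ring.
have fz : f z = 0 by rewrite /f /c divfK ?subrr // gt_eqF.
have pre x b : f x = 0 -> f (cons_conf b x) = 0.
  move=> fx; have := ef x; rewrite fx mulr0 transferE => /eqP; rewrite paddr_eq0; last 2 first.
  - by rewrite mulr_ge0 // expR_ge0.
  - by rewrite mulr_ge0 // expR_ge0.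
  by rewrite !mulf_eq0 !expR_eq0 /= => /andP[/eqP ft /eqP ff]; case: b.
have word n (y : config nat) : f (fun i => if (i < n)%N then y i else z (i - n)%N) = 0.
  elim: n y => [|n IH] y.
    by rewrite -fz; congr f; apply/funext => i; rewrite subn0.
  rewrite (_ : (fun i => _) = cons_conf (y 0%N)
     (fun i => if (i < n)%N then y i.+1 else z (i - n)%N)); first by apply: pre; exact: (IH (fun i => y i.+1)).
  by apply/funext => -[|i].
have cf : continuous f.
  by move=> x; apply: cvgB; [apply: cvgM; [exact: cvg_cst|exact: h_cont]|exact: cg].
suff fy y : f y = 0 by move=> y; apply/esym/eqP; rewrite -subr_eq0; apply/eqP/fy.
apply/eqP; rewrite -normr_le0; apply/ler_addgt0Pl => e e0; rewrite addr0.
have /cvgrPdist_le/(_ _ e0) := cf y.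
move=> /agree_nbhs[G hG].
pose n := (\max_(i <- G) i).+1.
have := hG (fun i => if (i < n)%N then y i else z (i - n)%N).
rewrite /= word subr0; apply => i iG; rewrite ifT // ltnS.
exact: (leq_bigmax_seq (F := id)).
Qed.

End Uniqueness.

(** * The spectral radius *)

Section ComplexNorm.
Local Open Scope complex_scope.
Context {R : realType}.
Implicit Types (z w : R[i]).

Definition nc z : R := Normc.normc z.

Lemma ncE z : `|z| = (nc z)%:C. Proof. by []. Qed.

Lemma nc_ge0 z : 0 <= nc z.
Proof. by case: z => a b; exact: sqrtr_ge0. Qed.

Lemma ncD z w : nc (z + w) <= nc z + nc w.
Proof. exact: le_normcD. Qed.

Lemma ncM z w : nc (z * w) = nc z * nc w.
Proof. exact: Normc.normcM. Qed.

Lemma ncN z : nc (- z) = nc z.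
Proof. exact: normcN. Qed.

Lemma ncB z w : nc (z - w) <= nc z + nc w.
Proof. by rewrite -(ncN w); exact: ncD. Qed.

Lemma nc0 : nc 0 = 0. Proof. exact: Normc.normc0. Qed.

Lemma nc_real (a : R) : nc a%:C = `|a|.
Proof. by rewrite /nc /= expr0n addr0 sqrtr_sqr. Qed.

Lemma ncX z n : nc (z ^+ n) = nc z ^+ n.
Proof. by elim: n => [|n IH]; rewrite ?exprS ?ncM ?IH // !expr0; exact: Normc.normc1. Qed.

Lemma ncV z : nc z^-1 = (nc z)^-1.
Proof. exact: Normc.normcV. Qed.

Lemma nc_Re z : `|complex.Re z| <= nc z.
Proof.
case: z => a b; rewrite /nc /= -sqrtr_sqr; apply: ler_wsqrtr; rewrite lerDl; exact: sqr_ge0.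
Qed.

Lemma nc_Im z : `|complex.Im z| <= nc z.
Proof.
case: z => a b; rewrite /nc /= -sqrtr_sqr; apply: ler_wsqrtr; rewrite lerDr; exact: sqr_ge0.
Qed.

Lemma nc_ReIm z : nc z <= `|complex.Re z| + `|complex.Im z|.
Proof.
case: z => a b; rewrite /nc /= -[leRHS]ger0_norm ?addr_ge0 // -sqrtr_sqr; apply: ler_wsqrtr.
rewrite sqrrD -[a ^+ 2]real_normK ?num_real // -[b ^+ 2]real_normK ?num_real //.
by rewrite addrAC lerDl mulrn_wge0 // mulr_ge0.
Qed.

Lemma continuousCP {T : topologicalType} (f : T -> R[i]) :
  continuousC f <-> forall x e, 0 < e -> \forall y \near x, nc (f x - f y) <= e.
Proof.
split=> [cf x e e0|h x].
  have /cvgrPdist_le := cf x; move=> /(_ e%:C); rewrite ltcR => /(_ e0).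
  by apply: filterS => y; rewrite [X in X <= _]ncE lecR.
apply/cvgrPdist_le => -[a b]; rewrite ltcE /= => /andP[/eqP -> a0].
by have := h x a a0; apply: filterS => y hy; rewrite [X in X <= _]ncE lecE /= eqxx.
Qed.

Lemma continuousC_Re {T : topologicalType} (f : T -> R[i]) :
  continuousC f -> continuous (fun x => complex.Re (f x)).
Proof.
move=> /continuousCP cf x; apply/cvgrPdist_le => e e0.
apply: filterS (cf x e e0) => y; apply: le_trans; rewrite -raddfB; exact: nc_Re.
Qed.

Lemma continuousC_Im {T : topologicalType} (f : T -> R[i]) :
  continuousC f -> continuous (fun x => complex.Im (f x)).
Proof.
move=> /continuousCP cf x; apply/cvgrPdist_le => e e0.
apply: filterS (cf x e e0) => y; apply: le_trans; rewrite -raddfB; exact: nc_Im.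
Qed.

Lemma continuousC_ReIm {T : topologicalType} (f : T -> R[i]) :
  continuous (fun x => complex.Re (f x)) -> continuous (fun x => complex.Im (f x)) -> continuousC f.
Proof.
move=> cr ci; apply/continuousCP => x e e0; have e2 : 0 < e / 2 by rewrite divr_gt0.
have /cvgrPdist_le/(_ _ e2) hr := cr x; have /cvgrPdist_le/(_ _ e2) hi := ci x.
apply: filterS (filterI hr hi) => y [h1 h2]; apply: le_trans (nc_ReIm _) _.
by rewrite !raddfB [leRHS]splitr; apply: lerD.
Qed.

Lemma continuousC_cst {T : topologicalType} (c : R[i]) : continuousC (fun _ : T => c).
Proof. by move=> x; apply: cvg_cst. Qed.

Lemma continuousCD {T : topologicalType} (f g : T -> R[i]) :
  continuousC f -> continuousC g -> continuousC (fun x => f x + g x).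
Proof. by move=> cf cg x; apply: cvgD; [exact: cf|exact: cg]. Qed.

Lemma continuousCZ {T : topologicalType} (c : R[i]) (f : T -> R[i]) :
  continuousC f -> continuousC (fun x => c * f x).
Proof. by move=> cf x; apply: cvgM; [exact: cvg_cst|exact: cf]. Qed.

Lemma continuousC_bounded (f : config nat -> R[i]) : continuousC f -> exists B, forall x, nc (f x) <= B.
Proof.
move=> cf.
have cn : continuous (fun x => `|complex.Re (f x)| + `|complex.Im (f x)|).
  move=> x; apply: cvgD; apply: cvg_norm; [exact: continuousC_Re|exact: continuousC_Im].
have [z hz] := continuous_max cn; exists (`|complex.Re (f z)| + `|complex.Im (f z)|) => x.
exact: le_trans (nc_ReIm _) (hz x).
Qed.

End ComplexNorm.

Section ComplexUltraLimit.
Local Open Scope complex_scope.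
Context {R : realType} (U : set_system nat) (UU : UltraFilter U).
Implicit Types (a b : nat -> R[i]).

Definition ulimC a : R[i] := Complex (ulim U (fun n => complex.Re (a n))) (ulim U (fun n => complex.Im (a n))).

Definition bndC a := exists M : R, forall n, nc (a n) <= M.

Lemma bndC_Re a : bndC a -> bnd (fun n => complex.Re (a n)).
Proof. by move=> [M hM]; exists M => n; apply: le_trans (nc_Re _) (hM n). Qed.

Lemma bndC_Im a : bndC a -> bnd (fun n => complex.Im (a n)).
Proof. by move=> [M hM]; exists M => n; apply: le_trans (nc_Im _) (hM n). Qed.

Lemma bndCZ c a : bndC a -> bndC (fun n => c * a n).
Proof. by move=> [M hM]; exists (nc c * M) => n; rewrite ncM ler_wpM2l ?nc_ge0. Qed.

Lemma ulimCD a b : bndC a -> bndC b -> ulimC (fun n => a n + b n) = ulimC a + ulimC b.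
Proof.
move=> ba bb; rewrite /ulimC; under eq_fun do rewrite raddfD.
under [X in Complex _ (ulim U X)]eq_fun do rewrite raddfD.
by rewrite !ulimD //; try exact: bndC_Re; exact: bndC_Im.
Qed.

Lemma ulimCZ c a : bndC a -> ulimC (fun n => c * a n) = c * ulimC a.
Proof.
move=> ba; have [br bi] := (bndC_Re ba, bndC_Im ba).
case: c => u v; rewrite /ulimC.
have -> : (fun n => complex.Re (Complex u v * a n)) = fun n => u * complex.Re (a n) + - v * complex.Im (a n).
  by apply/funext => n; case: (a n) => p q /=; rewrite mulNr.
have -> : (fun n => complex.Im (Complex u v * a n)) = fun n => u * complex.Im (a n) + v * complex.Re (a n).
  by apply/funext => n; case: (a n) => p q /=.
rewrite !ulimD ?ulimZ //; try by apply: bndM => //; exact: bnd_cst.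
by apply/eqP; rewrite eq_complex /= mulNr !eqxx.
Qed.

(** The factor 2 arises because real and imaginary part are estimated separately. *)
Lemma ulimC_close a w e : bndC a -> (\near U, nc (a U - w) <= e) -> nc (ulimC a - w) <= 2 * e.
Proof.
move=> ba h; apply: le_trans (nc_ReIm _) _; rewrite mulr_natl mulr2n !raddfB; apply: lerD.
  apply: ulim_close => //; first exact: bndC_Re.
  by apply: filterS h => n; apply: le_trans; rewrite -raddfB; exact: nc_Re.
apply: ulim_close => //; first exact: bndC_Im.
by apply: filterS h => n; apply: le_trans; rewrite -raddfB; exact: nc_Im.
Qed.

Lemma ulimC_eq a w : bndC a -> (forall e, 0 < e -> \near U, nc (a U - w) <= e) -> ulimC a = w.
Proof.
move=> ba h; apply/eqP; rewrite -subr_eq0; apply/eqP/Normc.eq0_normc/eqP.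
rewrite eq_le nc_ge0 andbT; apply/ler_addgt0Pl => e e0; rewrite addr0.
have e2 : 0 < e / 2 by rewrite divr_gt0.
by apply: le_trans (ulimC_close ba (h _ e2)) _; rewrite mulrC divfK.
Qed.

End ComplexUltraLimit.

Section Spectrum.
Local Open Scope complex_scope.
Context {R : realType} (psi h : config nat -> R) (lam : R).
Context (psi_cont : continuous psi) (h_cont : continuous h) (h_gt0 : forall x, 0 < h x).
Context (h_eigen : forall x, transfer psi h x = lam * h x).
Implicit Types (f g : config nat -> R[i]) (x : config nat).

Let A := transferC psi.

Lemma transferCE f x : A f x = (expR (psi (cons_conf true x)))%:C * f (cons_conf true x) +
                     (expR (psi (cons_conf false x)))%:C * f (cons_conf false x).
Proof. by rewrite /A /transferC sum_preimage. Qed.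

Lemma eigenvalue_gt0 : 0 < lam.
Proof.
pose x : config nat := fun=> true.
rewrite -(pmulr_lgt0 _ (h_gt0 x)) -h_eigen transferE.
by rewrite addr_gt0 // mulr_gt0 // expR_gt0.
Qed.

Lemma transferC_lin (c : R[i]) f g x : A (fun t => c * f t + g t) x = c * A f x + A g x.
Proof. by rewrite !transferCE; ring. Qed.

Lemma iter_transferC_lin n (c : R[i]) f g x :
  iter n A (fun t => c * f t + g t) x = c * iter n A f x + iter n A g x.
Proof.
elim: n x => [|n IH] x //=; rewrite -transferC_lin; congr (A _ x); exact/funext.
Qed.

Lemma iter_transferCZ n (c : R[i]) f x : iter n A (fun t => c * f t) x = c * iter n A f x.
Proof.
elim: n x => [|n IH] x; first by [].
rewrite !iterS !transferCE !IH; ring.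
Qed.

(** A function bounded by B is dominated by (B / min h) h, and the positive operator multiplies this
    majorant by [lam] at each step. *)
Lemma transferC_growth : exists2 C, 0 <= C & forall f B, (forall t, nc (f t) <= B) ->
  forall n x, nc (iter n A f x) <= C * B * lam ^+ n.
Proof.
have cV : continuous (fun x => (h x)^-1).
  by move=> x; apply: cvgV; [rewrite gt_eqF|exact: h_cont].
have [u hu] := continuous_max h_cont; have [v hv] := continuous_max cV.
(* [h v] is the minimum of [h], since [v] maximizes its inverse: the constant is max h / min h. *)
exists ((h v)^-1 * h u) => [|f B fB n x]; first by apply: ltW; rewrite mulr_gt0 // invr_gt0.
have B0 : 0 <= B by apply: le_trans (nc_ge0 _) (fB (fun=> true)).
have lam0 := ltW eigenvalue_gt0.
suff H : nc (iter n A f x) <= B / h v * lam ^+ n * h x.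
  apply: le_trans H _; rewrite (_ : _ / h v * _ * _ = (h v)^-1 * h x * B * lam ^+ n); last by ring.
  by rewrite ler_wpM2r ?exprn_ge0 // ler_wpM2r // ler_wpM2l // invr_ge0 ltW.
elim: n x => [|n IH] x /=.
  apply: le_trans (fB x) _; rewrite mulr1 -mulrA ler_peMr // mulrC -ler_pdivrMl // mulr1; exact: hv.
rewrite transferCE; apply: le_trans (ncD _ _) _; rewrite !ncM !nc_real !ger0_norm ?expR_ge0 //.
rewrite exprSr mulrA -[leRHS]mulrA -h_eigen transferE mulrDr.
by apply: lerD; rewrite [leRHS]mulrCA; apply: ler_wpM2l; rewrite ?expR_ge0.
Qed.

Lemma continuous_cons b : continuous (cons_conf b : config nat -> config nat).
Proof.
move=> x V /agree_nbhs[G hG].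
apply: filterS (nbhs_agree [seq i.-1 | i <- G] x) => y hy; apply: hG => -[|i] iG //=.
by apply: hy; apply/mapP; exists i.+1.
Qed.

Lemma continuous_transfer (f : config nat -> R) : continuous f -> continuous (transfer psi f).
Proof.
move=> cf; rewrite (_ : transfer psi f = fun x => expR (psi (cons_conf true x)) * f (cons_conf true x) +
   expR (psi (cons_conf false x)) * f (cons_conf false x)); last by apply/funext => x; rewrite transferE.
have H b : continuous (fun x => expR (psi (cons_conf b x)) * f (cons_conf b x)).
  move=> x; apply: cvgM.
    apply: (@continuous_comp _ _ _ (psi \o cons_conf b) expR); last exact: continuous_expR.
    by apply: continuous_comp; [exact: continuous_cons|exact: psi_cont].
  by apply: (@continuous_comp _ _ _ (cons_conf b) f); [exact: continuous_cons|exact: cf].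
by move=> x; apply: cvgD; apply: H.
Qed.

Lemma transferC_continuous f : continuousC f -> continuousC (A f).
Proof.
move=> cf; apply: continuousC_ReIm.
  rewrite (_ : (fun x => _) = transfer psi (fun x => complex.Re (f x))).
    exact/continuous_transfer/continuousC_Re.
  apply/funext => x; rewrite transferE transferCE raddfD.
  by case: (f _) => p q; case: (f _) => r s /=; rewrite !mul0r !subr0.
rewrite (_ : (fun x => _) = transfer psi (fun x => complex.Im (f x))).
  exact/continuous_transfer/continuousC_Im.
apply/funext => x; rewrite transferE transferCE raddfD.
by case: (f _) => p q; case: (f _) => r s /=; rewrite !mul0r !addr0.
Qed.

Lemma iter_transferC_continuous n f : continuousC f -> continuousC (iter n A f).
Proof. move=> cf; elim: n => [|n IH]; [exact: cf|exact: transferC_continuous IH]. Qed.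

(** An inverse of lam - A would send 0 = (lam - A) h to [h], whereas linearity sends 0 to 0. *)
Lemma eigenvalue_spectrum : spectrum A lam%:C.
Proof.
move=> [S [[_ linS _] S1 _]].
pose hC : config nat -> R[i] := fun t => (h t)%:C.
have chC : continuousC hC.
  by apply: continuousC_ReIm => //=; move=> x; apply: cvg_cst.
pose x : config nat := fun=> true.
have := S1 hC chC x.
rewrite (_ : (fun t => _) = fun=> 0); last first.
  apply/funext => t; rewrite transferCE /hC -!rmorphM -rmorphD /= -transferE h_eigen.
  by rewrite rmorphM subrr.
have c0 : continuousC (fun _ : config nat => 0 : R[i]) by exact: continuousC_cst.
have := linS 1 _ _ c0 c0 x; rewrite (_ : (fun t => _) = fun=> 0); last first.
  by apply/funext => t; rewrite mulr0 addr0.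
rewrite mul1r -{1}[S _ x]addr0 => /addrI <- /eqP.
by rewrite /hC eq_sym fmorph_eq0 gt_eqF.
Qed.

Section Resolvent.
Context (z : R[i]) (lam_z : lam < nc z).

Let z_gt0 : 0 < nc z. Proof. exact: lt_trans eigenvalue_gt0 lam_z. Qed.

Let z0 : z != 0.
Proof. by apply: contraTneq z_gt0 => ->; rewrite nc0 ltxx. Qed.

Let q := lam / nc z.

Let q_ge0 : 0 <= q. Proof. by rewrite divr_ge0 ?ltW // eigenvalue_gt0. Qed.

Let q_lt1 : q < 1. Proof. by rewrite /q ltr_pdivrMr // mul1r. Qed.

Definition neumann n f x : R[i] := \sum_(0 <= k < n) z ^- k.+1 * iter k A f x.

Lemma geometric_block n m : \sum_(n <= k < m) q ^+ k <= q ^+ n / (1 - q).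
Proof.
rewrite ler_pdivlMr ?subr_gt0 //.
have [nm|mn] := leqP n m; last by rewrite big_geq ?mul0r ?exprn_ge0 // ltnW.
rewrite big_distrl /= (eq_bigr (fun k => - (q ^+ k.+1 - q ^+ k))); last by move=> k _; rewrite exprS; ring.
by rewrite sumrN telescope_sumr // opprB gerBl exprn_ge0.
Qed.

Lemma neumann_bound : exists2 D, 0 <= D & forall f B, (forall t, nc (f t) <= B) ->
  [/\ forall n m x, (n <= m)%N -> nc (neumann m f x - neumann n f x) <= D * B * q ^+ n &
      forall n x, nc (z ^- n * iter n A f x) <= D * B * q ^+ n].
Proof.
have [C C0 hC] := transferC_growth.
(* One constant for both claims: the 1 serves the remainder [z ^- n * iter n A f], the other summand
   the geometric tail of the series. *)
pose D := C * (1 + (nc z)^-1 / (1 - q)).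
have p0 : 0 <= (nc z)^-1 / (1 - q) by rewrite ltW // divr_gt0 ?invr_gt0 ?subr_gt0.
exists D; first by rewrite mulr_ge0 // addr_ge0.
move=> f B fB; have B0 : 0 <= B by apply: le_trans (nc_ge0 _) (fB (fun=> true)).
have hq n x : nc (z ^- n * iter n A f x) <= C * B * q ^+ n.
  rewrite ncM ncV ncX /q expr_div_n mulrC mulrA ler_pM2r ?invr_gt0 ?exprn_gt0 //.
  exact: hC.
split=> [n m x nm|n x]; last first.
  apply: le_trans (hq n x) _; rewrite ler_wpM2r ?exprn_ge0 // ler_wpM2r //.
  by rewrite /D ler_peMr // lerDl.
rewrite /neumann (@big_cat_nat _ _ _ n 0 m) //= addrAC subrr add0r.
apply: (@le_trans _ _ (\sum_(n <= k < m) (nc z)^-1 * C * B * q ^+ k)).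
  elim/big_ind2: _ => [|u a v b ha hb|k _]; first by rewrite nc0.
    by apply: le_trans (ncD _ _) _; apply: lerD.
  have -> : z ^- k.+1 * iter k A f x = z^-1 * (z ^- k * iter k A f x) by rewrite exprS invfM mulrA.
  rewrite ncM ncV -!mulrA ler_pM2l ?invr_gt0 // !mulrA.
  exact: hq.
rewrite -big_distrr /=; apply: (@le_trans _ _ ((nc z)^-1 * C * B * (q ^+ n / (1 - q)))).
  by rewrite ler_wpM2l ?geometric_block // !mulr_ge0 // invr_ge0 ltW.
rewrite (_ : (nc z)^-1 * C * B * _ = C * ((nc z)^-1 / (1 - q)) * B * q ^+ n); last by ring.
by rewrite ler_wpM2r ?exprn_ge0 // ler_wpM2r // ler_wpM2l // lerDr.
Qed.

Lemma neumann_lin n (c : R[i]) f g x :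
  neumann n (fun t => c * f t + g t) x = c * neumann n f x + neumann n g x.
Proof.
rewrite /neumann big_distrr -big_split; apply: eq_bigr => k _ /=.
by rewrite iter_transferC_lin; ring.
Qed.

Lemma neumannS n f x : neumann n.+1 f x = neumann n f x + z ^- n.+1 * iter n A f x.
Proof. by rewrite /neumann big_nat_recr. Qed.

Lemma neumann_telescope_l n f x :
  neumann n (fun t => z * f t - A f t) x = f x - z ^- n * iter n A f x.
Proof.
elim: n => [|n IH]; first by rewrite /neumann big_geq // expr0 invr1 mul1r subrr.
rewrite neumannS IH.
have -> : iter n A (fun t => z * f t - A f t) x = z * iter n A f x - iter n.+1 A f x.
  rewrite (_ : (fun t => z * f t - A f t) = fun t => -1 * A f t + z * f t).
    by rewrite iter_transferC_lin iter_transferCZ iterSr mulN1r addrC.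
  by apply/funext => t; rewrite mulN1r addrC.
by rewrite exprS; field; rewrite z0 expf_neq0.
Qed.

Lemma neumann_telescope_r n f x :
  z * neumann n f x - A (neumann n f) x = f x - z ^- n * iter n A f x.
Proof.
elim: n => [|n IH].
  rewrite /neumann big_geq // expr0 invr1 mul1r subrr mulr0 sub0r.
  rewrite transferCE !big_geq // !mulr0 addr0 oppr0 //.
rewrite neumannS (_ : A (neumann n.+1 f) x = z ^- n.+1 * iter n.+1 A f x + A (neumann n f) x).
  rewrite mulrDr; have -> : z * neumann n f x = f x - z ^- n * iter n A f x + A (neumann n f) x.
    by rewrite -IH subrK.
  by rewrite exprS; field; rewrite z0 expf_neq0.
rewrite -transferC_lin; congr (A _ x); apply/funext => t; by rewrite neumannS addrC.
Qed.

Lemma geometric_small (D e : R) : 0 <= D -> 0 < e -> exists N, forall n, (N <= n)%N -> D * q ^+ n <= e.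
Proof.
move=> D0 e0; have hq : `|q| < 1 by rewrite ger0_norm.
have e1 : 0 < e / (D + 1) by rewrite divr_gt0 // ltr_wpDl.
have /cvgrPdist_le/(_ _ e1)[N _ hN] := cvg_expr hq.
exists N => n /hN /=; rewrite sub0r normrN ger0_norm ?exprn_ge0 // => h1.
apply: (@le_trans _ _ (D * (e / (D + 1)))); first by rewrite ler_wpM2l.
by rewrite mulrA ler_pdivrMr ?ltr_wpDl // mulrC ler_pM2l // lerDl.
Qed.

Lemma neumann_continuous n f : continuousC f -> continuousC (neumann n f).
Proof.
move=> cf; elim: n => [|n IH].
  rewrite (_ : neumann 0 f = fun=> 0); first exact: continuousC_cst.
  by apply/funext => x; rewrite /neumann big_geq.
have G := continuousCD IH (@continuousCZ _ _ (z ^- n.+1) _ (@iter_transferC_continuous n f cf)).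
by rewrite (funext (neumannS n f)); exact: G.
Qed.

(* The resolvent is taken as an ultralimit of Neumann sums, so that only the
   estimate on their tails is needed. *)
Lemma resolvent : ~ spectrum A z.
Proof.
have [D D0 hD] := neumann_bound.
have [U [UU oU]] := @ultraFilterLemma nat \oo _.
have near_oo (P : nat -> Prop) : (exists N, forall n, (N <= n)%N -> P n) -> \near U, P U.
  by move=> [N hN]; apply: oU; exists N.
pose S f x := ulimC U (fun n => neumann n f x).
have n0 f x : neumann 0 f x = 0 by rewrite /neumann big_geq.
have bN f B x : (forall t, nc (f t) <= B) -> forall n, nc (neumann n f x) <= D * B.
  move=> fB n; have [h1 _] := hD f B fB; have := h1 0%N n x (leq0n n).
  by rewrite n0 subr0 mulr1.
have bNC f x : continuousC f -> bndC (fun n => neumann n f x).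
  by move=> /continuousC_bounded[B hB]; exists (D * B); exact: bN.
have SN f B x n : continuousC f -> (forall t, nc (f t) <= B) ->
    nc (S f x - neumann n f x) <= 2 * (D * B * q ^+ n).
  move=> cf fB; have [h1 _] := hD f B fB.
  by apply: ulimC_close; [exact: bNC|apply: near_oo; exists n => m nm; exact: h1].
have telescoped f B x (a : nat -> R[i]) : (forall t, nc (f t) <= B) ->
    (forall n, a n = f x - z ^- n * iter n A f x) ->
    forall e, 0 < e -> \near U, nc (a U - f x) <= e.
  move=> fB aE e e0; have [_ h2] := hD f B fB.
  have DB : 0 <= D * B by rewrite mulr_ge0 //; apply: le_trans (nc_ge0 _) (fB (fun=> true)).
  have [N hN] := geometric_small DB e0.
  apply: near_oo; exists N => n /hN hn; rewrite aE addrAC subrr add0r ncN.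
  exact: le_trans (h2 n x) hn.
suff P : exists S, [/\ bounded_operator S,
        forall f : config nat -> R[i], continuousC f ->
          forall x, S (fun t => z * f t - A f t) x = f x &
        forall f : config nat -> R[i], continuousC f ->
          forall x, z * S f x - A (S f) x = f x] by apply.
exists S; split.
- split.
  + move=> f cf; have [B fB] := continuousC_bounded cf.
    apply/continuousCP => x e e0.
    have DB : 0 <= 2 * (D * B) by rewrite !mulr_ge0 //; apply: le_trans (nc_ge0 _) (fB (fun=> true)).
    (* The usual three-term argument for a uniform limit: e/4 at each of the two points, e/2 for the
       Neumann sum. *)
    have e4 : 0 < e / 4 by rewrite divr_gt0.
    have e2 : 0 < e / 2 by rewrite divr_gt0.
    have [N hN] := geometric_small DB e4; have {hN} := hN N (leqnn N); rewrite -mulrA => hN.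
    have /continuousCP/(_ x _ e2) := @neumann_continuous N f cf.
    apply: filterS => y hy.
    rewrite (_ : S f x - S f y = (S f x - neumann N f x) + (neumann N f x - neumann N f y)
       - (S f y - neumann N f y)); last by ring.
    apply: le_trans (ncB _ _) _; apply: le_trans (lerD (ncD _ _) (lexx _)) _.
    have := SN f B x N cf fB; have := SN f B y N cf fB; lra.
  + move=> c f g cf cg x; rewrite /S -ulimCZ; last exact: bNC.
    rewrite -ulimCD; [|exact/bndCZ/bNC|exact: bNC].
    by congr ulimC; apply/funext => n; rewrite neumann_lin.
  + exists (2 * D) => f B cf fB x; rewrite -mulrA.
    by have := SN f B x 0%N cf fB; rewrite n0 subr0 mulr1.
- move=> f cf x; have [B fB] := continuousC_bounded cf.
  have cg : continuousC (fun t => z * f t - A f t).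
    rewrite (_ : (fun t => _) = fun t => z * f t + -1 * A f t); last first.
      by apply/funext => t; rewrite mulN1r.
    exact: (continuousCD (@continuousCZ _ _ z _ cf) (@continuousCZ _ _ (-1) _ (transferC_continuous cf))).
  apply: ulimC_eq; first exact: bNC.
  by apply: telescoped fB _ => n; exact: neumann_telescope_l.
move=> f cf x; have [B fB] := continuousC_bounded cf.
(* The ultralimit passes through [A] because [A] is a sum of two terms at each point. *)
transitivity (ulimC U (fun n => z * neumann n f x + -1 * A (neumann n f) x)).
  have bA b : bndC (fun n => (expR (psi (cons_conf b x)))%:C * neumann n f (cons_conf b x)).
    exact/bndCZ/bNC.
  under [X in ulimC U X]eq_fun => n do rewrite transferCE mulrDr.
  have bA' b : bndC (fun n => -1 * ((expR (psi (cons_conf b x)))%:C * neumann n f (cons_conf b x))).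
    exact/bndCZ/bA.
  have bD : bndC (fun n => -1 * ((expR (psi (cons_conf true x)))%:C * neumann n f (cons_conf true x))
     + -1 * ((expR (psi (cons_conf false x)))%:C * neumann n f (cons_conf false x))).
    have [M hM] := bA' true; have [M' hM'] := bA' false; exists (M + M') => n.
    by apply: le_trans (ncD _ _) _; apply: lerD.
  rewrite !ulimCD //; try exact/bndCZ/bNC.
  rewrite !ulimCZ //; try exact: bNC.
  by rewrite transferCE /S mulN1r mulN1r opprD.
apply: ulimC_eq.
  have [M hM] := bndCZ z (bNC f x cf).
  exists (nc (f x) + D * B) => n.
  rewrite mulN1r neumann_telescope_r; apply: le_trans (ncB _ _) _; apply: lerD => //.
  have [_ h2] := hD f B fB; apply: le_trans (h2 n x) _.
  rewrite ler_piMr ?exprn_ile1 ?(ltW q_lt1) // mulr_ge0 //.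
  by apply: le_trans (nc_ge0 _) (fB (fun=> true)).
by apply: telescoped fB _ => n; rewrite mulN1r neumann_telescope_r.
Qed.

End Resolvent.

Theorem spectral_radius_transfer : spectral_radius A = lam.
Proof.
have lamE : Normc.normc lam%:C = lam.
  by rewrite -/(nc _) nc_real gtr0_norm // eigenvalue_gt0.
have ub : ubound [set Normc.normc z | z in spectrum A] lam.
  move=> _ [z hz <-]; rewrite leNgt; apply/negP => h1; exact: (@resolvent z).
have inS : [set Normc.normc z | z in spectrum A] lam.
  by exists lam%:C; [exact: eigenvalue_spectrum|exact: lamE].
apply/eqP; rewrite eq_le; apply/andP; split.
  by apply: sup_le_ub => //; exists lam.
by apply: sup_upper_bound => //; split; [exists lam|exists lam].
Qed.

End Spectrum.

Lemma quasilocal_phi {R : realType} (J : nat -> R) :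
  (forall k, 0 <= J k) -> (\sum_(0 <= k <oo) (J k)%:E < +oo)%E ->
  (\sum_(0 <= n <oo) var n (phi J) ^+ 2 < +oo)%E -> quasilocal (phi J).
Proof.
move=> J_ge0 Js sq e e0.
have e2 : 0 < (e / 2) ^+ 2 by rewrite exprn_gt0 // divr_gt0.
have [m hm] := tail_square_small J_ge0 Js sq e2.
have tm : tail J m.+1 <= e / 2.
  have := hm 1%N; rewrite big_nat1 addn0 => h.
  by rewrite -(ler_pXn2r (n := 2)) // nnegrE ?tail_ge0 // divr_ge0 // ltW.
exists (iota 0 m.+1) => x y xy.
have xyl j : (j < m.+1)%N -> y j = x j by move=> jm; apply: xy; rewrite mem_iota.
rewrite !(phi_split J_ge0 Js _ m) xyl //.
rewrite (_ : \sum_(1 <= j < m.+1) J j * spin (y j) = \sum_(1 <= j < m.+1) J j * spin (x j)); last first.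
  by apply: eq_big_nat => j /andP[_ jm]; rewrite xyl.
have T z : `|tail_sum J m.+1 (fun l => spin (z (m.+1 + l)%N))| <= e / 2.
  have z1 l : `|spin (z (m.+1 + l)%N) : R| <= 1.
    by case: (@spin_pm R (z (m.+1 + l)%N)) => ->; rewrite ?normrN normr1.
  have := @tail_sum_le _ _ J_ge0 Js m.+1 0 _ 1 z1.
  by rewrite mul1r addn0 => /(_ (fun l l0 => False_ind _ (notF l0)))/le_trans; apply.
rewrite -mulrBr opprD addrACA subrr add0r normrM.
have -> : `|spin (x 0%N) : R| = 1 by case: (@spin_pm R (x 0%N)) => ->; rewrite ?normrN normr1.
rewrite mul1r [leRHS]splitr; apply: le_trans (ler_normB _ _) _; exact: lerD.
Qed.

Theorem theorem2 (R : realType) (J : nat -> R)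
  (J_ge0 : forall k, 0 <= J k) (J0 : J 0%N = 0)
  (J_summable : (\sum_(0 <= k <oo) (J k)%:E < +oo)%E)
  (phi_sqvar : (\sum_(0 <= n <oo) var n (phi J) ^+ 2 < +oo)%E)
  (beta : R) (beta_ge0 : 0 <= beta)
  (beta_lt : (beta%:E < critical_value J)%E) :
  let psi := fun x => beta * phi J x in
  let lambda := spectral_radius (transferC psi) in
  exists h : config nat -> R,
    [/\ continuous h,
        exists x, h x <> 0,
        forall x, transfer psi h x = lambda * h x &
        forall g : config nat -> R, continuous g ->
          (forall x, transfer psi g x = lambda * g x) ->
          exists c : R, forall x, g x = c * h x].
Proof.
move=> psi lambda.
have [chi chi0 hchi] := subcritical_susceptibility J_ge0 J0 J_summable beta_ge0 beta_lt.
have md := modulus J_ge0 J0 beta_ge0 J_summable phi_sqvar chi0 hchi.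
have [W W0 hW] := modulus0 J_ge0 J0 beta_ge0 J_summable phi_sqvar chi0 hchi.
have [lam [h [qh h_gt0 eh]]] := perron md W0 hW.
have ch : continuous h by exact: quasilocal_continuous.
have cpsi : continuous psi.
  by move=> x; apply: cvgM; [exact: cvg_cst|exact/quasilocal_continuous/quasilocal_phi].
have lamE : lambda = lam by exact: spectral_radius_transfer eh.
rewrite lamE; exists h; split => //; last exact: eigenfunction_unique.
by exists (fun=> true); apply/eqP; rewrite gt_eqF.
Qed.
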